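(* Let $\Omega\subset\mathbb{R}^2$ be a simply connected Lipschitz domain and let $\{\mathcal{J}_h\}$ be a regular, asymptotically parallelogram family of convex quadrilateral grids of $\Omega$. For $\zeta\in(H^1(\Omega))^2$ and $v_h\in V_h^{\rm QBL}$ set $$E(\zeta,v_h)=\sum_{K\in\mathcal{J}_h}\int_K\zeta\cdot\nabla v_h\,dx+\int_\Omega(\mathrm{div}\,\zeta)\,v_h\,dx.$$ Then, with a constant $C$ independent of $h$, $$E(\zeta,v_h)\le Ch\|\zeta\|_{1,\Omega}|v_h|_{1,h}$$ whenever either $\zeta\in(H^1(\Omega))^2$ and $v_h\in V_{h0}^{\rm QBL}$, or $\zeta\in(H^1_0(\Omega))^2$ and $v_h\in V_h^{\rm QBL}$.
   Context: Grids: $\Omega$ is the union of the cells of $\mathcal{J}_h$, which are convex quadrilaterals, and two distinct cells that intersect share exactly one vertex or one whole edge; $h_K=\mathrm{diam}\,K$, $h=\max_Kh_K$. Local coordinates: for a convex quadrilateral $K$ with vertices $A_1,\dots,A_4$ (counterclockwise), edges $e_i=A_iA_{i+1}$ (indices mod 4), $m_i$ the midpoint of $e_i$, let $O$ be the common midpoint of $m_1m_3$ and $m_2m_4$, $r=\overrightarrow{Om_4}$, $s=\overrightarrow{Om_1}$ (so $r\times s>0$), and let $\xi,\eta$ be the affine functions with $\xi(O+ar+bs)=a$, $\eta(O+ar+bs)=b$. Regular family: the numbers $\max\{\frac{|r||s|}{r\times s},\frac{|r|}{|s|},\frac{|s|}{|r|}\}$ are uniformly bounded over all cells of all grids of the family.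 Asymptotically parallelogram: there is $\kappa$ such that, for every cell $K$ of every grid, the distance $d_K$ between the midpoints of the two diagonals of $K$ satisfies $d_K\le\kappa h_K^2$. $V_h^{\rm QBL}$ consists of $v_h\in L^2(\Omega)$ with $v_h|_K\in\mathrm{span}\{1,\xi,\eta,\xi\eta\}$ for each cell $K$ that are continuous at the two endpoints of every interior edge; $V_{h0}^{\rm QBL}$ is its subspace of functions vanishing at the two endpoints of every boundary edge. $|v|_{1,h}^2=\sum_K\|\nabla v\|_{0,K}^2$; $\|\cdot\|_{1,\Omega}$ is the $H^1(\Omega)$ norm. *)

(* Defs.v *)
From HB Require Import structures.
From mathcomp Require Import all_boot all_order all_algebra.
From mathcomp Require Import all_classical all_reals all_analysis.
From mathcomp Require Import ring lra.

Set Implicit Arguments.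
Unset Strict Implicit.
Unset Printing Implicit Defensive.

Import Order.TTheory GRing.Theory Num.Theory.
Import numFieldNormedType.Exports.

Local Open Scope classical_set_scope.
Local Open Scope ring_scope.

(** * The Euclidean plane *)

(* The library norm on [R * R] is the max norm; it only provides the topology.
   All metric quantities below are Euclidean. *)
Definition enorm {R : realType} (u : R * R) : R :=
  Num.sqrt (u.1 ^+ 2 + u.2 ^+ 2).

Definition cross {R : realType} (u v : R * R) : R := u.1 * v.2 - u.2 * v.1.

Definition midpoint {R : realType} (p q : R * R) : R * R := 2^-1 *: (p + q).

Definition segment {R : realType} (p q : R * R) : set (R * R) :=
  [set (1 - t) *: p + t *: q | t in `[0, 1]%classic].

Definition diam {R : realType} (A : set (R * R)) : R :=
  sup [set enorm (z.1 - z.2) | z in A `*` A].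

Definition leb2 {R : realType} :
    {measure set (measurableTypeR R * measurableTypeR R) -> \bar R} :=
  (lebesgue_measure \x lebesgue_measure)%E.

(** * Sobolev spaces on an open set [D] *)

Definition basis {R : realType} (i : 'I_2) : R * R :=
  ((i == 0)%:R, (i == 1)%:R).

Definition pderiv {R : realType} (i : 'I_2) (f : R * R -> R) : R * R -> R :=
  fun x => 'D_(basis i) f x.

(* C^oo: all iterated partial derivatives are differentiable everywhere. *)
Definition smooth {R : realType} (f : R * R -> R) : Prop :=
  forall (s : seq 'I_2) (x : R * R), differentiable (foldr pderiv f s) x.

(* C_c^oo(D), each function being extended by 0 outside D. *)
Definition test_fun {R : realType} (D : set (R * R)) (f : R * R -> R) : Prop :=
  [/\ smooth f, compact (closure [set x | f x != 0])
    & closure [set x | f x != 0] `<=` D].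

Definition L2 {R : realType} (D : set (R * R)) (u : R * R -> R) : Prop :=
  measurable_fun D (u : measurableTypeR R * measurableTypeR R -> R) /\
  leb2.-integrable D (fun x => (u x ^+ 2)%:E).

Definition is_weak_pderiv {R : realType} (D : set (R * R)) (i : 'I_2)
    (u g : R * R -> R) : Prop :=
  forall phi, test_fun D phi ->
    \int[leb2]_(x in D) (u x * pderiv i phi x) =
    - \int[leb2]_(x in D) (g x * phi x).

Definition H1 {R : realType} (D : set (R * R)) (u : R * R -> R) : Prop :=
  L2 D u /\ forall i, exists g, L2 D g /\ is_weak_pderiv D i u g.

(* A chosen representative of the weak partial derivative, which is unique up
   to almost everywhere equality; only meaningful for [u] in [H1 D]. *)
Definition wderiv {R : realType} (D : set (R * R)) (i : 'I_2)
    (u : R * R -> R) : R * R -> R :=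
  xget (fun=> 0) [set g | L2 D g /\ is_weak_pderiv D i u g].

Definition sqnorm_L2 {R : realType} (D : set (R * R)) (u : R * R -> R) : R :=
  \int[leb2]_(x in D) (u x ^+ 2).

Definition sqnorm_H1 {R : realType} (D : set (R * R)) (u : R * R -> R) : R :=
  sqnorm_L2 D u + \sum_(i < 2) sqnorm_L2 D (wderiv D i u).

(* H^1_0(D): the closure of C_c^oo(D) in H^1(D). *)
Definition H10 {R : realType} (D : set (R * R)) (u : R * R -> R) : Prop :=
  H1 D u /\ forall e : R, 0 < e ->
    exists2 phi, test_fun D phi &
      Num.sqrt (sqnorm_H1 D (fun x => u x - phi x)) < e.

(* Vector fields are given by their two components. *)
Definition norm_H1v {R : realType} (D : set (R * R))
    (zeta : 'I_2 -> R * R -> R) : R :=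
  Num.sqrt (\sum_(i < 2) sqnorm_H1 D (zeta i)).

Definition wdiv {R : realType} (D : set (R * R))
    (zeta : 'I_2 -> R * R -> R) : R * R -> R :=
  fun x => \sum_(i < 2) wderiv D i (zeta i) x.

(** * Domains *)

(* Near each boundary point x0 there are orthonormal coordinates (s, t), with
   axes (n.2, - n.1) and n, in which D is the epigraph of a Lipschitz
   function. *)
Definition lipschitz_boundary {R : realType} (D : set (R * R)) : Prop :=
  forall x0, (closure D `\` interior D) x0 ->
    exists (n : R * R) (gamma : R -> R) (L a b : R),
      [/\ enorm n = 1, L.-lipschitz gamma, 0 < a, 0 < b &
        forall s t, `|s| < a -> `|t| < b ->
          (D (x0 + s *: (n.2, - n.1) + t *: n) <-> gamma s < t)].

Definition lipschitz_domain {R : realType} (D : set (R * R)) : Prop :=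
  [/\ open D, D !=set0, connected D, bounded_set D & lipschitz_boundary D].

(* Every loop in D contracts to its base point within D; connectedness is part
   of [lipschitz_domain], and open connected sets are path connected. *)
Definition simply_connected {R : realType} (D : set (R * R)) : Prop :=
  forall c : R -> R * R,
    {within `[0, 1], continuous c} -> c 0 = c 1 -> c @` `[0, 1] `<=` D ->
    exists H : R * R -> R * R,
      [/\ {within `[0, 1] `*` `[0, 1], continuous H},
          H @` (`[0, 1] `*` `[0, 1]) `<=` D,
          (forall t, t \in `[0, 1] -> H (0, t) = c t),
          (forall t, t \in `[0, 1] -> H (1, t) = c 0)
        & (forall s, s \in `[0, 1] -> H (s, 0) = c 0 /\ H (s, 1) = c 0)].

(** * Convex quadrilaterals *)

(* Indices live in the ring 'I_4 = Z/4, so that [i + 1] is cyclic.  Vertices are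
   numbered from 0, i.e. A_1, ..., A_4 are [vtx K 0], ..., [vtx K 3].  Four
   strict left turns add up to a total turning angle less than 4 pi, hence equal
   to 2 pi: the quadrilateral is simple, strictly convex and counterclockwise. *)
Record quad (R : realType) := Quad {
  vtx : 'I_4 -> R * R;
  vtx_ccw : forall i,
    0 < cross (vtx (i + 1) - vtx i) (vtx (i + 2) - vtx (i + 1))
}.

Definition cell_set {R : realType} (K : quad R) : set (R * R) :=
  [set x | exists l : 'I_4 -> R, [/\ forall i, 0 <= l i,
     \sum_i l i = 1 & x = \sum_i l i *: vtx K i]].

Definition edge {R : realType} (K : quad R) (i : 'I_4) : set (R * R) :=
  segment (vtx K i) (vtx K (i + 1)).

Definition emid {R : realType} (K : quad R) (i : 'I_4) : R * R :=
  midpoint (vtx K i) (vtx K (i + 1)).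

(* The midpoint of m_1 m_3, which is also that of m_2 m_4 ([qcenterE]). *)
Definition qcenter {R : realType} (K : quad R) : R * R :=
  midpoint (emid K 0) (emid K 2).

Definition qr {R : realType} (K : quad R) : R * R := emid K 3 - qcenter K.
Definition qs {R : realType} (K : quad R) : R * R := emid K 0 - qcenter K.

(* Cramer's formulas for the coordinates in the frame (O, r, s); see
   [qr_qs_gt0], [qxiE] and [qetaE]. *)
Definition qxi {R : realType} (K : quad R) (x : R * R) : R :=
  cross (x - qcenter K) (qs K) / cross (qr K) (qs K).
Definition qeta {R : realType} (K : quad R) (x : R * R) : R :=
  cross (qr K) (x - qcenter K) / cross (qr K) (qs K).

Definition shape_number {R : realType} (K : quad R) : R :=
  let r := qr K in let s := qs K in
  Num.max (enorm r * enorm s / cross r s)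
    (Num.max (enorm r / enorm s) (enorm s / enorm r)).

Definition diag_dist {R : realType} (K : quad R) : R :=
  enorm (midpoint (vtx K 0) (vtx K 2) - midpoint (vtx K 1) (vtx K 3)).

Section QuadSanity.
Context {R : realType} (K : quad R).

Let add01 : 0 + 1 = 1 :> 'I_4. Proof. exact/val_inj. Qed.
Let add11 : 1 + 1 = 2 :> 'I_4. Proof. exact/val_inj. Qed.
Let add21 : 2 + 1 = 3 :> 'I_4. Proof. exact/val_inj. Qed.
Let add31 : 3 + 1 = 0 :> 'I_4. Proof. exact/val_inj. Qed.
Let add02 : 0 + 2 = 2 :> 'I_4. Proof. exact/val_inj. Qed.
Let add22 : 2 + 2 = 0 :> 'I_4. Proof. exact/val_inj. Qed.
Let ord4E := (add01, add11, add21, add31, add02, add22).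

Lemma qcenterE : qcenter K = midpoint (emid K 1) (emid K 3).
Proof.
rewrite /qcenter /emid /midpoint !ord4E.
case: (vtx K 0) (vtx K 1) (vtx K 2) (vtx K 3) => [a1 a2] [b1 b2] [c1 c2] [d1 d2].
by congr pair => /=; rewrite /GRing.scale /=; ring.
Qed.

Lemma qr_qs_gt0 : 0 < cross (qr K) (qs K).
Proof.
have := vtx_ccw K 0; have := vtx_ccw K 2.
rewrite /qr /qs /qcenter /emid /midpoint /cross !ord4E.
case: (vtx K 0) (vtx K 1) (vtx K 2) (vtx K 3) => [a1 a2] [b1 b2] [c1 c2] [d1 d2].
by rewrite /= /GRing.scale /=; lra.
Qed.

Lemma qxiE (a b : R) : qxi K (qcenter K + a *: qr K + b *: qs K) = a.
Proof.
have := qr_qs_gt0; rewrite /qxi => /lt0r_neq0.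
case: (qr K) (qs K) (qcenter K) => [r1 r2] [s1 s2] [p1 p2].
by rewrite /cross /= /GRing.scale /= => ?; field.
Qed.

Lemma qetaE (a b : R) : qeta K (qcenter K + a *: qr K + b *: qs K) = b.
Proof.
have := qr_qs_gt0; rewrite /qeta => /lt0r_neq0.
case: (qr K) (qs K) (qcenter K) => [r1 r2] [s1 s2] [p1 p2].
by rewrite /cross /= /GRing.scale /= => ?; field.
Qed.

End QuadSanity.

(** * Grids *)

Record grid (R : realType) := Grid {
  ncells : nat;
  cell : 'I_ncells -> quad R
}.
Arguments cell {R} g k.

Definition boundary_edge {R : realType} (Omega : set (R * R)) (K : quad R)
    (i : 'I_4) : Prop :=
  edge K i `<=` closure Omega `\` interior Omega.

(* Omega is an open set, so the (closed) cells cover its closure. *)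
Definition is_grid_of {R : realType} (Omega : set (R * R)) (J : grid R) : Prop :=
  closure Omega = \bigcup_k cell_set (cell J k) /\
  forall k l, k != l -> let K := cell J k in let L := cell J l in
    cell_set K `&` cell_set L !=set0 ->
      (exists i j, vtx K i = vtx L j /\
         cell_set K `&` cell_set L = [set vtx K i]) \/
      (exists i j, edge K i = edge L j /\
         cell_set K `&` cell_set L = edge K i).

Definition mesh_size {R : realType} (J : grid R) : R :=
  \big[Num.max/0]_(k < ncells J) diam (cell_set (cell J k)).

Definition regular_family {R : realType} {I : Type} (J : I -> grid R) : Prop :=
  exists sigma : R, forall t k, shape_number (cell (J t) k) <= sigma.

Definition asymptotically_parallelogram {R : realType} {I : Type}
    (J : I -> grid R) : Prop :=
  exists kappa : R, forall t k,
    diag_dist (cell (J t) k) <= kappa * diam (cell_set (cell (J t) k)) ^+ 2.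

(** * The QBL finite element spaces *)

(* The value at a vertex [A] of [K] of the restriction of [v] to [K]. *)
Definition vtrace {R : realType} (K : quad R) (v : R * R -> R) (A : R * R) : R :=
  lim (v x @[x --> within (interior (cell_set K)) (nbhs A)]).

(* Elements of L^2 carry no information on the edges, so that restrictions to a
   cell are understood on its interior, and an interior edge is an edge common
   to two distinct cells, at the endpoints of which both traces must agree. *)
Definition VQBL {R : realType} (Omega : set (R * R)) (J : grid R)
    (v : R * R -> R) : Prop :=
  [/\ L2 Omega v,
      forall k, let K := cell J k in
        exists c0 c1 c2 c3 : R, forall x, interior (cell_set K) x ->
          v x = c0 + c1 * qxi K x + c2 * qeta K x + c3 * (qxi K x * qeta K x)
    & forall k l i j, let K := cell J k in let L := cell J l in
        k != l -> edge K i = edge L j ->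
        vtrace K v (vtx K i) = vtrace L v (vtx K i) /\
        vtrace K v (vtx K (i + 1)) = vtrace L v (vtx K (i + 1))].

Definition VQBL0 {R : realType} (Omega : set (R * R)) (J : grid R)
    (v : R * R -> R) : Prop :=
  VQBL Omega J v /\
  forall k i, let K := cell J k in boundary_edge Omega K i ->
    vtrace K v (vtx K i) = 0 /\ vtrace K v (vtx K (i + 1)) = 0.

(* Cell edges are null sets: integrating over the interiors of the cells, where
   [v] is a polynomial, makes the cellwise gradient a classical one. *)
Definition broken_seminorm {R : realType} (J : grid R) (v : R * R -> R) : R :=
  Num.sqrt (\sum_(k < ncells J)
    \int[leb2]_(x in interior (cell_set (cell J k)))
      (\sum_(i < 2) pderiv i v x ^+ 2)).

Definition consistency {R : realType} (Omega : set (R * R)) (J : grid R)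
    (zeta : 'I_2 -> R * R -> R) (v : R * R -> R) : R :=
  \sum_(k < ncells J)
    \int[leb2]_(x in interior (cell_set (cell J k)))
      (\sum_(i < 2) zeta i x * pderiv i v x)
  + \int[leb2]_(x in Omega) (wdiv Omega zeta x * v x).

(* Main.v *)
(* Let q be the bilinear polynomial equal to v on a cell K, and c its
   xi eta-coefficient.  Along an edge q differs from the affine interpolant of its
   end values by c dx dy t (1 - t), where dx and dy are the increments of xi and eta;
   on a parallelogram dx dy = 0.  Four bubbles, supported in the triangles that join
   the center to the edges, cancel this deviation: w = q + c * bubbles is affine on
   every edge.  As v is continuous at the vertices, the functions w agree on common
   edges, so they glue to a function that is Lipschitz off the vertices, and
   E(zeta, w) = 0 by the weak Green formula, in both cases.  Hence
   E(zeta, v) = E(zeta, v - w).  Here |v - w| <= 32 |c| and, the family being regular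
   and asymptotically parallelogram, |grad (v - w)| <= C |c|, whereas |K| <= 4 h^2
   and the integral of |grad v|^2 over K is at least C^-1 c^2.  The Cauchy-Schwarz
   inequality concludes.

   The weak derivatives are tested on smooth functions only; the Green formula for w
   is obtained by approximating Lipschitz functions that vanish off Omega by smooth
   spline quasi-interpolants with uniformly bounded gradients. *)
Require Import Defs.
From mathcomp Require Import all_boot all_order all_algebra.
From mathcomp Require Import all_classical all_reals all_analysis.
From mathcomp Require Import measurable_realfun.
From mathcomp Require Import ring lra zify.

Set Implicit Arguments.
Unset Strict Implicit.
Unset Printing Implicit Defensive.

Import Order.TTheory GRing.Theory Num.Theory.
Import numFieldNormedType.Exports.

Local Open Scope classical_set_scope.
Local Open Scope ring_scope.


(** * Smooth partition of unity on the line *)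

Section SmoothStep.
Context {R : realType}.
Implicit Types (f g : R -> R) (P : {poly R}).

(** Integrating by parts cell by cell would need traces of [zeta] on the edges. Testing one global
    Lipschitz function that vanishes off [Omega] avoids them. The passage from smooth to Lipschitz
    test functions is by dominated convergence: gradients converge off a null set under a uniform
    bound. A convolution would enlarge supports, whereas an interpolant may drop the nodes near the
    boundary and so keep a compact support in [Omega]. In the first case [w] itself vanishes on the
    boundary. In the second it need not, so [zeta] is approximated by test functions [phi], and the
    constant 1 is tested against [phi * w]. As [wderiv] is a chosen representative, its additivity
    is recovered from pairings with test functions. The definition of the space does not compare
    cells that meet only in a vertex, so vertices are left out of the gluing and segments are routed
    around this finite set. The Lipschitz boundary makes [Omega] the interior of its closure; hence
    a shared edge lies in [Omega] away from vertices, and points off [Omega] are limits of exterior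
    ones. *)

Fixpoint Cn (n : nat) f : Prop :=
  if n is n'.+1 then exists df, (forall x : R, is_derive x (1 : R) f (df x)) /\ Cn n' df
  else True.

Definition smooth1 f := forall n, Cn n f.

Lemma CnS n f : Cn n.+1 f -> Cn n f.
Proof.
elim: n f => [//|n IH] f [df [fdf dfn]].
by exists df; split => //; exact: IH.
Qed.

Lemma CnP n f df : (forall x : R, is_derive x (1 : R) f (df x)) -> Cn n df -> Cn n.+1 f.
Proof. by move=> ? ?; exists df. Qed.

Lemma CnD n f g : Cn n f -> Cn n g -> Cn n (fun x => f x + g x).
Proof.
elim: n f g => [//|n IH] f g [df [fdf dfn]] [dg [gdg dgn]].
apply: (@CnP _ _ (fun x => df x + dg x)); exact: IH.
Qed.

Lemma CnM n f g : Cn n f -> Cn n g -> Cn n (fun x => f x * g x).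
Proof.
elim: n f g => [//|n IH] f g /[dup] /CnS fn [df [fdf dfn]] /[dup] /CnS gn [dg [gdg dgn]].
by apply: (@CnP _ _ (fun x => f x * dg x + g x * df x)); apply: CnD; exact: IH.
Qed.

Lemma Cn_cst n (c : R) : Cn n (fun=> c).
Proof.
elim: n c => [//|n IH] c; exact: (@CnP _ _ (fun=> 0)).
Qed.

Lemma Cn_id n : Cn n (fun x : R => x).
Proof.
by case: n => // n; apply: (@CnP _ _ (fun=> 1)); exact: Cn_cst.
Qed.

Lemma CnV n f : (forall x, f x != 0) -> Cn n f -> Cn n (fun x => (f x)^-1).
Proof.
move=> f0; elim: n => [//|n IH] /[dup] /CnS fn [df [fdf dfn]].
apply: (@CnP _ _ (fun x => - 1 * ((f x)^-1 * (f x)^-1) * df x)).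
  move=> x; have := is_deriveV (f0 x) (fdf x).
  by move=> h; apply: is_derive_eq h _; rewrite /GRing.scale /= mulN1r -exprVn expr2.
apply: CnM => //; apply: CnM; first exact: Cn_cst.
by apply: CnM; exact: IH.
Qed.

Lemma Cn_comp_affine n (a b : R) f : Cn n f -> Cn n (fun x => f (a * x + b)).
Proof.
elim: n f => [//|n IH] f [df [fdf dfn]].
apply: (@CnP _ _ (fun x => df (a * x + b) * a)); last first.
  by apply: CnM; [exact: IH|exact: Cn_cst].
move=> x; have h : is_derive x 1 (fun x : R => a * x + b) a.
  have := is_deriveD (is_deriveM (is_derive_cst a x 1) (is_derive_id x 1)) (is_derive_cst b x 1).
  by move=> /is_derive_eq; apply; rewrite scaler0 /GRing.scale /= !addr0 mulr1.
exact: (is_derive1_comp (fdf _) h).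
Qed.

Lemma smooth1_derive f : smooth1 f ->
  exists df, (forall x : R, is_derive x (1 : R) f (df x)) /\ smooth1 df.
Proof.
move=> fs; have [df [fdf _]] := fs 1%N; exists df; split=> // n.
have [df' [fdf' dfn]] := fs n.+1.
suff -> : df = df' by [].
by apply/funext => x; rewrite -(@derive_val _ _ _ _ _ _ _ (fdf x)) (@derive_val _ _ _ _ _ _ _ (fdf' x)).
Qed.

(* This class of functions, [P] ranging over the polynomials, is stable under
   differentiation (see [is_derive_flat]). *)
Definition flat P (x : R) := if 0 < x then P.[x^-1] * expR (- x^-1) else 0.

Lemma is_derive_sq_bound f (C : R) : f 0 = 0 ->
  (forall h, `|h| < 1 -> `|f h| <= C * `|h| ^+ 2) -> is_derive (0 : R) (1 : R) f 0.
Proof.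
move=> f0 fb; 
suff h : h^-1 *: ((f \o shift 0) (h *: (1 : R)) - f 0) @[h --> 0^'] --> (0 : R).
  by apply: DeriveDef; [exact: cvgP h|exact: cvg_lim h].
apply/cvgrPdist_lt => /= e e0.
have C0 : 0 <= C.
  have := fb (2^-1); rewrite ger0_norm ?invr_ge0// => /(_ _)/=.
  have h2 : (2^-1 : R) < 1 by rewrite invf_lt1 // ltr1n.
  move=> /(_ h2) /(le_trans (normr_ge0 _)).
  by rewrite pmulr_lge0 // exprn_gt0 // invr_gt0.
near=> h.
have h0 : h != 0 by near: h; exact: nbhs_dnbhs_neq.
rewrite sub0r normrN f0 subr0 /= addr0 /GRing.scale /= mulr1 normrM normfV.
have h1 : `|h| < 1.
  near: h; apply: dnbhs0_lt => //.
have h2 : `|h| < e / (C + 1).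
  near: h; apply: dnbhs0_lt => //; rewrite divr_gt0 // ltr_wpDl //.
rewrite ltr_pdivlMr ?ltr_wpDl // in h2.
have h3 : 0 < `|h| by rewrite normr_gt0.
rewrite mulrC ltr_pdivrMr //.
by apply: le_lt_trans (fb h h1) _; nra.
Unshelve. all: by end_near.
Qed.

(** A single term of the exponential series at [x^-1]: the flat factor beats every power of [x]. *)
Lemma expRV_bound (d : nat) (x : R) : 0 < x -> expR (- x^-1) <= d.+1`!%:R * x ^+ d.+1.
Proof.
move=> x0; rewrite expRN.
have h := expR_ge1Dxn d (ltW (_ : 0 < x^-1)).
rewrite -[leRHS]invrK lef_pV2 ?posrE ?expR_gt0 ?invr_gt0 ?mulr_gt0 ?exprn_gt0 ?ltr0n ?fact_gt0 //.
rewrite invfM mulrC -exprVn; apply: le_trans (h _); rewrite ?invr_gt0 //.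
by rewrite lerDr.
Qed.

Lemma flat_bound P : exists C : R, forall h, `|h| < 1 -> `|flat P h| <= C * `|h| ^+ 2.
Proof.
pose S := \sum_(i < size P) `|P`_i|.
have S0 : 0 <= S by apply: sumr_ge0.
exists (S * (size P).+2`!%:R) => h h1; rewrite /flat; case: ifPn => h0; last first.
  by rewrite normr0 mulr_ge0 // ?mulr_ge0 // ?sqr_ge0.
have {h1} : h < 1 by rewrite gtr0_norm in h1.
rewrite (gtr0_norm h0) => h1.
have hP : `|P.[h^-1]| <= S * h^-1 ^+ size P.
  rewrite horner_coef mulr_suml; apply: le_trans (ler_norm_sum _ _ _) _.
  apply: ler_sum => i _; rewrite normrM ler_wpM2l // normrX (@ger0_norm _ h^-1) ?invr_ge0 ?(ltW h0) //.
  by rewrite ler_eXn2l ?invf_gt1 // ltnW.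
rewrite normrM (@ger0_norm _ (expR _)) ?expR_ge0 //.
(* The exponent [size P + 2] absorbs the pole of order [size P] and leaves [h ^+ 2]. *)
apply: le_trans (ler_pM _ _ hP (expRV_bound (size P).+1 h0)) _; rewrite ?expR_ge0 //.
rewrite -2!mulrA ler_wpM2l // exprVn mulrCA ler_wpM2l // -[(size P).+2]addn2 exprD mulKf //.
by rewrite expf_neq0 // gt_eqF.
Qed.

(** For positive x the chain rule in the variable 1/x turns the factor P into X^2 (P - P'). At 0 no
    formula applies, and the quadratic bound of [flat_bound] forces a zero derivative. *)
Lemma is_derive_flat P (x : R) : is_derive (x : R) (1 : R) (flat P) (flat ('X^2 * (P - P^`())) x).
Proof.
have [x0|x0|->] := ltgtP x 0; last first.
- have [C hC] := flat_bound P.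
  have -> : flat ('X^2 * (P - P^`())) 0 = 0 by rewrite /flat ltxx.
  by apply: is_derive_sq_bound hC; rewrite /flat ltxx.
- have h : is_derive (x : R) (1 : R) (fun x => P.[x^-1] * expR (- x^-1)) (flat ('X^2 * (P - P^`())) x).
    have hV : is_derive (x : R) (1 : R) (fun x => x^-1) (- x ^- 2 *: 1).
      by apply: is_deriveV; rewrite gt_eqF.
    have hP := is_derive1_comp (is_derive_poly P x^-1) hV.
    have hE := is_derive1_comp (is_derive_expR _) (is_deriveN hV).
    have hM := is_deriveM hP hE; apply: (is_derive_eq hM).
    rewrite /flat x0 !hornerE /= /GRing.scale /= exprVn; ring.
  apply: near_eq_is_derive h; rewrite ?oner_neq0 //.
  near=> y; rewrite /flat; have -> // : 0 < y.
  by near: y; exact: lt_nbhsr.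
- rewrite {2}/flat ltNge (ltW x0) /=.
  apply: (@near_eq_is_derive _ _ _ (cst 0)); rewrite ?oner_neq0 //.
  near=> y; rewrite /flat ifF //; apply/negbTE; rewrite -leNgt ltW //.
  by near: y; exact: lt_nbhsl.
Unshelve. all: by end_near.
Qed.

Lemma smooth1_flat P : smooth1 (flat P).
Proof.
move=> n; elim: n P => [//|n IH] P.
by apply: (CnP (is_derive_flat P)); exact: IH.
Qed.


Definition smooth_step (x : R) := flat 1 x / (flat 1 x + flat 1 (1 - x)).

Definition ramp (x : R) := x * smooth_step x.

(* The second difference of [ramp] is supported in [-2, 2]; since [ramp] is affine
   off [0, 1], the integer translates of [bspline] reproduce affine functions. *)
Definition bspline (x : R) := ramp (x + 1) - 2 * ramp x + ramp (x - 1).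

Lemma flat1_ge0 (x : R) : 0 <= flat 1 x.
Proof. by rewrite /flat; case: ifP => //; rewrite hornerE mul1r expR_ge0. Qed.

Lemma flat1_gt0 (x : R) : 0 < x -> 0 < flat 1 x.
Proof. by rewrite /flat => ->; rewrite hornerE mul1r expR_gt0. Qed.

Lemma flat1_eq0 (x : R) : x <= 0 -> flat 1 x = 0.
Proof. by rewrite /flat ltNge => ->. Qed.

Lemma smooth_step_den_gt0 (x : R) : 0 < flat 1 x + flat 1 (1 - x).
Proof.
have [x0|x0] := leP x 0; last by rewrite ltr_wpDr ?flat1_ge0 ?flat1_gt0.
by rewrite ltr_wpDl ?flat1_ge0 // flat1_gt0 // subr_gt0 (le_lt_trans x0).
Qed.

Lemma smooth1_ramp : smooth1 ramp.
Proof.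
move=> n; apply: CnM; first exact: Cn_id.
apply: CnM; first exact: smooth1_flat.
apply: CnV; first by move=> x; rewrite gt_eqF // smooth_step_den_gt0.
apply: CnD; first exact: smooth1_flat.
have -> : (fun x => flat 1 (1 - x)) = (fun x => flat 1 (- 1 * x + 1)).
  by apply/funext => x; rewrite mulN1r addrC.
exact/Cn_comp_affine/smooth1_flat.
Qed.

Lemma ramp_le0 (x : R) : x <= 0 -> ramp x = 0.
Proof. by move=> x0; rewrite /ramp /smooth_step flat1_eq0 // mul0r mulr0. Qed.

Lemma ramp_ge1 (x : R) : 1 <= x -> ramp x = x.
Proof.
move=> x1; have x0 : 0 < x by exact: lt_le_trans x1.
rewrite /ramp /smooth_step (@flat1_eq0 (1 - x)) ?subr_le0 // addr0 divff ?mulr1 //.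
by rewrite gt_eqF // flat1_gt0.
Qed.

Lemma smooth1_bspline : smooth1 bspline.
Proof.
move=> n.
have -> : bspline = (fun x => ramp (1 * x + 1) + (-2) * ramp x + ramp (1 * x + -1)).
  by apply/funext => x; rewrite /bspline !mul1r mulNr.
apply: CnD; last exact/Cn_comp_affine/smooth1_ramp.
apply: CnD; first exact/Cn_comp_affine/smooth1_ramp.
by apply: CnM; [exact: Cn_cst|exact: smooth1_ramp].
Qed.

Lemma bspline_eq0 (x : R) : 2 <= `|x| -> bspline x = 0.
Proof.
rewrite /bspline ler_normr => /orP[x2|x2].
  by rewrite !ramp_ge1; lra.
by rewrite !ramp_le0; lra.
Qed.

(** Second differences telescope to the first differences of [ramp] at the two ends; the range of
    [y] places these ends on the affine pieces, of slopes 1 and 0. *)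
Lemma bspline_sum (M : nat) (y : R) : 1 <= y -> y <= M%:R - 1 ->
  \sum_(k < M) bspline (y - k%:R) = 1.
Proof.
move=> y1 yM.
have H (m : nat) : \sum_(k < m) bspline (y - k%:R) =
    (ramp (y + 1) - ramp y) - (ramp (y - m%:R + 1) - ramp (y - m%:R)).
  elim: m => [|m IH]; first by rewrite big_ord0 subr0 subrr.
  rewrite big_ord_recr /= IH /bspline -[m.+1%:R]natr1.
  rewrite (_ : y - (m%:R + 1) + 1 = y - m%:R); last by ring.
  rewrite (_ : y - m%:R - 1 = y - (m%:R + 1)); last by ring.
  by ring.
rewrite H (@ramp_ge1 y) // (@ramp_ge1 (y + 1)) ?ramp_le0; lra.
Qed.

Lemma bspline_sum_id (M : nat) (y : R) : 1 <= y -> y <= M%:R - 1 ->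
  \sum_(k < M) k%:R * bspline (y - k%:R) = y.
Proof.
move=> y1 yM.
have H (m : nat) : \sum_(k < m) k%:R * bspline (y - k%:R) =
    ramp y - ramp (y - m%:R + 1) - (m%:R - 1) * (ramp (y - m%:R + 1) - ramp (y - m%:R)).
  elim: m => [|m IH]; first by rewrite big_ord0 subr0; ring.
  rewrite big_ord_recr /= IH /bspline -[m.+1%:R]natr1.
  rewrite (_ : y - (m%:R + 1) + 1 = y - m%:R); last by ring.
  rewrite (_ : y - m%:R - 1 = y - (m%:R + 1)); last by ring.
  by ring.
rewrite H (@ramp_ge1 y) // ?ramp_le0; lra.
Qed.

Lemma smooth1_continuous f : smooth1 f -> continuous f.
Proof.
move=> /smooth1_derive[df [fdf _]] x; apply: differentiable_continuous.
by apply/derivable1_diffP; have [] := fdf x.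
Qed.

Lemma continuous_support_bounded f (r : R) : continuous f -> (forall x, r < `|x| -> f x = 0) ->
  exists2 B : R, 0 <= B & forall x, `|f x| <= B.
Proof.
move=> fc f0.
have [r0|r0] := ltP r 0.
  exists 0 => // x; rewrite f0 ?normr0 //; exact: lt_le_trans r0 _.
have cf : {within `[- r, r], continuous (fun x => `|f x|)}.
  apply: continuous_subspaceT => x; apply: cvg_norm; exact: fc.
have rr : - r <= r by lra.
have [c _ hc] := EVT_max rr cf.
exists `|f c| => // x; have [xr|xr] := leP `|x| r; last by rewrite f0 ?normr0.
by apply: hc; rewrite in_itv /= -ler_norml.
Qed.

End SmoothStep.

(** * Gradients *)

Section Gradients.
Context {R : realType}.
Implicit Types (f g : R * R -> R) (x : R * R) (u v : R * R).

(** Differentiability bundled with the gradient as a pair, so that the sum, product and chain rules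
    yield both at once. *)
Definition has_grad f x u := is_diff x f (fun h : R * R => u.1 * h.1 + u.2 * h.2).

Lemma has_grad_differentiable f x u : has_grad f x u -> differentiable f x.
Proof. by case. Qed.

Lemma has_gradE f x u i : has_grad f x u -> pderiv i f x = (if i == 0 then u.1 else u.2).
Proof.
move=> h; have df := has_grad_differentiable h.
rewrite /pderiv deriveE // (@diff_val _ _ _ _ _ _ _ h) /basis.
by case: i => -[|[|//]] ? /=; rewrite ?mulr1 ?mulr0 ?addr0 ?add0r.
Qed.

Lemma has_grad_eq f x u v : has_grad f x u -> u = v -> has_grad f x v.
Proof. by move=> ? <-. Qed.

Lemma has_grad_cst (c : R) x : has_grad (fun=> c) x (0, 0).
Proof.
apply: is_diff_eq (is_diff_cst c x) _.
by apply/funext => h /=; rewrite !mul0r addr0.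
Qed.

Lemma has_grad_fst x : has_grad fst x (1, 0).
Proof.
have h : continuous (fst : R * R -> R) by move=> y; exact: cvg_fst.
apply: DiffDef.
  exact: (@linear_differentiable _ _ _ (fst : {linear (R * R)%type -> R}) x h).
rewrite (@diff_lin _ _ _ (fst : {linear (R * R)%type -> R})) //.
by apply/funext => k /=; rewrite mul1r mul0r addr0.
Qed.

Lemma has_grad_snd x : has_grad snd x (0, 1).
Proof.
have h : continuous (snd : R * R -> R) by move=> y; exact: cvg_snd.
apply: DiffDef.
  exact: (@linear_differentiable _ _ _ (snd : {linear (R * R)%type -> R}) x h).
rewrite (@diff_lin _ _ _ (snd : {linear (R * R)%type -> R})) //.
by apply/funext => k /=; rewrite mul1r mul0r add0r.
Qed.

Lemma has_gradD f g x u v : has_grad f x u -> has_grad g x v ->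
  has_grad (fun y => f y + g y) x (u + v).
Proof.
move=> hf hg; apply: is_diff_eq (is_diffD hf hg) _.
by apply/funext => h /=; rewrite !fctE /=; ring.
Qed.

Lemma has_gradM f g x u v : has_grad f x u -> has_grad g x v ->
  has_grad (fun y => f y * g y) x (f x *: v + g x *: u).
Proof.
move=> hf hg; apply: is_diff_eq (is_diffM hf hg) _.
by apply/funext => h /=; rewrite !fctE /= /GRing.scale /=; ring.
Qed.

Lemma has_gradZ (c : R) f x u : has_grad f x u -> has_grad (fun y => c * f y) x (c *: u).
Proof.
move=> hf; apply: has_grad_eq (has_gradM (has_grad_cst c x) hf) _.
by rewrite scaler0 addr0.
Qed.

Lemma has_grad_sum (I : Type) (s : seq I) (F : I -> R * R -> R) (u : I -> R * R) x :
  (forall i, has_grad (F i) x (u i)) ->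
  has_grad (fun y => \sum_(i <- s) F i y) x (\sum_(i <- s) u i).
Proof.
move=> h; elim: s => [|i s IH].
  by rewrite big_nil; under eq_fun do rewrite big_nil; exact: has_grad_cst.
by rewrite big_cons; under eq_fun do rewrite big_cons; exact: has_gradD.
Qed.

Lemma has_grad_comp (h dh : R -> R) f x u : is_derive (f x) (1 : R) h (dh (f x)) ->
  has_grad f x u -> has_grad (fun y => h (f y)) x (dh (f x) *: u).
Proof.
move=> dhx hf.
have hd : is_diff (f x) h (fun k => k * dh (f x)).
  have hdf : differentiable h (f x) by apply/derivable1_diffP; case: dhx.
  apply: DiffDef => //; rewrite diff1E //; apply/funext => k.
  by rewrite derive1E (@derive_val _ _ _ _ _ _ _ dhx).
apply: is_diff_eq (is_diff_comp hf hd) _.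
by apply/funext => k /=; rewrite /GRing.scale /=; ring.
Qed.

(** The epsilon form serves twice: it makes differentiability visibly local, and it is the Taylor
    estimate behind the convergence of the gradients of the interpolants. *)
Lemma has_gradP f x u : has_grad f x u <->
  forall e, 0 < e -> \forall h \near (0 : R * R),
    `|f (h + x) - f x - (u.1 * h.1 + u.2 * h.2)| <= e * `|h|.
Proof.
split=> [hf|hf].
  move=> e e0; have df := has_grad_differentiable hf.
  have /eqaddoP/(_ e e0) := diff_locally df.
  by rewrite (@diff_val _ _ _ _ _ _ _ hf) !fctE; apply: filterS => h /=; rewrite opprD addrA.
(* The candidate linear map is realised as the differential of [F], which supplies the linear and
   continuous structure that uniqueness of differentials asks for. *)
pose F := fun h : R * R => u.1 * h.1 + u.2 * h.2.
have FF : has_grad F 0 u.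
  have := has_gradD (has_gradZ u.1 (has_grad_fst 0)) (has_gradZ u.2 (has_grad_snd 0)).
  move/has_grad_eq; apply; case: u {hf F} => a b /=; congr pair; rewrite /= /GRing.scale /=; ring.
have dF : 'd F 0 = F :> (R * R -> R) by rewrite (@diff_val _ _ _ _ _ _ _ FF).
have cF : continuous 'd F 0 by apply: diff_continuous; exact: has_grad_differentiable FF.
have E e : 0 < e -> \forall h \near (0 : R * R),
    `|(f \o shift x - (cst (f x) + F)) h| <= e * `|h|.
  move=> /hf; apply: filterS => h.
  have -> : (f \o shift x - (cst (f x) + F)) h = f (h + x) - (f x + (u.1 * h.1 + u.2 * h.2)).
    by [].
  by rewrite [- (f x + _)]opprD addrA.
have D : 'd f x = 'd F 0 :> (R * R -> R).
  by apply: (diff_unique cF); apply/eqaddoP => e e0; rewrite dF; exact: E.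
apply: DiffDef; last by rewrite D dF.
apply/diff_locallyP; split; first by rewrite D; exact: cF.
by apply/eqaddoP => e e0; rewrite D dF; exact: E.
Qed.

Lemma has_grad_near f g x u : (\near x, f x = g x) -> has_grad f x u -> has_grad g x u.
Proof.
move=> fg /has_gradP hf; apply/has_gradP => e e0.
have gx : g x = f x by rewrite (nbhs_singleton fg).
have fg' : \forall h \near (0 : R * R), f (h + x) = g (h + x).
  have := fg; rewrite (near_shift 0 x) /=; apply: filterS => h.
  by rewrite /= subr0.
by near=> h; rewrite gx -(near fg' h) //; near: h; exact: hf.
Unshelve. all: by end_near.
Qed.

Lemma has_gradE_near f g x u i : (\near x, f x = g x) -> has_grad g x u ->
  pderiv i f x = (if i == 0 then u.1 else u.2).
Proof.
by move=> fg gu; rewrite -(has_gradE i gu); apply: near_eq_derive.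
Qed.

End Gradients.

(** * Sums of products of smooth one-variable functions *)

Section TensorSmooth.
Context {R : realType}.

Lemma smooth1_is_derive (f : R -> R) : smooth1 f ->
  (forall x : R, is_derive x (1 : R) f (derive1 f x)) /\ smooth1 (derive1 f).
Proof.
move=> /smooth1_derive[df [fdf sdf]].
suff -> : derive1 f = df by [].
by apply/funext => x; rewrite derive1E (@derive_val _ _ _ _ _ _ _ (fdf x)).
Qed.

(** This form is stable under both partial derivatives, so the quantification over iterated
    derivatives in [smooth] becomes an induction within the class. *)
Definition tensor (I : finType) (g h : I -> R -> R) (x : R * R) : R :=
  \sum_i g i x.1 * h i x.2.

Lemma has_grad_tensor (I : finType) (g h : I -> R -> R) x :
  (forall i, smooth1 (g i)) -> (forall i, smooth1 (h i)) ->
  has_grad (tensor g h) x (tensor (fun i => derive1 (g i)) h x, tensor g (fun i => derive1 (h i)) x).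
Proof.
move=> sg sh.
have hg i : has_grad (fun y => g i y.1) x (derive1 (g i) x.1, 0).
  apply: has_grad_eq (has_grad_comp (dh := derive1 (g i)) _ (has_grad_fst x)) _.
    exact: (smooth1_is_derive (sg i)).1.
  by congr pair; rewrite /GRing.scale /= ?mulr1 ?mulr0.
have hh i : has_grad (fun y => h i y.2) x (0, derive1 (h i) x.2).
  apply: has_grad_eq (has_grad_comp (dh := derive1 (h i)) _ (has_grad_snd x)) _.
    exact: (smooth1_is_derive (sh i)).1.
  by congr pair; rewrite /GRing.scale /= ?mulr1 ?mulr0.
apply: has_grad_eq (has_grad_sum _ (fun i => has_gradM (hg i) (hh i))) _.
rewrite /tensor; elim/big_rec3: _ => [//|i a b c _ ->].
by congr pair; rewrite /= /GRing.scale /=; ring.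
Qed.

Lemma smooth_tensor (I : finType) (g h : I -> R -> R) :
  (forall i, smooth1 (g i)) -> (forall i, smooth1 (h i)) -> smooth (tensor g h).
Proof.
move=> sg sh s x.
suff [g' [h' [sg' sh' ->]]] : exists g' h' : I -> R -> R, [/\ forall i, smooth1 (g' i),
    forall i, smooth1 (h' i) & foldr pderiv (tensor g h) s = tensor g' h'].
  exact: has_grad_differentiable (has_grad_tensor x sg' sh').
elim: s => [|j s [g' [h' [sg' sh' /= ->]]]]; first by exists g, h.
exists (fun i => if j == 0 then derive1 (g' i) else g' i), (fun i => if j == 0 then h' i else derive1 (h' i)).
split=> [i|i|].
- by case: ifP => _ //; exact: (smooth1_is_derive (sg' i)).2.
- by case: ifP => _ //; exact: (smooth1_is_derive (sh' i)).2.
- by apply/funext => y; rewrite (has_gradE j (has_grad_tensor y sg' sh')); case: ifP.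
Qed.

End TensorSmooth.

(** * Smooth approximation of Lipschitz functions vanishing off an open set *)

Section QuasiInterpolation.
Context {R : realType}.

Lemma sum_window (f : nat -> R) (B : R) (a M : nat) :
  (forall k, f k <= B) -> (forall k, ~~ (a <= k < a + 5)%N -> f k = 0) ->
  0 <= B -> \sum_(k < M) f k <= B * 5.
Proof.
move=> fB f0 B0.
(* [minn (M - a) 5] counts the window indices below [M], which makes the bound inductive in [M]. *)
have H : \sum_(k < M) f k <= B * (minn (M - a) 5)%:R.
  elim: M => [|M IH]; first by rewrite big_ord0 mulr_ge0.
  rewrite big_ord_recr /=; have [Ma|Ma] := boolP (a <= M < a + 5)%N.
    have -> : minn (M.+1 - a) 5 = (minn (M - a) 5).+1 by lia.
    by rewrite -natr1 mulrDr mulr1 lerD.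
  rewrite f0 // addr0; apply: le_trans IH _; rewrite ler_wpM2l // ler_nat; lia.
apply: le_trans H _; rewrite ler_wpM2l // ler_nat; lia.
Qed.

(** An interval of length 4 contains at most five integers; the smallest index within distance 2 of
    [y], if there is one, opens the window. *)
Lemma shift_sum_bound (p : R -> R) (B y : R) (M : nat) :
  (forall z, `|p z| <= B) -> (forall z, 2 < `|z| -> p z = 0) ->
  \sum_(k < M) `|p (y - k%:R)| <= B * 5.
Proof.
move=> pB p0; have B0 : 0 <= B by apply: le_trans (pB 0).
have [[k hk]|h] := pselect (exists k : nat, `|y - k%:R| <= 2); last first.
  rewrite big1 ?mulr_ge0 // => i _; rewrite p0 ?normr0 // ltNge; apply/negP => hi.
  by apply: h; exists i.
have ex : exists k : nat, (fun k : nat => `|y - k%:R| <= 2) k by exists k.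
case: (ex_minnP ex) => a ha amin.
apply: (@sum_window (fun k => `|p (y - k%:R)|) B a) => // j hj.
rewrite p0 ?normr0 // ltNge; apply/negP => hj2.
move/negP: hj; apply; rewrite amin //=; suff : (j <= a + 4)%N by lia.
rewrite -(ler_nat R) natrD.
by move: ha hj2; rewrite !ler_norml => /andP[? ?] /andP[? ?]; lra.
Qed.

(** Five indices per direction leave at most 25 active terms, whatever [M] is; only the coefficients
    at nodes close to the point matter. *)
Lemma tensor_sum_bound (p q : R -> R) (d : nat -> nat -> R) (B e y1 y2 : R) (M : nat) :
  (forall z, `|p z| <= B) -> (forall z, 2 < `|z| -> p z = 0) ->
  (forall z, `|q z| <= B) -> (forall z, 2 < `|z| -> q z = 0) ->
  (forall k l, `|y1 - k%:R| <= 2 -> `|y2 - l%:R| <= 2 -> `|d k l| <= e) ->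
  0 <= e ->
  `|\sum_(i : 'I_M * 'I_M) d i.1 i.2 * (p (y1 - i.1%:R) * q (y2 - i.2%:R))| <= 25 * B ^+ 2 * e.
Proof.
move=> pB p0 qB q0 de e0.
have B0 : 0 <= B by apply: le_trans (pB 0).
apply: le_trans (ler_norm_sum _ _ _) _.
have : \sum_(i : 'I_M * 'I_M) e * (`|p (y1 - i.1%:R)| * `|q (y2 - i.2%:R)|) <= 25 * B ^+ 2 * e.
  rewrite -big_distrr /= -(pair_bigA _ (fun i j : 'I_M => `|p (y1 - i%:R)| * `|q (y2 - j%:R)|)) /=.
  rewrite -big_distrlr /= mulrC ler_wpM2r //.
  have := ler_pM _ _ (shift_sum_bound y1 M pB p0) (shift_sum_bound y2 M qB q0).
  rewrite !sumr_ge0 // => /(_ isT isT)/le_trans; apply.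
  by rewrite le_eqVlt; apply/orP; left; apply/eqP; ring.
apply: le_trans; apply: ler_sum => -[i j] _ /=; rewrite !normrM.
have [h1|h1] := leP `|y1 - i%:R| 2; last by rewrite p0 // normr0 !mul0r !mulr0.
have [h2|h2] := leP `|y2 - j%:R| 2; last by rewrite q0 // normr0 !mulr0.
by rewrite ler_wpM2r ?mulr_ge0 // de.
Qed.

Definition dbspline : R -> R := derive1 (@bspline R).

Lemma dbspline_eq0 (z : R) : 2 < `|z| -> dbspline z = 0.
Proof.
move=> z2; rewrite /dbspline derive1E -(derive_cst (0 : R) z 1); apply: near_eq_derive.
near=> y; rewrite bspline_eq0 // ltW //.
by near: y; apply: (cvgr_gt `|z|) => //; exact: cvg_norm.
Unshelve. all: by end_near.
Qed.

Lemma bspline_bound : exists B : R, forall z, `|bspline z| <= B /\ `|dbspline z| <= B.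
Proof.
have [B1 B10 h1] : exists2 B : R, 0 <= B & forall z, `|bspline z| <= B.
  apply: (@continuous_support_bounded _ _ 2); first exact/smooth1_continuous/smooth1_bspline.
  by move=> x /ltW; exact: bspline_eq0.
have [B2 B20 h2] : exists2 B : R, 0 <= B & forall z, `|dbspline z| <= B.
  apply: (@continuous_support_bounded _ _ 2); last exact: dbspline_eq0.
  by apply: smooth1_continuous; exact: (smooth1_is_derive smooth1_bspline).2.
by exists (Num.max B1 B2) => z; rewrite !le_max h1 h2 orbT.
Qed.

Lemma is_derive_bspline_sum (c : nat -> R) (M : nat) (y : R) :
  is_derive (y : R) (1 : R) (fun z => \sum_(k < M) c k * bspline (z - k%:R))
    (\sum_(k < M) c k * dbspline (y - k%:R)).
Proof.
have h k : is_derive (y : R) (1 : R) (fun z => c k * bspline (z - k%:R)) (c k * dbspline (y - k%:R)).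
  have h1 := is_derive_shift y 1 (- k%:R).
  have h2 := (smooth1_is_derive (@smooth1_bspline R)).1 (y - k%:R).
  have h3 := is_deriveZ (c k) (@is_derive1_comp _ bspline (fun z => z - k%:R) y _ _ h2 h1).
  by apply: is_derive_eq h3 _; rewrite mulr1.
have -> : (fun z => \sum_(k < M) c k * bspline (z - k%:R)) =
    \sum_(k < M) (fun z => c k * bspline (z - k%:R)).
  by apply/funext => z; rewrite fct_sumE.
exact: is_derive_sum.
Qed.

(** Obtained by differentiating [bspline_sum], hence the strict inequalities: the identity must hold
    in a neighbourhood of [y]. *)
Lemma dbspline_sum (M : nat) (y : R) : 1 < y -> y < M%:R - 1 ->
  \sum_(k < M) dbspline (y - k%:R) = 0.
Proof.
move=> y1 yM; have h := is_derive_bspline_sum (fun=> 1) M y.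
transitivity (\sum_(k < M) 1 * dbspline (y - k%:R)); first by apply: eq_bigr => k _; rewrite mul1r.
rewrite -(@derive_val _ _ _ _ _ _ _ h); transitivity ('D_1 (cst (1 : R)) y); last exact: derive_cst.
apply: near_eq_derive.
near=> z; under eq_bigr do rewrite mul1r; rewrite bspline_sum // ltW //.
- by near: z; exact: lt_nbhsr.
- by near: z; exact: lt_nbhsl.
Unshelve. all: by end_near.
Qed.

Lemma dbspline_sum_id (M : nat) (y : R) : 1 < y -> y < M%:R - 1 ->
  \sum_(k < M) k%:R * dbspline (y - k%:R) = 1.
Proof.
move=> y1 yM; have h := is_derive_bspline_sum (fun k => k%:R) M y.
rewrite -(@derive_val _ _ _ _ _ _ _ h); transitivity ('D_1 (@idfun R) y); last exact: derive_id.
apply: near_eq_derive.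
near=> z; rewrite bspline_sum_id // ltW //.
- by near: z; exact: lt_nbhsr.
- by near: z; exact: lt_nbhsl.
Unshelve. all: by end_near.
Qed.

Section Interpolant.
Variables (Omega : set (R * R)) (r : R).
Hypotheses (Omega_open : open Omega) (Omega_le : forall x, Omega x -> `|x| <= r).
Implicit Types (w : R * R -> R) (N M : nat) (x z : R * R).

(** The offset [r + 1], together with [grid_size], puts the scaled coordinates of every point of
    [Omega] strictly between 1 and [grid_size N - 1] when [N > 1]: the range in which the translates
    of [bspline] reproduce affine functions. *)
Definition node N (k l : nat) : R * R := (k%:R / N%:R - (r + 1), l%:R / N%:R - (r + 1)).

(** Contains the support of the basis function attached to the node, as [bspline] vanishes beyond
    2. *)
Definition node_ball N k l : set (R * R) := [set z | `|z - node N k l| <= 2 / N%:R].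

(* Dropping the nodes too close to the boundary makes the interpolant a test
   function; for a Lipschitz [w] vanishing off [Omega] this costs O(1 / N) in each
   coefficient, hence only O(1) in the gradient. *)
Definition node_coef w N k l : R :=
  if `[< node_ball N k l `<=` Omega >] then w (node N k l) else 0.

Definition grid_size N : nat := (Num.truncn (N%:R * (2 * (r + 1)))).+3.

(** The one-variable factors are parameters because each partial derivative of the interpolant is
    [N] times the same sum with one factor replaced by [dbspline]. *)
Definition quasi w N (p q : R -> R) x : R :=
  \sum_(i : 'I_(grid_size N) * 'I_(grid_size N)) node_coef w N i.1 i.2 *
    (p (N%:R * (x.1 + (r + 1)) - i.1%:R) * q (N%:R * (x.2 + (r + 1)) - i.2%:R)).

Lemma quasi_tensor w N p q : quasi w N p q = tensor
  (fun (i : 'I_(grid_size N) * 'I_(grid_size N)) s =>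
     node_coef w N i.1 i.2 * p (N%:R * s + (N%:R * (r + 1) - i.1%:R)))
  (fun i s => q (N%:R * s + (N%:R * (r + 1) - i.2%:R))).
Proof.
by apply/funext => x; apply: eq_bigr => i _; rewrite mulrA !(mulrDr N%:R) !addrA.
Qed.

Lemma derive1_affine (c a b : R) (f : R -> R) (s : R) : smooth1 f ->
  derive1 (fun s => c * f (a * s + b)) s = a * (c * derive1 f (a * s + b)).
Proof.
move=> sf; rewrite derive1E.
have h : is_derive s 1 (fun x : R => a * x + b) a.
  have := is_deriveD (is_deriveM (is_derive_cst a s 1) (is_derive_id s 1)) (is_derive_cst b s 1).
  by move=> /is_derive_eq; apply; rewrite scaler0 /GRing.scale /= !addr0 mulr1.
have h2 := (smooth1_is_derive sf).1 (a * s + b).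
have h3 := is_deriveZ c (@is_derive1_comp _ f (fun s => a * s + b) s _ _ h2 h).
by rewrite (@derive_val _ _ _ _ _ _ _ h3) /GRing.scale /=; ring.
Qed.

Lemma smooth1_affine (c a b : R) (f : R -> R) : smooth1 f ->
  smooth1 (fun s => c * f (a * s + b)).
Proof. by move=> sf n; apply: CnM; [exact: Cn_cst|exact: Cn_comp_affine]. Qed.

Lemma has_grad_quasi w N x : has_grad (quasi w N (@bspline R) (@bspline R)) x
  (N%:R * quasi w N dbspline (@bspline R) x, N%:R * quasi w N (@bspline R) dbspline x).
Proof.
rewrite !quasi_tensor; apply: has_grad_eq (has_grad_tensor _ _ _) _.
- by move=> i; apply: smooth1_affine; exact: smooth1_bspline.
- by move=> i n; apply: Cn_comp_affine; exact: smooth1_bspline.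
congr pair; rewrite /tensor mulr_sumr; apply: eq_bigr => i _.
- by rewrite derive1_affine ?mulrA //; exact: smooth1_bspline.
- rewrite [in LHS](_ : (fun s => bspline (N%:R * s + (N%:R * (r + 1) - i.2%:R))) =
     (fun s => 1 * bspline (N%:R * s + (N%:R * (r + 1) - i.2%:R)))).
    by rewrite derive1_affine ?mul1r -/dbspline; [ring|exact: smooth1_bspline].
  by apply/funext => s; rewrite mul1r.
Qed.

Lemma smooth_quasi w N : smooth (quasi w N (@bspline R) (@bspline R)).
Proof.
rewrite quasi_tensor; apply: smooth_tensor => i.
- by apply: smooth1_affine; exact: smooth1_bspline.
- by move=> n; apply: Cn_comp_affine; exact: smooth1_bspline.
Qed.

Lemma compact_node_ball N k l : compact (node_ball N k l).
Proof.
pose a := node N k l; pose d := 2 / N%:R : R.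
suff -> : node_ball N k l = `[a.1 - d, a.1 + d] `*` `[a.2 - d, a.2 + d].
  by apply: compact_setX; exact: segment_compact.
apply/seteqP; split => z; rewrite /node_ball /= !in_itv /= prod_normE /= ge_max !ler_norml /a /d.
- by move=> /andP[/andP[? ?] /andP[? ?]]; split; apply/andP; split; lra.
- by move=> [/andP[? ?] /andP[? ?]]; do 2 (apply/andP; split); lra.
Qed.

Lemma node_dist N k l x : (0 < N)%N ->
  `|N%:R * (x.1 + (r + 1)) - k%:R| <= 2 -> `|N%:R * (x.2 + (r + 1)) - l%:R| <= 2 ->
  `|x - node N k l| <= 2 / N%:R.
Proof.
move=> N0; have NR : 0 < N%:R :> R by rewrite ltr0n.
have H (s : R) (m : nat) : `|N%:R * (s + (r + 1)) - m%:R| <= 2 ->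
    `|s - (m%:R / N%:R - (r + 1))| <= 2 / N%:R.
  move=> h; rewrite ler_pdivlMr // -[X in _ * X](gtr0_norm NR) -normrM; apply: le_trans h.
  rewrite le_eqVlt; apply/orP; left; apply/eqP; congr `|_|; field; exact: lt0r_neq0.
by move=> /H h1 /H h2; rewrite prod_normE /= ge_max h1.
Qed.

(** The nodes kept have their closed balls inside [Omega], and the finite union of these compact
    balls contains the support. *)
Lemma test_fun_quasi w N : (0 < N)%N -> test_fun Omega (quasi w N (@bspline R) (@bspline R)).
Proof.
move=> N0; pose I := ('I_(grid_size N) * 'I_(grid_size N))%type.
pose good (i : I) := `[< node_ball N i.1 i.2 `<=` Omega >].
pose S := \big[setU/set0]_(i : I | good i) node_ball N i.1 i.2.
have cS : compact S by apply: bigsetU_compact => i _; exact: compact_node_ball.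
have SE : S = \bigcup_(i in [set i | (i \in index_enum I) && good i]) node_ball N i.1 i.2.
  by rewrite bigcup_seq_cond.
have SO : S `<=` Omega.
  by rewrite SE => x [i /= /andP[_ /asboolP]]; exact.
have clS : closure [set x | quasi w N (@bspline R) (@bspline R) x != 0] `<=` S.
  have E : S = closure S by apply/closure_id; apply: compact_closed cS; exact: norm_hausdorff.
  rewrite [X in _ `<=` X]E.
  apply: closure_subset => x /= /eqP qx; apply: contrapT => nSx; apply: qx.
  apply: big1 => i _; rewrite /node_coef; case: ifPn => [gi|_]; last by rewrite mul0r.
  have [h1|h1] := leP `|N%:R * (x.1 + (r + 1)) - i.1%:R| 2; last first.
    by rewrite bspline_eq0 ?mul0r ?mulr0 // ltW.
  have [h2|h2] := leP `|N%:R * (x.2 + (r + 1)) - i.2%:R| 2; last first.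
    by rewrite (@bspline_eq0 _ (_ * (x.2 + _) - _)) ?mul0r ?mulr0 // ltW.
  exfalso; apply: nSx; rewrite SE; exists i; first by rewrite /= mem_index_enum.
  exact: node_dist.
split; [exact: smooth_quasi| |exact: subset_trans SO].
by apply: subclosed_compact cS clS; exact: closed_closure.
Qed.

(** The interpolant reproduces affine functions, so only the deviation [e] of the coefficients near
    [x] from those of an affine function counts. This one estimate yields the bounds and the limits
    of the interpolants and of their gradients, for suitable [a], [u] and [e]. *)
Lemma quasi_approx : exists2 C : R, 0 <= C & forall w N x (a e : R) (u : R * R),
  (1 < N)%N -> Omega x -> 0 <= e ->
  (forall k l, `|x - node N k l| <= 2 / N%:R ->
     `|node_coef w N k l - (a + u.1 * ((node N k l).1 - x.1) + u.2 * ((node N k l).2 - x.2))| <= e) ->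
  [/\ `|quasi w N (@bspline R) (@bspline R) x - a| <= C * e,
      `|quasi w N dbspline (@bspline R) x - u.1 / N%:R| <= C * e &
      `|quasi w N (@bspline R) dbspline x - u.2 / N%:R| <= C * e].
Proof.
have [B hB] := bspline_bound; exists (25 * B ^+ 2); first by rewrite mulr_ge0 // sqr_ge0.
move=> w N x a e u N1 Ox e0 he; set M := grid_size N.
have N0 : (0 < N)%N by exact: ltnW.
have NR : 1 < N%:R :> R by rewrite ltr1n.
have xr : `|x| <= r by exact: Omega_le.
have r0 : 0 <= r by exact: le_trans xr.
have yM (s : R) : `|s| <= r -> 1 < N%:R * (s + (r + 1)) /\ N%:R * (s + (r + 1)) < M%:R - 1.
  rewrite ler_norml => /andP[s1 s2]; split; first by nra.
  have := @truncnS_gt _ (N%:R * (2 * (r + 1)) : R).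
  by rewrite /M /grid_size -!natr1; set T := (Num.truncn _)%:R; nra.
set y1 := N%:R * (x.1 + (r + 1)); set y2 := N%:R * (x.2 + (r + 1)).
have [x1r x2r] : `|x.1| <= r /\ `|x.2| <= r.
  by move: xr; rewrite prod_normE /= ge_max => /andP[].
have [y1l y1u] := yM _ x1r; have [y2l y2u] := yM _ x2r.
rewrite -/y1 in y1l y1u; rewrite -/y2 in y2l y2u.
have NV : N%:R != 0 :> R by rewrite gt_eqF // ltr0n.
(* Here [p0], [p1] are the zeroth and the centred first moment of the translates of [p]: they are 1,
   0 for [bspline] and 0, 1 for [dbspline]. *)
have affine (p q : R -> R) (p0 p1 q0 q1 : R) :
  \sum_(k < M) p (y1 - k%:R) = p0 -> \sum_(k < M) k%:R * p (y1 - k%:R) = y1 * p0 + p1 ->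
  \sum_(k < M) q (y2 - k%:R) = q0 -> \sum_(k < M) k%:R * q (y2 - k%:R) = y2 * q0 + q1 ->
  \sum_(i : 'I_M * 'I_M) (a + u.1 * ((node N i.1 i.2).1 - x.1) + u.2 * ((node N i.1 i.2).2 - x.2)) *
     (p (y1 - i.1%:R) * q (y2 - i.2%:R)) =
  a * p0 * q0 + u.1 / N%:R * p1 * q0 + u.2 / N%:R * p0 * q1.
  move=> hp0 hp1 hq0 hq1.
  have E1 : \sum_(k < M) (k%:R - y1) * p (y1 - k%:R) = p1.
    under eq_bigr do rewrite mulrBl; rewrite sumrB hp1 -mulr_sumr hp0; ring.
  have E2 : \sum_(k < M) (k%:R - y2) * q (y2 - k%:R) = q1.
    under eq_bigr do rewrite mulrBl; rewrite sumrB hq1 -mulr_sumr hq0; ring.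
  transitivity (\sum_(i < M) \sum_(j < M) (a * (p (y1 - i%:R) * q (y2 - j%:R)) +
      (u.1 / N%:R * (((i%:R - y1) * p (y1 - i%:R)) * q (y2 - j%:R)) +
       u.2 / N%:R * (p (y1 - i%:R) * ((j%:R - y2) * q (y2 - j%:R)))))).
    rewrite pair_bigA /=; apply: eq_bigr => -[i j] _ /=.
    by rewrite /y1 /y2; field.
  have D (F G : 'I_M -> R) (c : R) : \sum_(i < M) \sum_(j < M) c * (F i * G j) =
      c * (\sum_i F i) * (\sum_j G j).
    rewrite -mulrA big_distrlr mulr_sumr; apply: eq_bigr => i _; by rewrite mulr_sumr.
  under eq_bigr do rewrite !big_split /=; rewrite !big_split /= !D hp0 hq0 E1 E2; ring.
have est (p q : R -> R) (p0 p1 q0 q1 : R) :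
  \sum_(k < M) p (y1 - k%:R) = p0 -> \sum_(k < M) k%:R * p (y1 - k%:R) = y1 * p0 + p1 ->
  \sum_(k < M) q (y2 - k%:R) = q0 -> \sum_(k < M) k%:R * q (y2 - k%:R) = y2 * q0 + q1 ->
  (forall s : R, `|p s| <= B) -> (forall s : R, 2 < `|s| -> p s = 0) ->
  (forall s : R, `|q s| <= B) -> (forall s : R, 2 < `|s| -> q s = 0) ->
  `|quasi w N p q x - (a * p0 * q0 + u.1 / N%:R * p1 * q0 + u.2 / N%:R * p0 * q1)| <= 25 * B ^+ 2 * e.
  move=> hp0 hp1 hq0 hq1 pB pz qB qz; rewrite -(affine p q) // /quasi -sumrB.
  under eq_bigr do rewrite -mulrBl.
  apply: (@tensor_sum_bound p q (fun k l => node_coef w N k l -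
    (a + u.1 * ((node N k l).1 - x.1) + u.2 * ((node N k l).2 - x.2)))) => // k l h1 h2.
  by apply: he; exact: node_dist.
have b0 (s : R) : 2 < `|s| -> bspline s = 0 by move=> /ltW; exact: bspline_eq0.
have bB (s : R) : `|bspline s| <= B by case: (hB s).
have dB (s : R) : `|dbspline s| <= B by case: (hB s).
have S1 := bspline_sum (ltW y1l) (ltW y1u); have S2 := bspline_sum (ltW y2l) (ltW y2u).
have I1 := bspline_sum_id (ltW y1l) (ltW y1u); have I2 := bspline_sum_id (ltW y2l) (ltW y2u).
have T1 := dbspline_sum y1l y1u; have T2 := dbspline_sum y2l y2u.
have J1 := dbspline_sum_id y1l y1u; have J2 := dbspline_sum_id y2l y2u.
split.
- have := est _ _ _ 0 _ 0 S1 _ S2 _ bB b0 bB b0; rewrite !(mulr0, mul0r, mulr1, addr0, add0r); apply => //.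
- have := est _ _ _ 1 _ 0 T1 _ S2 _ dB dbspline_eq0 bB b0.
  by rewrite !(mulr0, mul0r, mulr1, addr0, add0r); apply.
- have := est _ _ _ 0 _ 1 S1 _ T2 _ bB b0 dB dbspline_eq0.
  by rewrite !(mulr0, mul0r, mulr1, addr0, add0r); apply.
Qed.

Lemma node_ball_sub N k l x (d : R) : `|x - node N k l| <= 2 / N%:R ->
  4 / N%:R < d -> (forall z, `|x - z| < d -> Omega z) -> node_ball N k l `<=` Omega.
Proof.
move=> h hd hO z hz; apply: hO; apply: le_lt_trans hd.
have -> : x - z = (x - node N k l) - (z - node N k l) by rewrite opprB addrA subrK.
apply: le_trans (ler_normB _ _) _.
by have -> : 4 / N%:R = 2 / N%:R + 2 / N%:R :> R; [rewrite -mulrDl; congr (_ / _); ring|exact: lerD].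
Qed.

Lemma near_inv_nat (d : R) : 0 < d -> \forall n \near \oo, 4 / n.+2%:R < d.
Proof.
move=> d0; near=> n; rewrite ltr_pdivrMr // mulrC -ltr_pdivrMr //.
apply: (@lt_trans _ _ n%:R); last by rewrite ltr_nat.
by near: n; exact: nbhs_infty_gtr.
Unshelve. all: by end_near.
Qed.

Lemma nbhs_dist_ball (A : set (R * R)) x : nbhs x A ->
  exists2 d : R, 0 < d & forall z, `|x - z| < d -> A z.
Proof.
by move/nbhs_ballP => [d /= d0 h]; exists d => // z hz; apply: h; rewrite -ball_normE.
Qed.

Lemma open_norm_ball x : Omega x -> exists2 d : R, 0 < d & forall z, `|x - z| < d -> Omega z.
Proof. by move=> Ox; apply: nbhs_dist_ball; apply: open_nbhs_nbhs; split. Qed.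

(** One sequence, with a constant chosen before [w], has all the properties; each property asks of
    [w] only what it states, so that discontinuous [w] can be approximated too. *)
Lemma mollification : exists2 C : R, 0 <= C & forall w, exists phi : nat -> R * R -> R,
  [/\ forall n, test_fun Omega (phi n),
     forall W, 0 <= W -> (forall x, Omega x -> `|w x| <= W) ->
       forall n x, Omega x -> `|phi n x| <= C * W,
     forall x, Omega x -> {for x, continuous w} -> phi n x @[n --> \oo] --> w x,
     forall L, 0 <= L -> (forall x y, `|w x - w y| <= L * `|x - y|) ->
       (forall x, ~ Omega x -> w x = 0) ->
       forall n x i, Omega x -> `|pderiv i (phi n) x| <= C * L
   & forall x u i, Omega x -> has_grad w x u ->
       pderiv i (phi n) x @[n --> \oo] --> (if i == 0 then u.1 else u.2)].
Proof.
have [C C0 hC] := quasi_approx; exists (4 * C) => [|w]; first by rewrite mulr_ge0.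
pose phi n := quasi w n.+2 (@bspline R) (@bspline R); exists phi; split.
- by move=> n; exact: test_fun_quasi.
- move=> W W0 hW n x Ox.
  have [] // := hC w n.+2 x 0 W (0, 0) _ Ox W0.
    move=> k l _; rewrite /= !mul0r !addr0 subr0 /node_coef; case: asboolP => [h|_]; last by rewrite normr0.
    by apply: hW; apply: h; rewrite /node_ball /= subrr normr0 divr_ge0.
  rewrite subr0 => h _ _; apply: le_trans h _; rewrite ler_wpM2r //; lra.
- move=> x Ox cw; have [d1 d10 hd1] := open_norm_ball Ox.
  apply/cvgrPdist_le => e e0; pose e' := e / (C + 1).
  have e'0 : 0 < e' by rewrite divr_gt0 // ltr_wpDl.
  have /cvgrPdist_le/(_ _ e'0) := cw; rewrite near_nbhs => /nbhs_dist_ball[d2 d20 hd2].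
  near=> n.
  have h1 : 4 / n.+2%:R < d1 by near: n; exact: near_inv_nat.
  have h2 : 4 / n.+2%:R < d2 by near: n; exact: near_inv_nat.
  have [] // := hC w n.+2 x (w x) e' (0, 0) _ Ox (ltW e'0).
    move=> k l hk; rewrite /= !mul0r !addr0 /node_coef.
    rewrite asboolT; last exact: node_ball_sub hk h1 hd1.
    rewrite distrC; apply: hd2; apply: le_lt_trans hk (le_lt_trans _ h2).
    by rewrite ler_wpM2r ?invr_ge0 //; lra.
  rewrite distrC => h _ _; apply: le_trans h _.
  by rewrite /e' mulrCA ger_pMr // ler_pdivrMr ?mul1r ?lerDl // ltr_wpDl.
- move=> L L0 wL w0 n x i Ox.
  have N0 : 0 < n.+2%:R :> R by rewrite ltr0n.
  have e0 : 0 <= L * (4 / n.+2%:R) by rewrite mulr_ge0 // divr_ge0.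
  have [] // := hC w n.+2 x (w x) _ (0, 0) _ Ox e0.
    move=> k l hk; rewrite /= !mul0r !addr0 /node_coef.
    case: asboolP => [_|].
      apply: le_trans (wL _ _) _; rewrite ler_wpM2l // distrC; apply: le_trans hk _.
      by rewrite ler_wpM2r ?invr_ge0 //; lra.
    (* The ball of a dropped node contains a zero [z] of [w], at distance at most 4 / N from [x];
       hence replacing the coefficient by 0 costs no more than [L * (4 / N)], and the factor N of
       the gradient turns this into [4 * L]. *)
    move=> /existsNP[z /not_implyP[zb /w0 wz]]; rewrite sub0r normrN -[w x]subr0 -wz.
    apply: le_trans (wL _ _) _; rewrite ler_wpM2l //.
    have -> : x - z = (x - node n.+2 k l) - (z - node n.+2 k l) by rewrite opprB addrA subrK.
    apply: le_trans (ler_normB _ _) _.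
    by have -> : 4 / n.+2%:R = 2 / n.+2%:R + 2 / n.+2%:R :> R; [rewrite -mulrDl; congr (_ / _); ring|exact: lerD].
  rewrite (has_gradE i (has_grad_quasi w n.+2 x)) /= !mul0r !subr0 => _ h1 h2.
  have H (q : R) : `|q| <= C * (L * (4 / n.+2%:R)) -> `|n.+2%:R * q| <= 4 * C * L.
    move=> h; rewrite normrM (gtr0_norm N0) mulrC -ler_pdivlMr //; apply: le_trans h _.
    by rewrite le_eqVlt; apply/orP; left; apply/eqP; ring.
  by case: ifP => _; exact: H.
- move=> x u i Ox /has_gradP wu; have [d1 d10 hd1] := open_norm_ball Ox.
  apply/cvgrPdist_le => e e0; pose e' := e / (2 * (C + 1)).
  have C1 : 0 < 2 * (C + 1) by rewrite mulr_gt0 // ltr_wpDl.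
  have e'0 : 0 < e' by rewrite divr_gt0.
  have /nbhs_dist_ball[d2 d20 hd2] := wu _ e'0.
  near=> n.
  have h1 : 4 / n.+2%:R < d1 by near: n; exact: near_inv_nat.
  have h2 : 4 / n.+2%:R < d2 by near: n; exact: near_inv_nat.
  have N0 : 0 < n.+2%:R :> R by rewrite ltr0n.
  (* The Taylor error at an active node is [e'] times its distance, at most 2 / N, to [x]. The
     factor N of the gradient leaves [2 * C * e'], whence the choice of [e']. *)
  have e1 : 0 <= e' * (2 / n.+2%:R) by rewrite mulr_ge0 ?ltW // divr_gt0.
  have [] // := hC w n.+2 x (w x) _ u _ Ox e1.
    move=> k l hk; rewrite /node_coef.
    rewrite asboolT; last exact: node_ball_sub hk h1 hd1.
    have := hd2 (node n.+2 k l - x); rewrite sub0r opprB => /(_ _)/=.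
    have E (p q s t : R) : p - (q + s + t) = p - q - (s + t) by ring.
    rewrite subrK E => hh; apply: le_trans (hh _) _.
      by apply: le_lt_trans hk (le_lt_trans _ h2); rewrite ler_wpM2r ?invr_ge0 //; lra.
    by apply: ler_wpM2l; [exact: ltW|rewrite distrC].
  rewrite (has_gradE i (has_grad_quasi w n.+2 x)) /= => _ H1 H2.
  have H (q v : R) : `|q - v / n.+2%:R| <= C * (e' * (2 / n.+2%:R)) -> `|v - n.+2%:R * q| <= e.
    move=> h; rewrite (_ : v - n.+2%:R * q = n.+2%:R * - (q - v / n.+2%:R)); last first.
      by field; exact: lt0r_neq0.
    rewrite normrM (gtr0_norm N0) normrN mulrC -ler_pdivlMr //; apply: le_trans h _.
    rewrite (mulrA e') (mulrA C) ler_wpM2r ?invr_ge0 //.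
    rewrite /e' mulrAC mulrA mulrA ler_pdivrMr //; nra.
  by case: ifP => _; exact: H.
Unshelve. all: by end_near.
Qed.

End Interpolant.

End QuasiInterpolation.

(** * Lebesgue measure and L^2 in the plane *)

Section PlaneMeasure.
Context {R : realType}.
Local Notation T2 := (measurableTypeR R * measurableTypeR R)%type.
Implicit Types (D : set T2) (f g : T2 -> R).

(** Countably many boxes with rational corners exhaust an open set; this links the topology of the
    plane to the product sigma-algebra. *)
Lemma open_measurable2 (U : set (R * R)) : open U -> measurable (U : set T2).
Proof.
move=> oU; pose box (q : (rat * rat) * (rat * rat)) : set T2 :=
  `]ratr q.1.1, ratr q.1.2[%classic `*` `]ratr q.2.1, ratr q.2.2[%classic.
have -> : (U : set T2) = \bigcup_q (if `[< box q `<=` U >] then box q else set0).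
  apply/seteqP; split => [x Ux|x [q _]]; last by case: asboolP => // h; exact: h.
  have /nbhs_dist_ball[d d0 hd] : nbhs x U by exact: open_nbhs_nbhs.
  have ex (s : R) : exists p : rat * rat, [/\ ratr p.1 < s, s < ratr p.2, s - d < ratr p.1 & ratr p.2 < s + d].
    have [p1 hp1] := @rat_in_itvoo _ (s - d) s (ltac:(lra)).
    have [p2 hp2] := @rat_in_itvoo _ s (s + d) (ltac:(lra)).
    by exists (p1, p2); move: hp1 hp2; rewrite !in_itv /= => /andP[? ?] /andP[? ?].
  have [p [p1 p2 p3 p4]] := ex x.1; have [q [q1 q2 q3 q4]] := ex x.2.
  exists (p, q) => //; case: asboolP => [_|[]]; first by split => /=; rewrite in_itv /= ?p1 ?q1.
  move=> z [/= ]; rewrite !in_itv /= => /andP[z1 z2] /andP[z3 z4]; apply: hd.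
  by rewrite prod_normE /= gt_max !ltr_norml; do 2 (apply/andP; split); lra.
apply: countable_bigcupT_measurable => // q.
by case: ifP => // _; apply: measurableX; exact: measurable_itv.
Qed.

Lemma closed_measurable2 (U : set (R * R)) : closed U -> measurable (U : set T2).
Proof. by move=> /closed_openC/open_measurable2/measurableC; rewrite setCK. Qed.

Lemma continuous_measurable2 (f : R * R -> R) (D : set T2) : continuous f ->
  measurable D -> measurable_fun D (f : T2 -> R).
Proof.
move=> /continuousP cf mD; apply: (measurability _ (RGenOpens.measurableE R)).
move=> _ [_ [a [b ->] <-]]; apply: measurableI => //; apply: open_measurable2.
exact/cf/interval_open.
Qed.

Lemma leb2X (A B : set (measurableTypeR R)) : measurable A -> measurable B ->
  leb2 (A `*` B : set T2) = (@lebesgue_measure R A * @lebesgue_measure R B)%E.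
Proof. by move=> mA mB; exact: (product_measure1E lebesgue_measure lebesgue_measure mA mB). Qed.

Lemma line_null (a b c : R) : (a != 0) || (b != 0) ->
  leb2 ([set x | a * x.1 + b * x.2 = c] : set T2) = 0%E.
Proof.
have [->|b0] := eqVneq b 0.
  rewrite orbF => a0.
  have -> : [set x : T2 | a * x.1 + 0 * x.2 = c] = [set c / a] `*` setT.
    apply/seteqP; split => x /=; rewrite mul0r addr0.
      by move=> <-; split => //; field.
    by move=> [-> _]; field.
  by rewrite leb2X // lebesgue_measure_set1 mul0e.
move=> _; rewrite /leb2 /= /product_measure1; apply: integral0_eq => x _ /=.
have -> : xsection [set x : T2 | a * x.1 + b * x.2 = c] x = [set (c - a * x) / b].
  apply/seteqP; split => y; rewrite /xsection /= ?in_setE /=.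
    by move=> <-; field.
  by move=> ->; field.
exact: lebesgue_measure_set1.
Qed.

Lemma line_measurable (a b c : R) : measurable ([set x | a * x.1 + b * x.2 = c] : set T2).
Proof.
apply: closed_measurable2; apply: (@closed_comp _ _ (fun x : R * R => a * x.1 + b * x.2) [set c]).
  move=> x _; apply: cvgD; (apply: cvgM; first exact: cvg_cst); [exact: cvg_fst|exact: cvg_snd].
exact: closed_eq.
Qed.

Lemma box_measure (p : R * R) (d : R) : 0 <= d ->
  leb2 ([set z | `|z - p| <= d] : set T2) = ((2 * d) ^+ 2)%:E.
Proof.
move=> d0.
have -> : [set z : T2 | `|z - p| <= d] =
    `[p.1 - d, p.1 + d]%classic `*` `[p.2 - d, p.2 + d]%classic.
  apply/seteqP; split => z; rewrite /= !in_itv /= prod_normE /= ge_max !ler_norml.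
  - by move=> /andP[/andP[? ?] /andP[? ?]]; split; apply/andP; split; lra.
  - by move=> [/andP[? ?] /andP[? ?]]; do 2 (apply/andP; split); lra.
rewrite leb2X; try exact: measurable_itv.
rewrite !lebesgue_measure_itv /= !lte_fin.
have [d1|d1] := ltP 0 d; last first.
  have -> : d = 0 by lra.
  by rewrite !subr0 !addr0 !ltxx mule0 mulr0 expr0n.
by rewrite !ifT; [rewrite -!EFinD -EFinM; congr (_%:E); ring|lra|lra].
Qed.

Definition rintegrable D f := leb2.-integrable D (fun x => (f x)%:E).

Lemma bounded_finite (A : set (R * R)) (r : R) : (forall x, A x -> `|x| <= r) ->
  measurable (A : set T2) -> (leb2 (A : set T2) < +oo)%E.
Proof.
move=> Ar mA.
have [->|/set0P[x Ax]] := eqVneq A set0; first by rewrite measure0.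
have r0 : 0 <= r by apply: le_trans (Ar _ Ax).
apply: (@le_lt_trans _ _ (leb2 ([set z | `|z - 0| <= r] : set T2))); last by rewrite box_measure // ltry.
apply: le_measure; rewrite ?inE //.
  apply: closed_measurable2; apply: (@closed_comp _ _ (fun z : R * R => `|z - 0|) [set t | t <= r]).
    by move=> z _; apply: cvg_norm; apply: cvgB; [exact: cvg_id|exact: cvg_cst].
  exact: closed_le.
by move=> z /Ar; rewrite /= subr0.
Qed.

Section Domain.
Variable D : set T2.
Hypotheses (mD : measurable D) (fD : (leb2 D < +oo)%E).

Lemma rintegrable_bounded f (M : R) : measurable_fun D f -> (forall x, D x -> `|f x| <= M) ->
  rintegrable D f.
Proof.
move=> mf fM; apply: measurable_bounded_integrable => //.
exists M; split; first exact: num_real.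
by move=> y /ltW My x Dx; apply: le_trans My; exact: fM.
Qed.

Lemma rintegrableD f g : rintegrable D f -> rintegrable D g -> rintegrable D (fun x => f x + g x).
Proof.
move=> rf rg; have := integrableD mD rf rg.
by apply: eq_integrable => // x _; rewrite /= EFinD.
Qed.

Lemma rintegrableZ (c : R) f : rintegrable D f -> rintegrable D (fun x => c * f x).
Proof.
move=> rf; have := integrableZl mD c rf.
by apply: eq_integrable => // x _; rewrite /= EFinM.
Qed.

Lemma rintegrable_le f g : measurable_fun D f -> (forall x, D x -> `|f x| <= g x) ->
  rintegrable D g -> rintegrable D f.
Proof.
move=> mf fg; apply: le_integrable => //; first exact/measurable_EFinP.
move=> x Dx /=; rewrite lee_fin; apply: le_trans (fg x Dx) (ler_norm _).
Qed.

Lemma rintegrable_sum (I : Type) (s : seq I) (F : I -> T2 -> R) :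
  (forall i, rintegrable D (F i)) -> rintegrable D (fun x => \sum_(i <- s) F i x).
Proof.
move=> h; elim: s => [|i s IH].
  apply: (@rintegrable_bounded _ 0) => [|x _]; last by rewrite big_nil normr0.
  by apply: eq_measurable_fun (measurable_cst (0 : R)) => x _; rewrite big_nil.
have := rintegrableD (h i) IH; apply: eq_integrable => // x _.
by rewrite big_cons.
Qed.

Lemma Rintegral_sum (I : Type) (s : seq I) (F : I -> T2 -> R) :
  (forall i, rintegrable D (F i)) ->
  \int[leb2]_(x in D) (\sum_(i <- s) F i x) = \sum_(i <- s) \int[leb2]_(x in D) F i x.
Proof.
move=> h; elim: s => [|i s IH].
  rewrite big_nil -[RHS](mul0r (fine (leb2 D))) -Rintegral_cst //.
  by apply: eq_Rintegral => x _; rewrite big_nil.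
rewrite big_cons -IH -RintegralD //; [|exact: h|exact: rintegrable_sum].
by apply: eq_Rintegral => x _; rewrite big_cons.
Qed.

Lemma L2_measurable f : L2 D f -> measurable_fun D f.
Proof. by case. Qed.

Lemma L2_mul f g : L2 D f -> L2 D g -> rintegrable D (fun x => f x * g x).
Proof.
move=> [mf f2] [mg g2]; apply: (@rintegrable_le _ (fun x => f x ^+ 2 + g x ^+ 2)).
- exact: measurable_funM.
- move=> x _; rewrite normrM -(normr_id (f x)) -(normr_id (g x)).
  rewrite -[f x ^+ 2]real_normK ?num_real // -[g x ^+ 2]real_normK ?num_real // !normr_id.
  have := normr_ge0 (f x); have := normr_ge0 (g x).
  set a := `|f x|; set b := `|g x|; nra.
- exact: rintegrableD.
Qed.

Lemma L2_bounded f (M : R) : measurable_fun D f -> (forall x, D x -> `|f x| <= M) -> L2 D f.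
Proof.
move=> mf fM; split => //; apply: (@rintegrable_bounded _ (M ^+ 2)); first exact: measurable_funX.
by move=> x Dx; rewrite normrX lerXn2r ?nnegrE ?fM //; apply: le_trans (fM _ Dx).
Qed.

Lemma L2_cst (c : R) : L2 D (fun=> c).
Proof. by apply: (@L2_bounded _ `|c|); first exact: measurable_cst. Qed.

Lemma L2_rintegrable f : L2 D f -> rintegrable D f.
Proof.
move=> h; have := L2_mul h (L2_cst 1).
by apply: eq_integrable => // x _; rewrite mulr1.
Qed.

Lemma L2D f g : L2 D f -> L2 D g -> L2 D (fun x => f x + g x).
Proof.
move=> hf hg; have fg := L2_mul hf hg; case: hf hg => mf f2 [mg g2].
split; first exact: measurable_funD.
have := rintegrableD (rintegrableD f2 (rintegrableZ 2 fg)) g2.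
apply: eq_integrable => // x _; congr (_%:E); ring.
Qed.

Lemma L2Z (c : R) f : L2 D f -> L2 D (fun x => c * f x).
Proof.
move=> [mf f2]; split; first by apply: measurable_funM => //; exact: measurable_cst.
have := rintegrableZ (c ^+ 2) f2.
by apply: eq_integrable => // x _; congr (_%:E); ring.
Qed.

Lemma L2B f g : L2 D f -> L2 D g -> L2 D (fun x => f x - g x).
Proof.
move=> hf /(L2Z (-1)) hg; have := L2D hf hg.
by congr L2; apply/funext => x; rewrite mulN1r.
Qed.

Lemma sqnorm_L2_ge0 f : 0 <= sqnorm_L2 D f.
Proof. by apply: Rintegral_ge0 => x _; exact: sqr_ge0. Qed.

Lemma cauchy_schwarz f g : L2 D f -> L2 D g ->
  `|\int[leb2]_(x in D) (f x * g x)| <= Num.sqrt (sqnorm_L2 D f) * Num.sqrt (sqnorm_L2 D g).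
Proof.
move=> hf hg; have fg := L2_mul hf hg.
set A := sqnorm_L2 D f; set C := sqnorm_L2 D g; set B := \int[leb2]_(x in D) (f x * g x).
have A0 : 0 <= A := sqnorm_L2_ge0 f; have C0 : 0 <= C := sqnorm_L2_ge0 g.
(* The discriminant argument: the integral of [(t * f - g) ^+ 2] is a nonnegative polynomial in
   [t]. *)
have key t : 0 <= A * t ^+ 2 - 2 * B * t + C.
  have -> : A * t ^+ 2 - 2 * B * t + C = \int[leb2]_(x in D) (t * f x - g x) ^+ 2.
    rewrite /A /B /C /sqnorm_L2; case: hf hg => mf f2 [mg g2].
    transitivity (\int[leb2]_(x in D) (t ^+ 2 * f x ^+ 2 + (- 2 * t) * (f x * g x) + g x ^+ 2)).
      rewrite RintegralD //; last by apply: rintegrableD; exact: rintegrableZ.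
      rewrite RintegralD //; [|exact: rintegrableZ|exact: rintegrableZ].
      by rewrite !RintegralZl //; ring.
    by apply: eq_Rintegral => x _; ring.
  by apply: Rintegral_ge0 => x _; exact: sqr_ge0.
rewrite -sqrtrM // -sqrtr_sqr ler_sqrt ?mulr_ge0 //.
have [A1|A1] := eqVneq A 0.
  have [->|B0] := eqVneq B 0; first by rewrite expr0n /= mulr_ge0.
  (* For [A = 0] the polynomial is affine in [t], and at this [t] it would be -1. *)
  have := key ((C + 1) / (2 * B)); rewrite A1 mul0r sub0r.
  have -> : - (2 * B * ((C + 1) / (2 * B))) + C = -1 by field.
  by rewrite ler0N1.
have := key (B / A); have -> : A * (B / A) ^+ 2 - 2 * B * (B / A) + C = (A * C - B ^+ 2) / A by field.
by rewrite pmulr_lge0 ?subr_ge0 // invr_gt0 lt_neqAle eq_sym A1.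
Qed.

Lemma Rintegral_null f (N : set T2) : measurable N -> leb2 N = 0%E -> rintegrable D f ->
  \int[leb2]_(x in D) f x = \int[leb2]_(x in D `\` N) f x.
Proof. by move=> mN N0 rf; rewrite /Rintegral (negligible_integral mN mD rf N0). Qed.

Lemma ae_eq_Rintegral f g (N : set T2) : measurable N -> leb2 N = 0%E ->
  rintegrable D f -> rintegrable D g -> (forall x, D x -> ~ N x -> f x = g x) ->
  \int[leb2]_(x in D) f x = \int[leb2]_(x in D) g x.
Proof.
move=> mN N0 rf rg fg; rewrite (Rintegral_null mN N0 rf) (Rintegral_null mN N0 rg).
by apply: eq_Rintegral => x; rewrite inE => -[Dx Nx]; exact: fg.
Qed.

Lemma Rintegral_dominated (f_ : nat -> T2 -> R) f g (N : set T2) :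
  measurable N -> leb2 N = 0%E -> (forall n, measurable_fun D (f_ n)) -> measurable_fun D f ->
  (forall x, D x -> ~ N x -> f_ n x @[n --> \oo] --> f x) ->
  rintegrable D g -> (forall n x, D x -> `|f_ n x| <= g x) ->
  \int[leb2]_(x in D) f_ n x @[n --> \oo] --> \int[leb2]_(x in D) f x.
Proof.
move=> mN N0 mf_ mf cf rg fg.
have [] := @dominated_convergence _ _ _ leb2 D mD (fun n x => (f_ n x)%:E) (fun x => (f x)%:E)
  (fun x => (g x)%:E).
- by move=> n; exact/measurable_EFinP.
- exact/measurable_EFinP.
- exists N; split => // x /= h; apply: contrapT => Nx; apply: h => Dx.
  by apply: cvg_EFin; [near=> n|exact: cf].
- exact: rg.
- by apply: aeW => x n Dx; rewrite lee_fin; exact: fg.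
move=> rif _; rewrite -(fineK (integrable_fin_num mD rif)) => h.
exact: fine_cvg h.
Unshelve. all: by end_near.
Qed.

Lemma Rintegral_partition (n : nat) (U : 'I_n -> set T2) f :
  (forall k, measurable (U k)) -> (forall k, U k `<=` D) ->
  (forall k l x, U k x -> U l x -> k = l) ->
  leb2 (D `\` \bigcup_k U k) = 0%E -> rintegrable D f ->
  \int[leb2]_(x in D) f x = \sum_k \int[leb2]_(x in U k) f x.
Proof.
move=> mU UD dU N0 rf.
transitivity (\sum_k \int[leb2]_(x in D) (f x * \1_(U k) x)); last first.
  apply: eq_bigr => k _; rewrite -[in RHS](setIidr (UD k)) Rintegral_mkcondr.
  by apply: eq_Rintegral => x _; rewrite patchE indicE; case: ifP; rewrite ?mulr1 ?mulr0.
have rk k : rintegrable D (fun x => f x * \1_(U k) x).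
  apply: (@rintegrable_le _ (fun x => `|f x|)).
  - apply: measurable_funM; first by have := measurable_int _ rf; move/measurable_EFinP.
    exact: measurable_indic.
  - by move=> x _; rewrite normrM indicE; case: (x \in U k); rewrite ?normr1 ?mulr1 // normr0 mulr0.
  - exact: (integrable_abse rf).
rewrite -Rintegral_sum //; apply: (ae_eq_Rintegral (N := D `\` \bigcup_k U k)) => //.
- apply: measurableD => //; apply: fin_bigcup_measurable => //; exact: finite_finset.
- exact: rintegrable_sum.
- move=> x Dx h; have [k _ Ukx] : (\bigcup_k U k) x by apply: contrapT => h2; apply: h.
  rewrite (bigD1 k) //= indicE mem_set // mulr1 big1 ?addr0 // => l lk.
  rewrite indicE memNset ?mulr0 // => Ulx; move/eqP: lk; apply; exact: dU Ulx Ukx.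
Qed.

End Domain.



Lemma slice_derive (psi : R * R -> R) (p : R * R) (i : 'I_2) :
  let s := if i == 0 then fun t : R => psi (t, p.2) else fun t => psi (p.1, t) in
  let t := if i == 0 then p.1 else p.2 in
  differentiable psi p -> derivable s t 1 /\ derive1 s t = pderiv i psi p.
Proof.
move=> s t dp; have D : derivable psi p (Defs.basis i) by exact: diff_derivable.
have E : (fun h : R => h^-1 *: ((s \o shift t) (h *: (1 : R)) - s t)) =
         (fun h : R => h^-1 *: ((psi \o shift p) (h *: Defs.basis i) - psi p)).
  apply/funext => h; rewrite /s /t /basis /=; case: p {dp D s t} => a b; case: i => -[|[|//]] ? /=;
  by congr (_ *: (psi _ - _)); congr pair; rewrite /= /GRing.scale /= ?mulr0 ?add0r.
by split; [rewrite /derivable E; exact: D|rewrite derive1E /pderiv /derive E].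
Qed.

Lemma integral_compact_derivative (F f : R -> R) (r : R) : continuous f ->
  (forall t, derivable F t 1) -> derive1 F = f -> (forall t, r < `|t| -> F t = 0) ->
  (forall t, r < `|t| -> f t = 0) ->
  (\int[lebesgue_measure]_t (f t)%:E = 0)%E.
Proof.
move=> cf dF F'f F0 f0; pose a := `|r| + 1.
have ra t : a <= `|t| -> r < `|t|.
  by move=> h; apply: lt_le_trans h; rewrite /a; have := ler_norm r; lra.
have a0 : 0 < a by rewrite /a ltr_wpDl.
have -> : (fun t => (f t)%:E) = (EFin \o f) \_ `[- a, a].
  apply/funext => t; rewrite patchE; case: ifPn => //; rewrite notin_setE /= in_itv /= -ler_norml.
  by move=> /negP; rewrite -ltNge => /ltW/ra/f0 ->.
rewrite -integral_mkcond /= (@continuous_FTC2 _ f F).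
- by rewrite !F0 ?subee // ra // ?normrN ger0_norm // ltW.
- lra.
- exact: continuous_subspaceT.
- have cF : continuous F by move=> t; apply: differentiable_continuous; apply/derivable1_diffP.
  split; first by move=> t _.
  + by apply: cvg_at_right_filter; exact: cF.
  + by apply: cvg_at_left_filter; exact: cF.
- by move=> t _; rewrite F'f.
Qed.

(** Fubini reduces the integral to lines, where the fundamental theorem applies to a compactly
    supported function. The integrability that Fubini needs comes from continuity on a box outside
    which the derivative vanishes. *)
Lemma Rintegral_pderiv_eq0 (psi : R * R -> R) (r : R) (i : 'I_2) (D : set T2) :
  measurable D -> (forall x, differentiable psi x) -> continuous (pderiv i psi) ->
  (forall x, r < `|x| -> psi x = 0) -> (forall x, ~ D x -> pderiv i psi x = 0) ->
  \int[leb2]_(x in D) pderiv i psi x = 0.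
Proof.
move=> mD dpsi cpsi psi0 D0.
have g0 x : r < `|x| -> pderiv i psi x = 0.
  move=> rx; rewrite (@has_gradE_near _ _ (cst 0) _ (0, 0)); [by case: ifP| |exact: has_grad_cst].
  near=> y; apply: psi0; near: y.
  by apply: (cvgr_gt `|x|) => //; exact: cvg_norm.
have rg : rintegrable setT (pderiv i psi).
  pose B : set T2 := [set z | `|z - 0| <= `|r|].
  have mB : measurable B.
    apply: closed_measurable2; apply: (@closed_comp _ _ (fun z : R * R => `|z - 0|) [set t | t <= `|r|]).
      by move=> z _; apply: cvg_norm; apply: cvgB; [exact: cvg_id|exact: cvg_cst].
    exact: closed_le.
  have fB : (leb2 B < +oo)%E by rewrite /B box_measure // ltry.
  have -> : pderiv i psi = (pderiv i psi : T2 -> R) \_ B.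
    apply/funext => x; rewrite patchE; case: ifPn => //; rewrite notin_setE /B /= subr0 => /negP.
    by rewrite -ltNge => h; apply: g0; apply: le_lt_trans h; exact: ler_norm.
  rewrite /rintegrable (_ : (fun x => _) = (fun x : T2 => (pderiv i psi x)%:E) \_ B); last first.
    by apply/funext => x; rewrite !patchE; case: ifP.
  suff : rintegrable B (pderiv i psi) by move/(integrable_mkcond _ mB).
  have cB : compact (B : set (R * R)).
    have -> : (B : set (R * R)) = `[- `|r|, `|r|]%classic `*` `[- `|r|, `|r|]%classic.
      apply/seteqP; split => z; rewrite /B /= !in_itv /= prod_normE /= ge_max !ler_norml.
      - by move=> /andP[/andP[? ?] /andP[? ?]]; split; apply/andP; split; lra.
      - by move=> [/andP[? ?] /andP[? ?]]; do 2 (apply/andP; split); lra.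
    by apply: compact_setX; exact: segment_compact.
  have [M [_ hM]] : bounded_set (pderiv i psi @` (B : set (R * R))).
    apply: compact_bounded; apply: continuous_compact => //; exact: continuous_subspaceT.
  apply: (@rintegrable_bounded _ mB fB _ (M + 1)); first exact: continuous_measurable2.
  by move=> x Bx; apply: hM; [lra|exists x].
have -> : \int[leb2]_(x in D) pderiv i psi x = \int[leb2]_x pderiv i psi x.
  rewrite Rintegral_mkcond; congr (Rintegral _ _ _); apply/funext => x; rewrite patchE.
  by case: ifPn => //; rewrite notin_setE => /D0.
rewrite /Rintegral -(integral12_prod_meas1 rg) /fubini_F.
have [i0|i0] := eqVneq i 0.
  rewrite (Fubini rg) integral0_eq // => y _.
  apply: (@integral_compact_derivative (fun t => psi (t, y)) _ r).
  - move=> t; apply: (@continuous_comp _ _ _ (fun t : R => (t, y)) (pderiv i psi)); last exact: cpsi.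
    exact: (cvg_pair (@cvg_id _ _) (cvg_cst y)).
  - by move=> t; have [] := @slice_derive psi (t, y) i (dpsi _); rewrite i0.
  - by apply/funext => t; have [_] := @slice_derive psi (t, y) i (dpsi _); rewrite i0.
  - by move=> t h; apply: psi0; rewrite prod_normE /= lt_max h.
  - by move=> t h; apply: g0; rewrite prod_normE /= lt_max h.
rewrite integral0_eq // => y _.
apply: (@integral_compact_derivative (fun t => psi (y, t)) _ r).
- move=> t; apply: (@continuous_comp _ _ _ (fun t : R => (y, t)) (pderiv i psi)); last exact: cpsi.
  exact: (cvg_pair (cvg_cst y) (@cvg_id _ _)).
- by move=> t; have [] := @slice_derive psi (y, t) i (dpsi _); rewrite (negbTE i0).
- by apply/funext => t; have [_] := @slice_derive psi (y, t) i (dpsi _); rewrite (negbTE i0).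
- by move=> t h; apply: psi0; rewrite prod_normE /= lt_max h orbT.
- by move=> t h; apply: g0; rewrite prod_normE /= lt_max h orbT.
Unshelve. all: by end_near.
Qed.

End PlaneMeasure.

(** * Weak derivatives tested against Lipschitz functions *)

Section TestFunctions.
Context {R : realType}.
Local Notation T2 := (measurableTypeR R * measurableTypeR R)%type.
Implicit Types (phi psi f g u w : R * R -> R) (x y : R * R) (i : 'I_2).

Lemma differentiable_has_grad phi x : differentiable phi x ->
  has_grad phi x (pderiv 0 phi x, pderiv 1 phi x).
Proof.
move=> d; apply: DiffDef => //; apply/funext => h /=.
have hE : h = h.1 *: Defs.basis 0 + h.2 *: Defs.basis 1.
  case: h => a b; rewrite /Defs.basis /=; congr pair; rewrite /= /GRing.scale /= ?mulr0 ?mulr1 ?addr0 ?add0r //.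
by rewrite {1}hE linearD !linearZ /= /pderiv !deriveE // /GRing.scale /= [X in X + _]mulrC [X in _ + X]mulrC.
Qed.

Lemma ord2E i : i = 0 \/ i = 1.
Proof. by case: i => -[|[|//]] ?; [left|right]; exact: val_inj. Qed.

Lemma pderivM phi psi i x : differentiable phi x -> differentiable psi x ->
  pderiv i (fun y => phi y * psi y) x = phi x * pderiv i psi x + psi x * pderiv i phi x.
Proof.
move=> dp dq; have h := has_gradM (differentiable_has_grad dp) (differentiable_has_grad dq).
rewrite (has_gradE i h) /= /GRing.scale /=.
by case: (ord2E i) => ->.
Qed.

Section OnDomain.
Variables (Omega : set (R * R)) (r : R).
Hypotheses (Omega_open : open Omega) (Omega_le : forall x, Omega x -> `|x| <= r).

Let mO : measurable (Omega : set T2). Proof. exact: open_measurable2. Qed.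
Let fO : (leb2 (Omega : set T2) < +oo)%E. Proof. exact: bounded_finite Omega_le mO. Qed.

Lemma smooth_differentiable phi x : smooth phi -> differentiable phi x.
Proof. by move=> s; exact: (s [::] x). Qed.

Lemma smooth_pderiv_differentiable phi i x : smooth phi -> differentiable (pderiv i phi) x.
Proof. by move=> s; exact: (s [:: i] x). Qed.

Lemma smooth_continuous phi : smooth phi -> continuous phi.
Proof. by move=> s x; apply: differentiable_continuous; exact: smooth_differentiable. Qed.

Lemma smooth_pderiv_continuous phi i : smooth phi -> continuous (pderiv i phi).
Proof. by move=> s x; apply: differentiable_continuous; exact: smooth_pderiv_differentiable. Qed.

Lemma test_fun_out phi x : test_fun Omega phi -> ~ Omega x -> phi x = 0.
Proof.
move=> [_ _ h] nx; apply/eqP/negPn/negP => px; apply: nx; apply: h.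
exact: subset_closure.
Qed.

Lemma test_fun_pderiv_out phi i x : test_fun Omega phi -> ~ Omega x -> pderiv i phi x = 0.
Proof.
move=> [_ _ h] nx; have nc : ~ closure [set x | phi x != 0] x by move=> /h.
rewrite (@has_gradE_near _ _ (cst 0) _ (0, 0)); [by case: ifP| |exact: has_grad_cst].
have : nbhs x (~` closure [set x | phi x != 0]).
  by apply: open_nbhs_nbhs; split => //; apply: closed_openC; exact: closed_closure.
apply: filterS => y /= nc'; apply/eqP/negPn/negP => py; apply: nc'; exact: subset_closure.
Qed.

Lemma continuous_compact_bounded f (K : set (R * R)) : compact K -> continuous f ->
  (forall x, ~ K x -> f x = 0) -> exists2 M : R, 0 <= M & forall x, `|f x| <= M.
Proof.
move=> cK cf f0; have [M [_ hM]] : bounded_set (f @` K).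
  by apply: compact_bounded; apply: continuous_compact => //; exact: continuous_subspaceT.
exists (`|M| + 1); first by rewrite addr_ge0.
move=> x; have [Kx|/f0 ->] := pselect (K x); last by rewrite normr0 addr_ge0.
by apply: hM; [have := ler_norm M; lra|exists x].
Qed.

Lemma test_fun_bounded phi : test_fun Omega phi -> exists2 M : R, 0 <= M & forall x, `|phi x| <= M.
Proof.
move=> [s c _]; apply: (continuous_compact_bounded c); first exact: smooth_continuous.
by move=> x nc; apply/eqP/negPn/negP => px; apply: nc; exact: subset_closure.
Qed.

Lemma test_fun_pderiv_bounded phi i : test_fun Omega phi ->
  exists2 M : R, 0 <= M & forall x, `|pderiv i phi x| <= M.
Proof.
move=> t; have [s c _] := t; apply: (continuous_compact_bounded c); first exact: smooth_pderiv_continuous.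
move=> x nx; rewrite (@has_gradE_near _ _ (cst 0) _ (0, 0)); [by case: ifP| |exact: has_grad_cst].
have : nbhs x (~` closure [set x | phi x != 0]).
  by apply: open_nbhs_nbhs; split => //; apply: closed_openC; exact: closed_closure.
apply: filterS => y /= nc'; apply/eqP/negPn/negP => py; apply: nc'; exact: subset_closure.
Qed.

Lemma derivable_lipschitz (f : R -> R) (M a b : R) : (forall t, derivable f t 1) ->
  (forall t, `|derive1 f t| <= M) -> `|f b - f a| <= M * `|b - a|.
Proof.
move=> df fM; wlog ab : a b / a <= b.
  by move=> H; have [ab|/ltW ab] := leP a b; [exact: H|rewrite distrC [`|b - a|]distrC; exact: H].
have cf : {within `[a, b], continuous f}.
  by apply: continuous_subspaceT => t; apply: differentiable_continuous; apply/derivable1_diffP.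
have hd (t : R) : t \in `]a, b[ -> is_derive t 1 f (derive1 f t).
  by move=> _; rewrite derive1E; exact: derivableP.
have [c _ ->] := MVT_segment ab hd cf.
by rewrite normrM ler_wpM2r.
Qed.

(** Two axis-parallel steps through [(y.1, x.2)] reduce this to the mean value theorem; they may
    leave [Omega], which is harmless as [phi] is smooth on the whole plane. *)
Lemma test_fun_lipschitz phi : test_fun Omega phi ->
  exists2 L : R, 0 <= L & forall x y, `|phi x - phi y| <= L * `|x - y|.
Proof.
move=> t; have [M0 M00 h0] := test_fun_pderiv_bounded 0 t.
have [M1 M10 h1] := test_fun_pderiv_bounded 1 t.
exists (M0 + M1); first by rewrite addr_ge0.
have d x : differentiable phi x by case: t => s _ _; exact: smooth_differentiable.
move=> x y; have -> : phi x - phi y = (phi (x.1, x.2) - phi (y.1, x.2)) + (phi (y.1, x.2) - phi (y.1, y.2)).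
  by rewrite addrA subrK -!surjective_pairing.
apply: le_trans (ler_normD _ _) _; rewrite mulrDl; apply: lerD.
- apply: (@le_trans _ _ (M0 * `|x.1 - y.1|)); last by rewrite ler_wpM2l // prod_normE /= le_max lexx.
  apply: (@derivable_lipschitz (fun t => phi (t, x.2))) => s.
  + by have [] := @slice_derive _ phi (s, x.2) 0 (d _).
  + by have [_ ->] := @slice_derive _ phi (s, x.2) 0 (d _); exact: h0.
- apply: (@le_trans _ _ (M1 * `|x.2 - y.2|)); last by rewrite ler_wpM2l // prod_normE /= le_max lexx orbT.
  apply: (@derivable_lipschitz (fun t => phi (y.1, t))) => s.
  + by have [] := @slice_derive _ phi (y.1, s) 1 (d _).
  + by have [_ ->] := @slice_derive _ phi (y.1, s) 1 (d _); exact: h1.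
Qed.

Lemma continuous_measurable_Omega f : continuous f -> measurable_fun (Omega : set T2) f.
Proof. by move=> cf; exact: continuous_measurable2. Qed.

Lemma test_fun_L2 phi : test_fun Omega phi -> L2 Omega phi.
Proof.
move=> t; have [M _ hM] := test_fun_bounded t; have [s _ _] := t.
by apply: (L2_bounded mO fO (M := M)) => //; apply: continuous_measurable_Omega; exact: smooth_continuous.
Qed.

Lemma test_fun_pderiv_L2 phi i : test_fun Omega phi -> L2 Omega (pderiv i phi).
Proof.
move=> t; have [M _ hM] := test_fun_pderiv_bounded i t; have [s _ _] := t.
by apply: (L2_bounded mO fO (M := M)) => //; apply: continuous_measurable_Omega; exact: smooth_pderiv_continuous.
Qed.

Lemma test_fun_pderiv_int0 phi psi i : test_fun Omega phi -> smooth psi ->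
  \int[leb2]_(x in Omega) pderiv i (fun y => phi y * psi y) x = 0.
Proof.
move=> t spsi; have [s _ _] := t.
have E x : pderiv i (fun y => phi y * psi y) x = phi x * pderiv i psi x + psi x * pderiv i phi x.
  by apply: pderivM; exact: smooth_differentiable.
apply: (@Rintegral_pderiv_eq0 _ _ r) => //.
- move=> x; apply: differentiableM; exact: smooth_differentiable.
- have -> : pderiv i (fun y => phi y * psi y) = fun x => phi x * pderiv i psi x + psi x * pderiv i phi x.
    exact/funext.
  move=> x; apply: cvgD; apply: cvgM; (try exact: smooth_continuous); exact: smooth_pderiv_continuous.
- move=> x rx; rewrite (test_fun_out t) ?mul0r // => /Omega_le; rewrite leNgt rx.
  by [].
- move=> x nx; rewrite E (test_fun_out t) // (test_fun_pderiv_out i t) // mul0r mulr0 addr0.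
  by [].
Qed.

Lemma test_fun_weak_pderiv phi i : test_fun Omega phi -> is_weak_pderiv Omega i phi (pderiv i phi).
Proof.
move=> t psi t'; have [s _ _] := t; have [s' _ _] := t'.
apply/eqP; rewrite -addr_eq0 -RintegralD //; last 2 first.
- exact: (L2_mul mO (test_fun_L2 t) (test_fun_pderiv_L2 i t')).
- exact: (L2_mul mO (test_fun_pderiv_L2 i t) (test_fun_L2 t')).
rewrite -[X in _ == X](test_fun_pderiv_int0 i t s'); apply/eqP; apply: eq_Rintegral => x _.
by rewrite pderivM; [rewrite [psi x * _]mulrC|exact: smooth_differentiable|exact: smooth_differentiable].
Qed.

(** For later use with [phi * w] as the function tested: with 1 as the field, the Green formula says
    that the integral of the derivative of [phi * w] vanishes. *)
Lemma cst1_weak_pderiv i : is_weak_pderiv Omega i (fun=> 1) (fun=> 0).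
Proof.
move=> phi t; have [s _ _] := t.
have s1 : smooth (fun _ : R * R => 1 : R).
  have -> : (fun _ : R * R => 1 : R) = tensor (fun (_ : 'I_1) _ => 1) (fun _ _ => 1).
    by apply/funext => x; rewrite /tensor big_ord1 mulr1.
  by apply: smooth_tensor => _ n; exact: Cn_cst.
transitivity (0 : R); last first.
  have -> : (fun x => 0 * phi x) = (fun x => 0 : R) by apply/funext => x; rewrite mul0r.
  by rewrite Rintegral_cst // mul0r oppr0.
rewrite -(test_fun_pderiv_int0 i t s1); apply: eq_Rintegral => x _.
rewrite mul1r; congr (pderiv i _ x); by apply/funext => y; rewrite mulr1.
Qed.

(** The smooth approximations of [u] have gradients bounded by [C * L], so [C * L * |f|] dominates.
    Differentiability off an explicit null set is a hypothesis, which stands in for Rademacher's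
    theorem. *)
Lemma weak_pderiv_lipschitz f g u (G : 'I_2 -> R * R -> R) i (L : R) (N : set T2) :
  L2 Omega f -> L2 Omega g -> is_weak_pderiv Omega i f g ->
  0 <= L -> (forall x y, `|u x - u y| <= L * `|x - y|) -> (forall x, ~ Omega x -> u x = 0) ->
  measurable N -> leb2 N = 0%E ->
  (forall x, Omega x -> ~ N x -> has_grad u x (G 0 x, G 1 x)) -> measurable_fun (Omega : set T2) (G i) ->
  \int[leb2]_(x in Omega) (f x * G i x) = - \int[leb2]_(x in Omega) (g x * u x).
Proof.
move=> f2 g2 fg L0 uL u0 mN N0 uG mG.
have [C C0 /(_ u)[phi [tphi phiB phic phiL phiG]]] := mollification Omega_open Omega_le.
have cu : continuous u.
  move=> x; apply/cvgrPdist_le => e e0; have d0 : 0 < e / (L + 1) by rewrite divr_gt0 // ltr_wpDl.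
  near=> y; apply: le_trans (uL _ _) _.
  have : `|x - y| <= e / (L + 1) by near: y; apply: cvgr_dist_le => //; exact: cvg_id.
  rewrite ler_pdivlMr ?ltr_wpDl // => h; have := normr_ge0 (x - y); nra.
have [W W0 uW] : exists2 W : R, 0 <= W & forall x, Omega x -> `|u x| <= W.
  exists (`|u 0| + L * `|r|); first by rewrite addr_ge0 // mulr_ge0.
  move=> x Ox; have -> : u x = u 0 + (u x - u 0) by rewrite addrC subrK.
  apply: le_trans (ler_normD _ _) _; rewrite lerD2l; apply: le_trans (uL _ _) _.
  by rewrite subr0 ler_wpM2l //; apply: le_trans (Omega_le Ox) (ler_norm _).
have s n : smooth (phi n) by case: (tphi n).
have h1 : \int[leb2]_(x in Omega) (f x * pderiv i (phi n) x) @[n --> \oo] -->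
    \int[leb2]_(x in Omega) (f x * G i x).
  apply: (Rintegral_dominated mO mN N0 (g := fun x => C * L * `|f x|)).
  - move=> n; apply: measurable_funM; first exact: L2_measurable f2.
    by apply: continuous_measurable_Omega; exact: smooth_pderiv_continuous.
  - by apply: measurable_funM => //; exact: L2_measurable f2.
  - move=> x Ox Nx; apply: cvgM; first exact: cvg_cst.
    have -> : G i x = if i == 0 then (G 0 x, G 1 x).1 else (G 0 x, G 1 x).2.
      by case: (ord2E i) => ->.
    exact: phiG (uG _ Ox Nx).
  - apply: rintegrableZ => //; exact: (integrable_abse (L2_rintegrable mO fO f2)).
  - by move=> n x Ox; rewrite normrM mulrC ler_wpM2r //; exact: phiL.
have h2 : \int[leb2]_(x in Omega) (g x * phi n x) @[n --> \oo] --> \int[leb2]_(x in Omega) (g x * u x).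
  apply: (Rintegral_dominated mO mN N0 (g := fun x => C * W * `|g x|)).
  - move=> n; apply: measurable_funM; first exact: L2_measurable g2.
    by apply: continuous_measurable_Omega; exact: smooth_continuous.
  - by apply: measurable_funM; [exact: L2_measurable g2|exact: continuous_measurable_Omega].
  - by move=> x Ox Nx; apply: cvgM; [exact: cvg_cst|apply: phic => //; exact: cu].
  - apply: rintegrableZ => //; exact: (integrable_abse (L2_rintegrable mO fO g2)).
  - by move=> n x Ox; rewrite normrM mulrC ler_wpM2r //; exact: phiB.
have h3 : \int[leb2]_(x in Omega) (f x * pderiv i (phi n) x) @[n --> \oo] -->
    - \int[leb2]_(x in Omega) (g x * u x).
  rewrite (_ : (fun n => _) = (fun n => - \int[leb2]_(x in Omega) (g x * phi n x))); first exact: cvgN h2.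
  by apply/funext => n; exact: fg.
by rewrite -(cvg_lim _ h1) // -(cvg_lim _ h3).
Unshelve. all: by end_near.
Qed.

(** A substitute for the density of test functions in L2: bounded functions continuous almost
    everywhere are dominated limits of test functions. It makes identities known only against test
    functions available against [w]. *)
Lemma orthogonal_test_fun h w (W : R) (N : set T2) : L2 Omega h ->
  (forall phi, test_fun Omega phi -> \int[leb2]_(x in Omega) (h x * phi x) = 0) ->
  0 <= W -> (forall x, Omega x -> `|w x| <= W) -> measurable_fun (Omega : set T2) w ->
  measurable N -> leb2 N = 0%E -> (forall x, Omega x -> ~ N x -> {for x, continuous w}) ->
  \int[leb2]_(x in Omega) (h x * w x) = 0.
Proof.
move=> h2 hperp W0 wW mw mN N0 cw.
have [C C0 /(_ w)[phi [tphi phiB phic _ _]]] := mollification Omega_open Omega_le.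
have : \int[leb2]_(x in Omega) (h x * phi n x) @[n --> \oo] --> \int[leb2]_(x in Omega) (h x * w x).
  apply: (Rintegral_dominated mO mN N0 (g := fun x => C * W * `|h x|)).
  - move=> n; apply: measurable_funM; first exact: L2_measurable h2.
    by apply: continuous_measurable_Omega; apply: smooth_continuous; case: (tphi n).
  - by apply: measurable_funM => //; exact: L2_measurable h2.
  - by move=> x Ox Nx; apply: cvgM; [exact: cvg_cst|apply: phic => //; exact: cw].
  - apply: rintegrableZ => //; exact: (integrable_abse (L2_rintegrable mO fO h2)).
  - by move=> n x Ox; rewrite normrM mulrC ler_wpM2r //; exact: phiB.
rewrite (_ : (fun n => _) = (fun=> 0)); last by apply/funext => n; exact: hperp.
by move=> /cvg_lim <- //; rewrite lim_cst.
Qed.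

Lemma wderivP f i : H1 Omega f -> L2 Omega (wderiv Omega i f) /\ is_weak_pderiv Omega i f (wderiv Omega i f).
Proof. by move=> [_ /(_ i) h]; exact: (xgetPex _ h). Qed.

Lemma sqnorm_wderiv_le f i : sqnorm_L2 Omega (wderiv Omega i f) <= sqnorm_H1 Omega f.
Proof.
rewrite /sqnorm_H1 (bigD1 i) //= addrCA lerDl addr_ge0 ?sqnorm_L2_ge0 //.
by apply: sumr_ge0 => j _; exact: sqnorm_L2_ge0.
Qed.

Lemma sqnorm_L2_le f : sqnorm_L2 Omega f <= sqnorm_H1 Omega f.
Proof. by rewrite /sqnorm_H1 lerDl; apply: sumr_ge0 => j _; exact: sqnorm_L2_ge0. Qed.

Lemma H1_sub_test_fun f phi : H1 Omega f -> test_fun Omega phi -> H1 Omega (fun x => f x - phi x).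
Proof.
move=> Hf t; split; first exact: (L2B mO Hf.1 (test_fun_L2 t)).
move=> i; have [g2 fg] := wderivP i Hf.
exists (fun x => wderiv Omega i f x - pderiv i phi x); split.
  exact: (L2B mO g2 (test_fun_pderiv_L2 i t)).
move=> psi t'.
have f2 := Hf.1; have p2 := test_fun_L2 t; have dp2 := test_fun_pderiv_L2 i t.
have q2 := test_fun_L2 t'; have dq2 := test_fun_pderiv_L2 i t'.
transitivity (\int[leb2]_(x in Omega) (f x * pderiv i psi x) - \int[leb2]_(x in Omega) (phi x * pderiv i psi x)).
  rewrite -(RintegralB mO (L2_mul mO f2 dq2) (L2_mul mO p2 dq2)).
  by apply: eq_Rintegral => x _; rewrite mulrBl.
rewrite fg // (test_fun_weak_pderiv i t) // opprK addrC -opprB; congr (- _).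
rewrite -(RintegralB mO (L2_mul mO g2 q2) (L2_mul mO dp2 q2)).
by apply: eq_Rintegral => x _; rewrite mulrBl.
Qed.

Let cancel_sum (a1 a2 b1 b2 c : R) : b1 + b2 = 0 -> 0 = a2 - b2 - c -> a1 + a2 = a1 - b1 + c.
Proof. by lra. Qed.

(** The left-hand side is a functional of [f], continuous in the H1 norm by the Cauchy-Schwarz
    inequality and zero on test functions. *)
Lemma H10_weak_identity f w (G : R * R -> R) (W M : R) (N : set T2) i :
  H10 Omega f -> 0 <= W -> (forall x, Omega x -> `|w x| <= W) -> measurable_fun (Omega : set T2) w ->
  measurable N -> leb2 N = 0%E -> (forall x, Omega x -> ~ N x -> {for x, continuous w}) ->
  measurable_fun (Omega : set T2) G -> (forall x, Omega x -> `|G x| <= M) ->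
  (forall phi, test_fun Omega phi ->
    \int[leb2]_(x in Omega) (phi x * G x) + \int[leb2]_(x in Omega) (pderiv i phi x * w x) = 0) ->
  \int[leb2]_(x in Omega) (f x * G x) + \int[leb2]_(x in Omega) (wderiv Omega i f x * w x) = 0.
Proof.
move=> [Hf Happ] W0 wW mw mN N0 cw mG GM Hphi.
have w2 : L2 Omega w by exact: (L2_bounded mO fO mw wW).
have G2 : L2 Omega G by exact: (L2_bounded mO fO mG GM).
set A := (X in X = 0); set K := Num.sqrt (sqnorm_L2 Omega G) + Num.sqrt (sqnorm_L2 Omega w).
have K0 : 0 <= K by rewrite addr_ge0 // sqrtr_ge0.
suff H e : 0 < e -> `|A| <= e * K.
  apply/eqP; rewrite -normr_eq0 eq_le normr_ge0 andbT; apply/ler_addgt0Pr => e e0; rewrite add0r.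
  have e1 : 0 < e / (K + 1) by rewrite divr_gt0 // ltr_wpDl.
  by apply: le_trans (H _ e1) _; rewrite mulrAC ler_pdivrMr ?ltr_wpDl //; nra.
move=> e0; have [phi t hphi] := Happ _ e0.
have Hd := H1_sub_test_fun Hf t; set d := (fun x => f x - phi x) in Hd hphi.
have [g2 fg] := wderivP i Hf; have [gd2 dg] := wderivP i Hd.
have f2 := Hf.1; have d2 := Hd.1; have p2 := test_fun_L2 t; have dp2 := test_fun_pderiv_L2 i t.
set g := wderiv Omega i f in g2 fg A *; set gd := wderiv Omega i d in gd2 dg.
(* [wderiv] is not literally additive: [gd] and [g - pderiv i phi] are merely weak derivatives of
   the same function, hence have the same pairing with each test function, and then with [w]. *)
have perp : \int[leb2]_(x in Omega) ((g x - pderiv i phi x - gd x) * w x) = 0.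
  apply: (orthogonal_test_fun _ _ W0 wW mw mN N0 cw); first exact: (L2B mO (L2B mO g2 dp2) gd2).
  move=> psi t'; have q2 := test_fun_L2 t'; have dq2 := test_fun_pderiv_L2 i t'.
  transitivity (\int[leb2]_(x in Omega) (g x * psi x) - \int[leb2]_(x in Omega) (pderiv i phi x * psi x)
      - \int[leb2]_(x in Omega) (gd x * psi x)).
    rewrite -(RintegralB mO (L2_mul mO g2 q2) (L2_mul mO dp2 q2)).
    rewrite -(RintegralB mO _ (L2_mul mO gd2 q2)); last first.
      by have := L2_mul mO (L2B mO g2 dp2) q2; apply: eq_integrable => // x _; rewrite mulrBl.
    by apply: eq_Rintegral => x _; rewrite !mulrBl.
  have E (a b c a' b' c' : R) : a' = - a -> b' = - b -> c' = - c -> c' = a' - b' -> a - b - c = 0.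
    by move=> -> -> -> h; lra.
  apply: E (fg _ t') (test_fun_weak_pderiv i t t') (dg _ t') _.
  rewrite -(RintegralB mO (L2_mul mO f2 dq2) (L2_mul mO p2 dq2)).
  by apply: eq_Rintegral => x _; rewrite /d mulrBl.
have -> : A = \int[leb2]_(x in Omega) (d x * G x) + \int[leb2]_(x in Omega) (gd x * w x).
  have E1 : \int[leb2]_(x in Omega) (d x * G x) =
      \int[leb2]_(x in Omega) (f x * G x) - \int[leb2]_(x in Omega) (phi x * G x).
    rewrite -(RintegralB mO (L2_mul mO f2 G2) (L2_mul mO p2 G2)).
    by apply: eq_Rintegral => x _; rewrite /d mulrBl.
  have E2 : 0 = \int[leb2]_(x in Omega) (g x * w x) - \int[leb2]_(x in Omega) (pderiv i phi x * w x)
      - \int[leb2]_(x in Omega) (gd x * w x).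
    rewrite -perp -(RintegralB mO (L2_mul mO g2 w2) (L2_mul mO dp2 w2)).
    rewrite -(RintegralB mO _ (L2_mul mO gd2 w2)); last first.
      by have := L2_mul mO (L2B mO g2 dp2) w2; apply: eq_integrable => // x _; rewrite mulrBl.
    by apply: eq_Rintegral => x _; rewrite !mulrBl.
  by rewrite E1; exact: cancel_sum (Hphi _ t) E2.
apply: le_trans (ler_normD _ _) _; rewrite mulrDr.
have dn : Num.sqrt (sqnorm_L2 Omega d) <= e.
  by apply: le_trans (ltW hphi); rewrite ler_wsqrtr // sqnorm_L2_le.
have gn : Num.sqrt (sqnorm_L2 Omega gd) <= e.
  by apply: le_trans (ltW hphi); rewrite ler_wsqrtr // sqnorm_wderiv_le.
apply: lerD.
- by apply: le_trans (cauchy_schwarz mO d2 G2) _; rewrite ler_wpM2r ?sqrtr_ge0.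
- by apply: le_trans (cauchy_schwarz mO gd2 w2) _; rewrite ler_wpM2r ?sqrtr_ge0.
Qed.

End OnDomain.
End TestFunctions.

(** * Gluing Lipschitz functions *)

Section Gluing.
Context {R : realType}.

Lemma closed_max (A : set R) (b : R) : closed A -> A !=set0 -> (forall t, A t -> t <= b) ->
  exists2 d, A d & forall t, A t -> t <= d.
Proof.
move=> cA A0 Ab; have ub : has_ubound A by exists b.
by exists (sup A); [exact/cA/closure_sup|move=> t; exact: ub_le_sup].
Qed.

Lemma closed_min (A : set R) (a : R) : closed A -> A !=set0 -> (forall t, A t -> a <= t) ->
  exists2 c, A c & forall t, A t -> c <= t.
Proof.
move=> cA [t0 At0] aA.
have [|||c Ac hc] := @closed_max (-%R @^-1` A) (- a).
- by apply: preimage_closed => // t _; exact: opp_continuous.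
- by exists (- t0); rewrite /= opprK.
- by move=> t /= /aA; rewrite lerNr.
- by exists (- c) => // t At; rewrite lerNl; apply: hc; rewrite /= opprK.
Qed.

Lemma segment_closure (a b t : R) : a < b -> a <= t <= b -> closure `]a, b[%classic t.
Proof.
move=> ab /andP[ta tb] B /nbhs_ballP[e /= e0 eB].
pose d := Num.min 2^-1 (e / (b - a)).
have ba : 0 < b - a by rewrite subr_gt0.
have d0 : 0 < d by rewrite lt_min invr_gt0 ltr0n divr_gt0.
have d2 : d <= 2^-1 by rewrite ge_min lexx.
have de : d * (b - a) <= e by rewrite -ler_pdivlMr // ge_min lexx orbT.
exists (t + d * ((a + b) / 2 - t)); split.
  rewrite /= in_itv /=; apply/andP; split; nra.
by apply: eB; rewrite -ball_normE /= opprD addNKr ltr_norml; apply/andP; split; nra.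
Qed.

(** Induction on the number of sets, without continuity of [f]: one estimate jumps from the first to
    the last point of [[a, b]] in the last set, and the two remaining pieces are covered by the
    other sets. *)
Lemma cover_lipschitz (f : R -> R) (L : R) (n : nat) (F : nat -> set R) (a b : R) :
  0 <= L -> (forall k, closed (F k)) ->
  (forall t, a <= t <= b -> exists2 k, (k < n)%N & F k t) ->
  (forall k s t, (k < n)%N -> a <= s <= b -> a <= t <= b -> F k s -> F k t ->
     `|f s - f t| <= L * `|s - t|) ->
  a <= b -> `|f b - f a| <= L * (b - a).
Proof.
move=> L0 cF; elim: n a b => [|n IH] a b cov lip ab.
  by have [//|k] := cov a; rewrite ?lexx.
pose A := F n `&` [set t | a <= t <= b].
have cA : closed A.
  apply: closedI => //; rewrite (_ : [set t | _] = `[a, b]%classic); first exact: interval_closed.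
  by apply/seteqP; split => t; rewrite /= in_itv.
have [A0|/set0P A0] := eqVneq A set0.
  apply: IH => // [t tab|k s t kn]; last exact: lip (ltnW _).
  have [k kn Fk] := cov t tab; exists k => //.
  move: kn; rewrite ltnS leq_eqVlt => /predU1P[kE|//].
  by exfalso; have : A t; [split => //; rewrite -kE|rewrite A0].
have [d [Fd /andP[ad db]] hd] := @closed_max A b cA A0 (fun t h => proj2 (andP h.2)).
have [c [Fc /andP[ac cb]] hc] := @closed_min A a cA A0 (fun t h => proj1 (andP h.2)).
have cd : c <= d by apply: hd; split => //; apply/andP.
(* points of [a, b] outside [c, d] are not in [F n]; the endpoints follow by closure *)
have side (e e' : R) : a <= e -> e <= e' -> e' <= b ->
    (forall t, e < t < e' -> exists2 k, (k < n)%N & F k t) -> `|f e' - f e| <= L * (e' - e).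
  move=> ae ee' e'b h.
  have [->|ne] := eqVneq e e'; first by rewrite !subrr normr0 mulr0.
  have lt : e < e' by rewrite lt_neqAle ne.
  apply: IH => // [t /andP[et te']|k s t kn /andP[s1 s2] /andP[t1 t2]]; last first.
    by apply: lip (ltnW _) _ _ => //; apply/andP; split; lra.
  have cU : closed (\bigcup_(k in `I_n) F k) by apply: closed_bigcup => //; exact: finite_II.
  suff [k kn Fk] : (\bigcup_(k in `I_n) F k) t by exists k.
  have oU : `]e, e'[%classic `<=` \bigcup_(k in `I_n) F k.
    by move=> s; rewrite /= in_itv /= => /h[k kn Fk]; exists k.
  apply: cU; apply: (closure_subset oU).
  by apply: segment_closure => //; apply/andP.
have E : f b - f a = (f b - f d) + (f d - f c) + (f c - f a) by ring.
have -> : L * (b - a) = L * (b - d) + L * (d - c) + L * (c - a) by ring.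
rewrite E; apply: le_trans (ler_normD _ _) _; apply: lerD.
  apply: le_trans (ler_normD _ _) _; apply: lerD.
    apply: side => // t /andP[dt tb]; have tab : a <= t <= b by apply/andP; split; lra.
    have [k kn Fk] := cov t tab; exists k => //; move: kn; rewrite ltnS leq_eqVlt => /predU1P[kE|//].
    by exfalso; move: dt; rewrite ltNge => /negP; apply; apply: hd; split => //; rewrite -kE.
  rewrite -[X in _ <= _ * X]ger0_norm ?subr_ge0 //.
  by apply: (lip n) => //; apply/andP; split; lra.
apply: side => // t /andP[at0 tc]; have tab : a <= t <= b by apply/andP; split; lra.
have [k kn Fk] := cov t tab; exists k => //; move: kn; rewrite ltnS leq_eqVlt => /predU1P[kE|//].
by exfalso; move: tc; rewrite ltNge => /negP; apply; apply: hc; split => //; rewrite -kE.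
Qed.

Lemma small_avoiding (s : seq R) (d : R) : 0 < d -> exists2 t, 0 < t < d & t \notin s.
Proof.
move=> d0.
have [d' /andP[d'0 d'd] hd'] : exists2 d', 0 < d' <= d & forall z, z \in s -> z <= 0 \/ d' <= z.
  elim: s => [|z s [e /andP[e0 ed] he]]; first by exists d; rewrite ?d0 ?lexx.
  have [z0|z0] := leP z 0.
    exists e; first by rewrite e0.
    by move=> y; rewrite inE => /predU1P[->|/he]; [left|].
  exists (Num.min e z); first by rewrite lt_min e0 z0 ge_min ed.
  move=> y; rewrite inE => /predU1P[->|/he[|h]]; [right|left|right] => //.
    by rewrite ge_min lexx orbT.
  by rewrite ge_min h.
exists (d' / 2); first by apply/andP; split; lra.
by apply/negP => /hd'[]; lra.
Qed.

Lemma seq_separated (V : seq (R * R)) (y : R * R) : y \notin V ->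
  exists2 d : R, 0 < d & forall v, v \in V -> d <= `|v - y|.
Proof.
elim: V => [|v V IH]; first by exists 1.
rewrite inE negb_or => /andP[yv /IH[d d0 hd]].
exists (Num.min d `|v - y|); first by rewrite lt_min d0 normr_gt0 subr_eq0 eq_sym.
by move=> z; rewrite inE => /predU1P[->|/hd h]; rewrite ge_min ?lexx ?orbT // h.
Qed.

(** The end point [y] is moved along the normal [n] to the segment; each point of [V], being
    distinct from [x], rules out at most one displacement. *)
Lemma perturb_segment (V : seq (R * R)) (x y : R * R) (e : R) : x \notin V -> 0 < e ->
  exists2 y', `|y - y'| < e & forall t, x + t *: (y' - x) \notin V.
Proof.
move=> xV e0; have [->|xy] := eqVneq y x.
  by exists x => [|t]; rewrite subrr ?normr0 // scaler0 addr0.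
pose n : R * R := (- (y - x).2, (y - x).1).
have n0 : 0 < `|n|.
  rewrite normr_gt0; apply: contraNneq xy => -[h1 h2]; rewrite -subr_eq0 (surjective_pairing (y - x)).
  by move/eqP: h1; rewrite oppr_eq0 => /eqP; rewrite /= h2 => ->.
have en : 0 < e / `|n| by rewrite divr_gt0.
(* The listed value for [v] is the [t] for which [v] lies on the line through [x] and
   [y + t *: n]. *)
have [t /andP[t0 te] tV] := small_avoiding [seq - cross (v - x) (y - x) / cross (v - x) n | v <- V] en.
exists (y + t *: n); first by rewrite opprD addNKr normrN normrZ gtr0_norm // -ltr_pdivlMr.
move=> s; apply/negP => sV; move/negP: tV; apply.
set v := x + s *: (y + t *: n - x) in sV.
have c0 : cross (v - x) (y - x) + t * cross (v - x) n = 0.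
  have -> : v - x = s *: (y + t *: n - x) by rewrite /v addrC addKr.
  by rewrite /cross /n /= /GRing.scale /=; ring.
(* [cross (v - x) n] is the scalar product of [v - x] and [y - x]; if it vanishes, then [v - x] is
   both orthogonal and parallel to [y - x], hence zero. *)
have [cn|cn] := eqVneq (cross (v - x) n) 0; last first.
  apply/mapP; exists v => //; apply: (mulIf cn); rewrite divfK //.
  by apply/eqP; rewrite -addr_eq0 addrC c0.
exfalso; move: c0; rewrite cn mulr0 addr0 => c0.
have vx : (v - x).1 = 0 /\ (v - x).2 = 0.
  move: cn c0; rewrite /cross /n; move: (v - x) (y - x) (@subr_eq0 _ y x) => p q qE /= h1 h2.
  have q0 : q.1 ^+ 2 + q.2 ^+ 2 != 0.
    rewrite paddr_eq0 ?sqr_ge0 // !sqrf_eq0; apply: contraNN xy => /andP[/eqP a /eqP b].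
    by rewrite -qE (surjective_pairing q) a b.
  have E1 : p.1 * (q.1 ^+ 2 + q.2 ^+ 2) = q.1 * (p.1 * q.1 - p.2 * - q.2) + q.2 * (p.1 * q.2 - p.2 * q.1) by ring.
  have E2 : p.2 * (q.1 ^+ 2 + q.2 ^+ 2) = q.2 * (p.1 * q.1 - p.2 * - q.2) - q.1 * (p.1 * q.2 - p.2 * q.1) by ring.
  by split; apply: (mulIf q0); rewrite mul0r ?E1 ?E2 h1 h2 !mulr0 ?subr0 ?addr0.
move/negP: xV; apply; rewrite (_ : x = v) //; apply/eqP; rewrite eq_sym -subr_eq0.
by rewrite (surjective_pairing (v - x)) vx.1 vx.2.
Qed.

(** A segment that avoids [V] is handled by [cover_lipschitz] along its parametrisation. A general
    one is tilted slightly to avoid [V], and the small gap at its end is itself a segment that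
    avoids [V]. *)
Lemma glue_lipschitz (u : R * R -> R) (V : seq (R * R)) (n : nat) (F : nat -> set (R * R)) (L : R) :
  0 <= L -> (forall k, closed (F k)) -> (forall p, exists2 k, (k < n)%N & F k p) ->
  (forall k p q, (k < n)%N -> F k p -> F k q -> p \notin V -> q \notin V ->
     `|u p - u q| <= L * `|p - q|) ->
  forall p q, p \notin V -> q \notin V -> `|u p - u q| <= L * `|p - q|.
Proof.
move=> L0 cF cov lip.
have seg x y : (forall t, 0 <= t <= 1 -> x + t *: (y - x) \notin V) -> `|u x - u y| <= L * `|x - y|.
  move=> h; pose g (t : R) := x + t *: (y - x).
  have g0 : g 0 = x by rewrite /g scale0r addr0.
  have g1 : g 1 = y by rewrite /g scale1r addrC subrK.
  suff : `|(u \o g) 1 - (u \o g) 0| <= L * `|x - y| * (1 - 0).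
    by rewrite /= g0 g1 subr0 mulr1 distrC.
  apply: (@cover_lipschitz _ _ n (fun k => g @^-1` F k)) => //.
  - by rewrite mulr_ge0.
  - move=> k; apply: preimage_closed => // t _; apply: cvgD; first exact: cvg_cst.
    by apply: cvgZr_tmp; exact: cvg_id.
  - by move=> t _; exact: cov.
  - move=> k s t kn s01 t01 Fs Ft; apply: le_trans (lip k _ _ kn Fs Ft (h _ s01) (h _ t01)) _.
    rewrite -mulrA ler_wpM2l // /g opprD addrACA subrr add0r -scalerBl normrZ mulrC.
    by rewrite [`|x - y|]distrC.
move=> x y xV yV; apply/ler_addgt0Pr => e e0.
have [d d0 hd] := seq_separated yV.
(* The bound [d] keeps the segment from [y] to [y'] away from [V]; the other bound keeps the total
   cost [2 * L * |y - y'|] of the detour below [e]. *)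
pose e' := Num.min d (e / (2 * L + 1)).
have L1 : 0 < 2 * L + 1 by rewrite ltr_wpDl // mulr_ge0.
have e'0 : 0 < e' by rewrite lt_min d0 divr_gt0.
have [y' hy' seg1] := perturb_segment y xV e'0.
have h1 := seg x y' (fun t _ => seg1 t).
have h2 : `|u y - u y'| <= L * `|y - y'|.
  apply: seg => t /andP[t0 t1]; apply/negP => /hd; rewrite leNgt => /negP; apply.
  rewrite addrAC subrr add0r normrZ ger0_norm //; apply: (@le_lt_trans _ _ `|y - y'|).
    by rewrite distrC ler_piMl.
  by apply: lt_le_trans hy' _; rewrite ge_min lexx.
have h3 : 2 * L * `|y - y'| <= e.
  have h4 : `|y - y'| <= e / (2 * L + 1) by apply: le_trans (ltW hy') _; rewrite ge_min lexx orbT.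
  rewrite ler_pdivlMr // in h4; have := normr_ge0 (y - y'); nra.
apply: le_trans (ler_distD (u y') _ _) _; rewrite [`|u y' - _|]distrC.
apply: le_trans (lerD h1 h2) _.
have h5 : L * `|x - y'| <= L * (`|x - y| + `|y - y'|) by rewrite ler_wpM2l // ler_distD.
by apply: le_trans (lerD h5 (lexx _)) _; rewrite mulrDr -addrA lerD2l -mulrDl; lra.
Qed.

(** McShane's formula, in its supremum form; it supplies the missing values on [V]. *)
Lemma lipschitz_extension (u : R * R -> R) (V : seq (R * R)) (L : R) : 0 <= L ->
  (forall p q, p \notin V -> q \notin V -> `|u p - u q| <= L * `|p - q|) ->
  exists2 w : R * R -> R, (forall p, p \notin V -> w p = u p) &
    forall p q, `|w p - w q| <= L * `|p - q|.
Proof.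
move=> L0 uL; pose A (p : R * R) := [set u q - L * `|p - q| | q in [set q | q \notin V]].
have [q0 q0V] : exists q, q \notin V.
  have [t _ tV] := @small_avoiding [seq v.1 | v <- V] 1 ltr01.
  by exists (t, 0); apply/negP => h; move/negP: tV; apply; apply/mapP; exists (t, 0).
have A0 p : A p !=set0 by exists (u q0 - L * `|p - q0|); exists q0.
have Aub p q : q \notin V -> ubound (A p) (u q + L * `|p - q|).
  move=> qV _ [z zV <-]; have := uL z q zV qV; rewrite ler_norml => /andP[_ h].
  rewrite lerBlDr -addrA -lerBlDl; apply: le_trans h _.
  by rewrite -mulrDr ler_wpM2l // [leRHS]addrC [`|p - z|]distrC; exact: ler_distD.
have hub p : has_ubound (A p) by exists (u q0 + L * `|p - q0|); exact: Aub.
exists (fun p => sup (A p)).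
  move=> p pV; apply/eqP; rewrite eq_le; apply/andP; split.
    by apply: ge_sup => //; have := Aub p p pV; rewrite subrr normr0 mulr0 addr0.
  by apply: ub_le_sup => //; exists p => //; rewrite subrr normr0 mulr0 subr0.
have half p q : sup (A p) <= sup (A q) + L * `|p - q|.
  apply: ge_sup => // _ [z zV <-]; rewrite -lerBlDr; apply: (@le_trans _ _ (u z - L * `|q - z|)); last first.
    by apply: ub_le_sup => //; exists z.
  rewrite -addrA lerD2l -opprD lerN2 -mulrDr ler_wpM2l //.
  by rewrite [leRHS]addrC [`|p - q|]distrC; exact: ler_distD.
move=> p q; rewrite ler_norml lerNl opprB !lerBlDl; apply/andP; split.
  by have := half q p; rewrite distrC.
exact: half.
Qed.

End Gluing.

(** * Geometry of a quadrilateral *)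

Section QuadGeometry.
Context {R : realType}.
Implicit Types (K L : quad R) (x y z : R * R).

Lemma ord4P (P : 'I_4 -> Prop) : P 0 -> P 1 -> P 2 -> P 3 -> forall i, P i.
Proof.
move=> P0 P1 P2 P3 [[|[|[|[|//]]]] h].
- by have -> : Ordinal h = 0 by exact/val_inj.
- by have -> : Ordinal h = 1 by exact/val_inj.
- by have -> : Ordinal h = 2 by exact/val_inj.
- by have -> : Ordinal h = 3 by exact/val_inj.
Qed.

Lemma ord4E : (0 + 1 = 1 :> 'I_4) * (1 + 1 = 2 :> 'I_4) * (2 + 1 = 3 :> 'I_4) * (3 + 1 = 0 :> 'I_4) *
  (0 + 2 = 2 :> 'I_4) * (1 + 2 = 3 :> 'I_4) * (2 + 2 = 0 :> 'I_4) * (3 + 2 = 1 :> 'I_4).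
Proof. by do !split; exact/val_inj. Qed.

Lemma sum4E (V : zmodType) (F : 'I_4 -> V) : \sum_i F i = F 0 + F 1 + F 2 + F 3.
Proof.
rewrite !big_ord_recr big_ord0 /= add0r.
by congr (F _ + F _ + F _ + F _); exact/val_inj.
Qed.

Definition half_plane K (i : 'I_4) x : R := cross (vtx K (i + 1) - vtx K i) (x - vtx K i).

Lemma ccw4 K :
  [/\ 0 < half_plane K 0 (vtx K 2), 0 < half_plane K 1 (vtx K 3),
      0 < half_plane K 2 (vtx K 0) & 0 < half_plane K 3 (vtx K 1)].
Proof.
have := vtx_ccw K 0; have := vtx_ccw K 1; have := vtx_ccw K 2; have := vtx_ccw K 3.
rewrite /half_plane /cross !ord4E /= => h3 h2 h1 h0.
by split; lra.
Qed.

Lemma ccw4' K :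
  [/\ 0 < half_plane K 0 (vtx K 3), 0 < half_plane K 1 (vtx K 0),
      0 < half_plane K 2 (vtx K 1) & 0 < half_plane K 3 (vtx K 2)].
Proof.
have := vtx_ccw K 0; have := vtx_ccw K 1; have := vtx_ccw K 2; have := vtx_ccw K 3.
rewrite /half_plane /cross !ord4E /= => h3 h2 h1 h0.
by split; lra.
Qed.

Lemma half_plane_start K i : half_plane K i (vtx K i) = 0.
Proof. by rewrite /half_plane /cross subrr /= !mulr0 subrr. Qed.

Lemma half_plane_end K i : half_plane K i (vtx K (i + 1)) = 0.
Proof. by rewrite /half_plane /cross mulrC subrr. Qed.

Lemma half_plane_gt0 K i j : j != i -> j != i + 1 -> 0 < half_plane K i (vtx K j).
Proof.
have [a0 a1 a2 a3] := ccw4 K; have [b0 b1 b2 b3] := ccw4' K.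
by elim/ord4P: i; elim/ord4P: j.
Qed.

Lemma half_plane_ge0 K i j : 0 <= half_plane K i (vtx K j).
Proof.
have [->|ji] := eqVneq j i; first by rewrite half_plane_start.
have [->|ji'] := eqVneq j (i + 1); first by rewrite half_plane_end.
exact: ltW (half_plane_gt0 _ ji ji').
Qed.

Lemma half_plane_comb K i (l : 'I_4 -> R) : \sum_j l j = 1 ->
  half_plane K i (\sum_j l j *: vtx K j) = \sum_j l j * half_plane K i (vtx K j).
Proof.
rewrite !sum4E => l1; rewrite /half_plane /cross.
have -> : l 0 = 1 - l 1 - l 2 - l 3 by rewrite -l1; ring.
by rewrite /= /GRing.scale /=; ring.
Qed.

Lemma cell_half_plane K x : cell_set K x -> forall i, 0 <= half_plane K i x.
Proof.
move=> [l [l0 l1 ->]] i; rewrite half_plane_comb //.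
by apply: sumr_ge0 => j _; rewrite mulr_ge0 // half_plane_ge0.
Qed.

(** The diagonal from vertex 0 to vertex 2 cuts the cell into two triangles. The sign of [S] tells
    on which side [x] lies, and quotients of areas are its barycentric coordinates in that
    triangle. *)
Lemma half_plane_cell K x : (forall i, 0 <= half_plane K i x) -> cell_set K x.
Proof.
move=> h; have [a0 a1 a2 a3] := ccw4 K.
have [T0 T0E] : exists T, T = half_plane K 0 (vtx K 2) by exists (half_plane K 0 (vtx K 2)).
have [T2 T2E] : exists T, T = half_plane K 2 (vtx K 0) by exists (half_plane K 2 (vtx K 0)).
rewrite -T0E in a0; rewrite -T2E in a2.
have [S SE] : exists S, S = cross (vtx K 2 - vtx K 0) (x - vtx K 0) by eexists.
have [S0|S0] := leP S 0.
  exists (fun i => if i == 0 then half_plane K 1 x / T0 else if i == 1 then - S / T0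
     else if i == 2 then half_plane K 0 x / T0 else 0); split.
  - by elim/ord4P => //=; rewrite divr_ge0 ?oppr_ge0 // ltW.
  - rewrite sum4E /= addr0 -!mulrDl; apply: (mulIf (lt0r_neq0 a0)); rewrite divfK ?lt0r_neq0 // mul1r.
    by rewrite T0E SE /half_plane /cross !ord4E /=; ring.
  - rewrite sum4E /= scale0r addr0.
    have E : T0 *: x = half_plane K 1 x *: vtx K 0 - S *: vtx K 1 + half_plane K 0 x *: vtx K 2.
      rewrite T0E SE /half_plane /cross !ord4E; case: x (vtx K 0) (vtx K 1) (vtx K 2) {h a0 a1 a2 a3 T0E T2E SE} => x1 x2 [p1 p2] [q1 q2] [r1 r2].
      by congr pair; rewrite /= /GRing.scale /=; ring.
    apply: (scalerI (lt0r_neq0 a0)); rewrite E !scalerDr !scalerA ![T0 * (_ / T0)]mulrC !divfK ?lt0r_neq0 //.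
    by rewrite scaleNr.
exists (fun i => if i == 0 then half_plane K 2 x / T2 else if i == 1 then 0
   else if i == 2 then half_plane K 3 x / T2 else S / T2); split.
- by elim/ord4P => //=; rewrite divr_ge0 // ltW.
- rewrite sum4E /= addr0 -!mulrDl; apply: (mulIf (lt0r_neq0 a2)); rewrite divfK ?lt0r_neq0 // mul1r.
  by rewrite T2E SE /half_plane /cross !ord4E /=; ring.
- rewrite sum4E /= scale0r addr0.
  have E : T2 *: x = half_plane K 2 x *: vtx K 0 + half_plane K 3 x *: vtx K 2 + S *: vtx K 3.
    rewrite T2E SE /half_plane /cross !ord4E; case: x (vtx K 0) (vtx K 2) (vtx K 3) {h a0 a1 a2 a3 T0E T2E SE S0} => x1 x2 [p1 p2] [q1 q2] [r1 r2].
    by congr pair; rewrite /= /GRing.scale /=; ring.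
  by apply: (scalerI (lt0r_neq0 a2)); rewrite E !scalerDr !scalerA ![T2 * (_ / T2)]mulrC !divfK ?lt0r_neq0.
Qed.

Lemma half_plane_continuous K i : continuous (half_plane K i).
Proof.
move=> x; rewrite /half_plane /cross.
apply: cvgB; apply: cvgM; try exact: cvg_cst.
- exact: (cvgB (cvg_snd (F:=nbhs x.1) (G:=nbhs x.2)) (cvg_cst _)).
- exact: (cvgB (cvg_fst (F:=nbhs x.1) (G:=nbhs x.2)) (cvg_cst _)).
Qed.

Lemma cell_closed K : closed (cell_set K).
Proof.
have -> : cell_set K = \bigcap_(i in [set: 'I_4]) (half_plane K i @^-1` [set t | 0 <= t]).
  apply/seteqP; split => [x Kx i _|x h]; first exact: cell_half_plane.
  by apply: half_plane_cell => i; exact: h.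
apply: closed_bigI => i _; apply: preimage_closed; last exact: closed_ge.
by move=> x _; exact: half_plane_continuous.
Qed.

Lemma half_plane_near K i x : 0 < half_plane K i x -> \forall y \near x, 0 < half_plane K i y.
Proof.
move=> h; apply: (open_nbhs_nbhs (A := half_plane K i @^-1` [set t | 0 < t])); split => //.
by apply: open_comp; [move=> y _; exact: half_plane_continuous|exact: open_gt].
Qed.

Lemma half_plane_interior K x : (forall i, 0 < half_plane K i x) -> interior (cell_set K) x.
Proof.
move=> h; have : \forall y \near x, [/\ 0 < half_plane K 0 y, 0 < half_plane K 1 y, 0 < half_plane K 2 y & 0 < half_plane K 3 y].
  near=> y; split; near: y; exact: half_plane_near.
apply: filterS => y [h0 h1 h2 h3]; apply: half_plane_cell.
by elim/ord4P; exact: ltW.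
Unshelve. all: by end_near.
Qed.

Lemma vtx_neq K i : vtx K (i + 1) - vtx K i != 0.
Proof.
apply/negP => /eqP h; have := vtx_ccw K i; by rewrite h /cross /= !mul0r subrr ltxx.
Qed.

Lemma half_plane_perturb K i x (e : R) : 0 < e ->
  exists y z, [/\ `|x - y| < e, `|x - z| < e, half_plane K i y < half_plane K i x & half_plane K i x < half_plane K i z].
Proof.
move=> e0; pose v := vtx K (i + 1) - vtx K i; pose n : R * R := (- v.2, v.1).
have v0 : 0 < v.1 ^+ 2 + v.2 ^+ 2.
  rewrite lt_neqAle eq_sym paddr_eq0 ?sqr_ge0 // !sqrf_eq0 addr_ge0 ?sqr_ge0 // andbT.
  by apply: contraNN (vtx_neq K i) => /andP[/eqP a /eqP b]; rewrite -/v (surjective_pairing v) a b.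
have n0 : 0 < `|n| + 1 by rewrite ltr_wpDl.
pose t := e / (`|n| + 1); have t0 : 0 < t by rewrite divr_gt0.
have tn : `|t *: n| < e.
  by rewrite normrZ gtr0_norm // /t mulrAC ltr_pdivrMr // ltr_pM2l // ltrDl.
have E (s : R) : half_plane K i (x + s *: n) = half_plane K i x + s * (v.1 ^+ 2 + v.2 ^+ 2).
  by rewrite /half_plane -/v /cross /n /= /GRing.scale /=; ring.
exists (x + (- t) *: n), (x + t *: n); rewrite !E; split.
- by rewrite opprD addNKr normrN scaleNr normrN.
- by rewrite opprD addNKr normrN.
- by rewrite gtrDl mulNr oppr_lt0 mulr_gt0.
- by rewrite ltrDl mulr_gt0.
Qed.

Lemma interior_half_plane K x : interior (cell_set K) x -> forall i, 0 < half_plane K i x.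
Proof.
move=> /nbhs_dist_ball[e e0 he] i; have [y [_ [hy _ h _]]] := half_plane_perturb K i x e0.
by apply: le_lt_trans h; apply: cell_half_plane; exact: he.
Qed.


Lemma edgeP K i x : edge K i x <-> exists t, [/\ 0 <= t, t <= 1 & x = (1 - t) *: vtx K i + t *: vtx K (i + 1)].
Proof.
split=> [[t]|[t [t0 t1 ->]]]; last by exists t => //; rewrite /= in_itv /= t0.
by rewrite /= in_itv /= => /andP[t0 t1] <-; exists t.
Qed.

Lemma half_plane_affine K i (t : R) x y :
  half_plane K i ((1 - t) *: x + t *: y) = (1 - t) * half_plane K i x + t * half_plane K i y.
Proof. by rewrite /half_plane /cross /= /GRing.scale /=; ring. Qed.

Lemma edge_half_plane K i x : edge K i x -> half_plane K i x = 0.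
Proof. by move=> /edgeP[t [_ _ ->]]; rewrite half_plane_affine half_plane_start half_plane_end !mulr0 addr0. Qed.

Lemma edge_cell K i : edge K i `<=` cell_set K.
Proof.
move=> x /edgeP[t [t0 t1 ->]]; apply: half_plane_cell => j; rewrite half_plane_affine.
by rewrite addr_ge0 // mulr_ge0 ?half_plane_ge0 // subr_ge0.
Qed.

Lemma cell_edge K i x : cell_set K x -> half_plane K i x = 0 -> edge K i x.
Proof.
move=> [l [l0 l1 xE]]; rewrite xE half_plane_comb // => h.
have l_0 j : j != i -> j != i + 1 -> l j = 0.
  move=> ji ji'; have hj := half_plane_gt0 K ji ji'.
  have : l j * half_plane K i (vtx K j) <= 0.
    rewrite -h (bigD1 j) //= lerDl; apply: sumr_ge0 => k _; by rewrite mulr_ge0 // half_plane_ge0.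
  by rewrite pmulr_lle0 // => lj; apply/le_anti; rewrite lj l0.
apply/edgeP; exists (l (i + 1)); rewrite l0; split => //.
  by rewrite -l1 (bigD1 (i + 1)) //= lerDl; exact: sumr_ge0.
have ni : i != i + 1 by move: i {h l_0}; apply: ord4P.
rewrite (bigD1 i) //= (bigD1 (i + 1)) 1?eq_sym //= big1 ?addr0; last first.
  by move=> j /andP[j1 j2]; rewrite l_0 // scale0r.
congr (_ *: _ + _); rewrite -l1 (bigD1 i) //= (bigD1 (i + 1)) 1?eq_sym //= big1 ?addr0 ?addrK //.
by move=> j /andP[j1 j2]; rewrite l_0.
Qed.

Lemma edge_half_plane_gt0 K i j x : edge K i x -> (forall k, x != vtx K k) -> j != i ->
  0 < half_plane K j x.
Proof.
move=> /edgeP[t [t0 t1 xE]] nv ji.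
have t0' : 0 < t.
  rewrite lt_neqAle t0 andbT; apply/eqP => tE; move/eqP: (nv i); apply.
  by rewrite xE -tE subr0 scale1r scale0r addr0.
have t1' : 0 < 1 - t.
  rewrite subr_gt0 lt_neqAle t1 andbT; apply/eqP => tE; move/eqP: (nv (i + 1)); apply.
  by rewrite xE tE subrr scale0r scale1r add0r.
rewrite xE half_plane_affine; have [ij|ij] := eqVneq i (j + 1).
  rewrite ij half_plane_end mulr0 add0r mulr_gt0 // half_plane_gt0 //.
    by move: j ji ij => j _ _; elim/ord4P: j.
  by elim/ord4P: j {ji ij}.
rewrite ltr_pwDl ?mulr_gt0 ?mulr_ge0 ?half_plane_ge0 // half_plane_gt0 //.
by rewrite eq_sym.
Qed.

Lemma cell_notin_interior K x : cell_set K x -> ~ interior (cell_set K) x -> exists i, edge K i x.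
Proof.
move=> Kx nx; apply: contrapT => h; apply: nx; apply: half_plane_interior => i.
rewrite lt_neqAle cell_half_plane // andbT eq_sym; apply/eqP => h0; apply: h; exists i.
exact: cell_edge.
Qed.

(** Grids compare edges as sets of points, while the gluing needs their end points. *)
Lemma segment_endpoints (A B C D : R * R) : A != B -> C != D -> segment A B = segment C D ->
  (A = C /\ B = D) \/ (A = D /\ B = C).
Proof.
move=> AB CD E.
have mem (P Q : R * R) : segment P Q P /\ segment P Q Q.
  split; [exists 0|exists 1]; rewrite /= ?in_itv /= ?lexx ?ler01 //.
    by rewrite subr0 scale1r scale0r addr0.
  by rewrite subrr scale1r scale0r add0r.
have [sA sB] := mem A B; have [sC sD] := mem C D.
rewrite E in sA sB; rewrite -E in sC sD.
case: sA => a; rewrite /= in_itv /= => /andP[a0 a1] aE.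
case: sB => b; rewrite /= in_itv /= => /andP[b0 b1] bE.
case: sC => c; rewrite /= in_itv /= => /andP[c0 c1] cE.
case: sD => d; rewrite /= in_itv /= => /andP[d0 d1] dE.
have key (s t : R) : (1 - s) *: C + s *: D = (1 - t) *: C + t *: D -> s = t.
  move=> h; have : (s - t) *: (D - C) = 0.
    have -> : (s - t) *: (D - C) = ((1 - s) *: C + s *: D) - ((1 - t) *: C + t *: D).
      by case: C D {CD E aE bE cE dE h} => C1 C2 [D1 D2]; congr pair; rewrite /= /GRing.scale /=; ring.
    by rewrite h subrr.
  by move/eqP; rewrite scaler_eq0 !subr_eq0 [D == C]eq_sym (negbTE CD) orbF => /eqP.
(* In the coordinate along [C D], the segment [A B] is an affine map of [[0, 1]] into itself. It
   takes the values 0 and 1, which an affine map can only do at the ends. *)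
have comb (t : R) : (1 - t) *: A + t *: B = (1 - (a + t * (b - a))) *: C + (a + t * (b - a)) *: D.
  by rewrite -aE -bE; case: C D {CD E aE bE cE dE key} => C1 C2 [D1 D2]; congr pair; rewrite /= /GRing.scale /=; ring.
have hc : a + c * (b - a) = 0 by apply: key; rewrite -comb cE subr0 scale1r scale0r addr0.
have hd : a + d * (b - a) = 1 by apply: key; rewrite -comb dE subrr scale1r scale0r add0r.
have [ab|ba] := leP a b.
- have a_0 : a = 0 by nra.
  have b_1 : b = 1 by nra.
  left; rewrite -aE -bE a_0 b_1; split; first by rewrite subr0 scale1r scale0r addr0.
  by rewrite subrr scale1r scale0r add0r.
- have a_1 : a = 1 by nra.
  have b_0 : b = 0 by nra.
  right; rewrite -aE -bE a_1 b_0; split; last by rewrite subr0 scale1r scale0r addr0.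
  by rewrite subrr scale1r scale0r add0r.
Qed.

Lemma edge_endpoints K L i j : edge K i = edge L j ->
  (vtx K i = vtx L j /\ vtx K (i + 1) = vtx L (j + 1)) \/
  (vtx K i = vtx L (j + 1) /\ vtx K (i + 1) = vtx L j).
Proof.
by apply: segment_endpoints; rewrite eq_sym -subr_eq0; exact: vtx_neq.
Qed.

End QuadGeometry.

(** * Topology of a grid *)

Section RegularOpen.
Context {R : realType}.

Lemma rotate_frame (q p n : R * R) (t : R) : n.1 ^+ 2 + n.2 ^+ 2 = 1 ->
  q + (p - t *: n) = p + (q.1 * n.2 - q.2 * n.1) *: (n.2, - n.1) + (q.1 * n.1 + q.2 * n.2 - t) *: n.
Proof.
case: q p n => q1 q2 [p1 p2] [m1 m2] /= nn; congr pair; rewrite /= /GRing.scale /=.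
- have -> : q1 + (p1 - t * m1) = q1 * (m1 ^+ 2 + m2 ^+ 2) + (p1 - t * m1) by rewrite nn mulr1.
  by ring.
- have -> : q2 + (p2 - t * m2) = q2 * (m1 ^+ 2 + m2 ^+ 2) + (p2 - t * m2) by rewrite nn mulr1.
  by ring.
Qed.

Lemma segment_subl (A B : R * R) (t : R) : (1 - t) *: A + t *: B - A = t *: (B - A).
Proof. by case: A B => a1 a2 [b1 b2]; congr pair; rewrite /= /GRing.scale /=; ring. Qed.

Lemma segment_subr (A B : R * R) (t : R) : B - ((1 - t) *: A + t *: B) = (1 - t) *: (B - A).
Proof. by case: A B => a1 a2 [b1 b2]; congr pair; rewrite /= /GRing.scale /=; ring. Qed.

Lemma segment_sub (A B : R * R) (s t : R) :
  (1 - s) *: A + s *: B - ((1 - t) *: A + t *: B) = (s - t) *: (B - A).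
Proof. by case: A B => a1 a2 [b1 b2]; congr pair; rewrite /= /GRing.scale /=; ring. Qed.

(** This excludes slits. Were a boundary point interior to the closure, [Omega] would accumulate
    straight below it, along [- n]; but the graph has nonnegative height over that point, and its
    slope bound forbids so deep a descent nearby. *)
Lemma lipschitz_boundary_regular (Omega : set (R * R)) : open Omega -> lipschitz_boundary Omega ->
  interior (closure Omega) `<=` Omega.
Proof.
move=> oO lO x0 /nbhs_dist_ball[e e0 he]; apply: contrapT => nx.
have bx : (closure Omega `\` interior Omega) x0.
  split; first by apply: he; rewrite subrr normr0.
  by move/interior_subset.
have [n [gamma [L [a [b [n1 gL a0 b0 hD]]]]]] := lO _ bx.
have nn : n.1 ^+ 2 + n.2 ^+ 2 = 1.
  by move: n1; rewrite /enorm => /(congr1 (fun t => t ^+ 2)); rewrite sqr_sqrtr ?addr_ge0 ?sqr_ge0 // expr1n.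
have nb : `|n.1| <= 1 /\ `|n.2| <= 1.
  have := sqr_ge0 n.1; have := sqr_ge0 n.2.
  by split; rewrite -[leRHS]sqrtr1 -sqrtr_sqr ler_wsqrtr //; lra.
have g0 : 0 <= gamma 0.
  rewrite leNgt; apply/negP => h; apply: nx.
  have := hD 0 0; rewrite !normr0 !scale0r !addr0 => -[] // _; apply.
  by [].
(* A point of [Omega] within [d] of [x0 - tau *: n] has |s| < 2 d and t < 2 d - tau, so gamma s < t
   forces tau < 2 d (1 + |L|); [d = tau / M] rules this out. *)
pose M := 4 * (2 + `|L|).
have M0 : 8 <= M by rewrite /M; have := normr_ge0 L; lra.
pose tau := Num.min (e / 2) (Num.min a b / 2).
have tau0 : 0 < tau by rewrite !lt_min !divr_gt0 // lt_min a0.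
have taue : tau <= e / 2 by rewrite ge_min lexx.
have tauab : tau <= Num.min a b / 2 by rewrite ge_min lexx orbT.
have taua : tau <= a / 2 by apply: le_trans tauab _; rewrite ler_pM2r // ge_min lexx.
have taub : tau <= b / 2 by apply: le_trans tauab _; rewrite ler_pM2r // ge_min lexx orbT.
pose d := tau / M; have d0 : 0 < d by rewrite divr_gt0 //; lra.
have dM : d * M = tau by rewrite /d divfK // gt_eqF //; lra.
pose y := x0 - tau *: n.
have cy : closure Omega y.
  apply: he; rewrite /y opprB addrC subrK normrZ gtr0_norm //.
  have : `|n| <= 1 by rewrite prod_normE /= ge_max nb.1 nb.2.
  have := normr_ge0 n; nra.
have [z [Oz zy]] : exists z, Omega z /\ `|y - z| < d.
  have [z [Oz zy]] := cy _ (nbhsx_ballx y d d0); exists z; split => //.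
  by move: zy; rewrite -ball_normE.
pose q := z - y; pose s := q.1 * n.2 - q.2 * n.1; pose t := q.1 * n.1 + q.2 * n.2 - tau.
have [q1 q2] : `|q.1| < d /\ `|q.2| < d.
  by move: zy; rewrite distrC -/q prod_normE /= gt_max => /andP[].
have zE : z = x0 + s *: (n.2, - n.1) + t *: n.
  by rewrite -(rotate_frame q x0 tau nn) -/y /q subrK.
have prodb (u v : R) : `|u| < d -> `|v| <= 1 -> `|u * v| < d.
  by move=> hu hv; rewrite normrM; have := normr_ge0 u; have := normr_ge0 v; nra.
have sb : `|s| < 2 * d.
  have h1 := prodb _ _ q1 nb.2; have h2 := prodb _ _ q2 nb.1.
  by apply: le_lt_trans (ler_normB _ _) _; lra.
have tb : `|t + tau| < 2 * d.
  rewrite /t subrK; have h1 := prodb _ _ q1 nb.1; have h2 := prodb _ _ q2 nb.2.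
  by apply: le_lt_trans (ler_normD _ _) _; lra.
have /(hD s t) : `|s| < a by nra.
have tb' : `|t| < b.
  by move: tb; rewrite !ltr_norml => /andP[h1 h2]; apply/andP; split; nra.
move=> /(_ tb') [h _]; have := h; rewrite -zE => /(_ Oz) gst.
have := gL (s, 0) (conj I I); rewrite /= subr0 => gs.
have Ls : L * `|s| <= `|L| * (2 * d).
  apply: le_trans (ler_wpM2r (normr_ge0 s) (ler_norm L)) _.
  by rewrite ler_wpM2l // ltW.
have : - (`|L| * (2 * d)) <= gamma s.
  have := ler_norm (- (gamma s - gamma 0)); rewrite normrN => h2.
  by lra.
move: tb; rewrite ltr_norml => /andP[_ h3] h4.
have : tau <= 2 * d + `|L| * (2 * d) by lra.
by rewrite -dM /M; have := normr_ge0 L; nra.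
Qed.

End RegularOpen.

(** * Shared edges and boundary edges *)

Section GridTopology.
Context {R : realType}.
Variables (Omega : set (R * R)) (J : grid R).
Hypotheses (Omega_open : open Omega) (Omega_reg : interior (closure Omega) `<=` Omega).
Hypothesis J_grid : is_grid_of Omega J.
Local Notation K := (cell J).
Local Notation T2 := (measurableTypeR R * measurableTypeR R)%type.

Lemma cell_closure k : cell_set (K k) `<=` closure Omega.
Proof. by move=> x Kx; rewrite J_grid.1; exists k. Qed.

Lemma cover_cell x : Omega x -> exists k, cell_set (K k) x.
Proof.
move=> Ox; have : closure Omega x by exact: subset_closure.
by rewrite J_grid.1 => -[k _ h]; exists k.
Qed.

Lemma interior_cell k : interior (cell_set (K k)) `<=` Omega.
Proof. by apply: subset_trans Omega_reg; apply: interiorS; exact: cell_closure. Qed.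

Lemma interior_cell_disjoint k l x : interior (cell_set (K k)) x -> cell_set (K l) x -> k = l.
Proof.
move=> kx lx; apply/eqP/negPn/negP => kl.
have Kx := interior_subset kx; have hx := interior_half_plane kx.
have KLx : (cell_set (K k) `&` cell_set (K l)) x by [].
have [|[i [j [e E]]]|[i [j [e E]]]] := J_grid.2 _ _ kl; first by exists x.
- by move: KLx; rewrite E /= => xE; have := hx i; rewrite xE half_plane_start ltxx.
- by move: KLx; rewrite E => /edge_half_plane xE; have := hx i; rewrite xE ltxx.
Qed.

Definition vertices : seq (R * R) := [seq vtx (K k) i | k <- enum 'I_(ncells J), i <- enum 'I_4].

Lemma vtx_vertices k i : vtx (K k) i \in vertices.
Proof. by apply/allpairsP; exists (k, i); rewrite !mem_enum. Qed.

Lemma shared_edge k l x : k != l -> cell_set (K k) x -> cell_set (K l) x ->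
  x \notin vertices -> exists i j, [/\ edge (K k) i = edge (K l) j, edge (K k) i x &
    cell_set (K k) `&` cell_set (K l) = edge (K k) i].
Proof.
move=> kl kx lx xV; have KLx : (cell_set (K k) `&` cell_set (K l)) x by [].
have [|[i [j [e E]]]|[i [j [e E]]]] := J_grid.2 _ _ kl; first by exists x.
- by exfalso; move: KLx; rewrite E /= => xE; move/negP: xV; apply; rewrite xE vtx_vertices.
- by exists i, j; split => //; rewrite -E.
Qed.

(** The two cells lie on opposite sides of the common edge, so together they fill a neighbourhood of
    [x] within the closure of [Omega]. *)
Lemma shared_Omega k l x : k != l -> cell_set (K k) x -> cell_set (K l) x ->
  x \notin vertices -> Omega x.
Proof.
move=> kl kx lx xV; have [i [j [e ex E]]] := shared_edge kl kx lx xV.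
have ex' : edge (K l) j x by rewrite -e.
have nv k' i' : x != vtx (K k') i'.
  by apply/negP => /eqP xE; move/negP: xV; apply; rewrite xE vtx_vertices.
have pk i' : i' != i -> \forall y \near x, 0 < half_plane (K k) i' y.
  by move=> ii; apply: half_plane_near; apply: edge_half_plane_gt0 ex _ ii => j'; exact: nv.
have pl j' : j' != j -> \forall y \near x, 0 < half_plane (K l) j' y.
  by move=> jj; apply: half_plane_near; apply: edge_half_plane_gt0 ex' _ jj => j''; exact: nv.
have allk : \forall y \near x, forall i', i' != i -> 0 < half_plane (K k) i' y.
  apply: (@filter_forall _ _ (fun i' y => i' != i -> 0 < half_plane (K k) i' y) (nbhs x)) => i'; have [->|ii] := eqVneq i' i; first exact: nearW.
  by have := pk i' ii; apply: filterS.
have alll : \forall y \near x, forall j', j' != j -> 0 < half_plane (K l) j' y.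
  apply: (@filter_forall _ _ (fun j' y => j' != j -> 0 < half_plane (K l) j' y) (nbhs x)) => j'; have [->|jj] := eqVneq j' j; first exact: nearW.
  by have := pl j' jj; apply: filterS.
have opp y : half_plane (K l) j y = - half_plane (K k) i y.
  have [[E1 E2]|[E1 E2]] := edge_endpoints e; last first.
    by rewrite /half_plane /cross E1 E2 /=; ring.
  (* If both cells ran along the edge in the same direction, they would lie on the same side of it
     and share a point off the edge. *)
  exfalso.
  have same z : half_plane (K l) j z = half_plane (K k) i z by rewrite /half_plane E1 E2.
  have : \forall z \near x, (forall i', i' != i -> 0 < half_plane (K k) i' z) /\
      (forall j', j' != j -> 0 < half_plane (K l) j' z) by near=> z; split; near: z.
  move=> /nbhs_dist_ball[d d0 hd].
  have [_ [z [_ xz _ hz]]] := half_plane_perturb (K k) i x d0.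
  rewrite (edge_half_plane ex) in hz; have [h1 h2] := hd _ xz.
  have Kz : cell_set (K k) z.
    by apply: half_plane_cell => i'; have [->|/h1/ltW//] := eqVneq i' i; exact: ltW.
  have Lz : cell_set (K l) z.
    by apply: half_plane_cell => j'; have [->|/h2/ltW//] := eqVneq j' j; rewrite same ltW.
  have : (cell_set (K k) `&` cell_set (K l)) z by [].
  by rewrite E => /edge_half_plane h; move: hz; rewrite h ltxx.
apply: Omega_reg; near=> y.
have h1 : forall i', i' != i -> 0 < half_plane (K k) i' y by near: y.
have h2 : forall j', j' != j -> 0 < half_plane (K l) j' y by near: y.
have [h|h] := leP 0 (half_plane (K k) i y).
- apply: (@cell_closure k); apply: half_plane_cell => i'.
  by have [->|/h1/ltW//] := eqVneq i' i.
- apply: (@cell_closure l); apply: half_plane_cell => j'.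
  by have [->|/h2/ltW//] := eqVneq j' j; rewrite opp oppr_ge0 ltW.
Unshelve. all: by end_near.
Qed.


(** The whole edge must avoid [Omega], not just [x]. If a point of it were in [Omega], a nearby
    point of its relative interior would also belong to a second cell; that cell would share the
    edge, hence contain [x], and [shared_Omega] would put [x] in [Omega]. *)
Lemma boundary_cell k x : cell_set (K k) x -> ~ Omega x -> x \notin vertices ->
  exists2 i, edge (K k) i x & boundary_edge Omega (K k) i.
Proof.
move=> kx nO xV.
have [|i ex] := cell_notin_interior kx; first by move=> /interior_cell.
exists i => // y ey; split; first exact/(@cell_closure k)/edge_cell/ey.
move=> /interior_subset Oy.
have only z : cell_set (K k) z -> (exists l, l != k /\ cell_set (K l) z) ->
    edge (K k) i z -> (forall j, z != vtx (K k) j) -> False.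
  move=> kz [l [lk lz]] ez nvz; have KLz : (cell_set (K k) `&` cell_set (K l)) z by [].
  have [||[i' [j [e E]]]|[i' [j [e E]]]] := J_grid.2 k l; first by rewrite eq_sym.
  - by exists z.
  - by move: KLz; rewrite E /= => zE; move/eqP: (nvz i').
  - have ii : i' = i.
      apply/eqP/negPn/negP => ii; have := edge_half_plane_gt0 ez nvz ii.
      by move: KLz; rewrite E => /edge_half_plane ->; rewrite ltxx.
    have : (cell_set (K k) `&` cell_set (K l)) x by rewrite E ii.
    by move=> [_ lx]; apply: nO; apply: (@shared_Omega k l x) => //; rewrite eq_sym.
(* Near [z] the points across the edge would be in [Omega] but in no cell: not in cell [k], by the
   sign of [half_plane], and not in another closed cell, by [only]. *)
have out z : edge (K k) i z -> (forall j, z != vtx (K k) j) -> ~ Omega z.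
  move=> ez nvz Oz; have kz := edge_cell ez.
  have oth l : l != k -> \forall w \near z, ~ cell_set (K l) w.
    move=> lk; apply: (open_nbhs_nbhs (A := ~` cell_set (K l))); split.
      exact/closed_openC/cell_closed.
    by move=> lz; apply: only kz _ ez nvz; exists l.
  have H : \forall w \near z, Omega w /\ forall l, l != k -> ~ cell_set (K l) w.
    apply: filterI; first by apply: open_nbhs_nbhs.
    apply: (@filter_forall _ _ (fun l w => l != k -> ~ cell_set (K l) w) (nbhs z)) => l.
    by have [->|lk] := eqVneq l k; [exact: nearW|apply: filterS (oth _ lk)].
  have [d d0 hd] := nbhs_dist_ball H.
  have [w [_ [zw _ hw _]]] := half_plane_perturb (K k) i z d0.
  rewrite (edge_half_plane ez) in hw; have [Ow h] := hd _ zw.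
  have [l lw] := cover_cell Ow.
  have [lk|lk] := eqVneq l k; last exact: h lk lw.
  by have := cell_half_plane lw i; rewrite lk leNgt hw.
(* endpoints of the edge are limits of relative interior points *)
have [d d0 hd] := open_norm_ball Omega_open Oy.
have /edgeP[t [t0 t1 yE]] := ey.
set A := vtx (K k) i in yE; set B := vtx (K k) (i + 1) in yE.
have BA1 : 0 < `|B - A| + 1 by rewrite ltr_wpDl.
pose s := Num.min 1 (d / (`|B - A| + 1)).
have s0 : 0 < s by rewrite lt_min ltr01 divr_gt0.
have s1 : s <= 1 by rewrite ge_min lexx.
have sd : s * (`|B - A| + 1) <= d by rewrite -ler_pdivlMr // ge_min lexx orbT.
pose t' := t + s * (2^-1 - t).
have t'0 : 0 < t' by rewrite /t'; nra.
have t'1 : t' < 1 by rewrite /t'; nra.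
pose y' := (1 - t') *: A + t' *: B.
have ey' : edge (K k) i y' by apply/edgeP; exists t'; rewrite !ltW.
apply: (out y' ey').
  move=> j; apply/negP => /eqP y'v.
  have [ji|ji] := eqVneq j i.
    have : t' *: (B - A) == 0.
      have -> : t' *: (B - A) = y' - A.
        by rewrite segment_subl.
      by rewrite y'v ji subrr.
    by rewrite scaler_eq0 (negbTE (vtx_neq _ _)) orbF gt_eqF.
  have [ji'|ji'] := eqVneq j (i + 1).
    have : (1 - t') *: (B - A) == 0.
      have -> : (1 - t') *: (B - A) = B - y'.
        by rewrite segment_subr.
      by rewrite y'v ji' subrr.
    by rewrite scaler_eq0 (negbTE (vtx_neq _ _)) orbF gt_eqF // subr_gt0.
  by have := half_plane_gt0 (K k) ji ji'; rewrite -y'v (edge_half_plane ey') ltxx.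
apply: hd; have -> : y - y' = (s * (t - 2^-1)) *: (B - A).
  by rewrite yE segment_sub; congr (_ *: _); rewrite /t'; ring.
rewrite normrZ normrM (gtr0_norm s0); apply: lt_le_trans sd; rewrite -mulrA ltr_pM2l //.
apply: (@le_lt_trans _ _ `|B - A|); last by rewrite ltrDl.
by rewrite ler_piMl // ler_norml; apply/andP; split; lra.
Qed.

Lemma null_cover (I : eqType) (s : seq I) (F : I -> set T2) :
  (forall i, measurable (F i) /\ leb2 (F i) = 0%E) ->
  exists N : set T2, [/\ measurable N, leb2 N = 0%E & forall i, i \in s -> F i `<=` N].
Proof.
move=> h; elim: s => [|i s [N [mN N0 hN]]]; first by exists set0; rewrite measure0.
have [mi i0] := h i; exists (F i `|` N); split; first exact: measurableU.
  by rewrite null_set_setU.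
by move=> j; rewrite inE => /predU1P[->|/hN hj] x Fx; [left|right; exact: hj].
Qed.

Lemma half_plane_line L i : measurable ([set x | half_plane L i x = 0] : set T2) /\
  leb2 ([set x | half_plane L i x = 0] : set T2) = 0%E.
Proof.
pose e := vtx L (i + 1) - vtx L i.
have -> : [set x | half_plane L i x = 0] =
    [set x | - e.2 * x.1 + e.1 * x.2 = e.1 * (vtx L i).2 - e.2 * (vtx L i).1].
  apply/seteqP; split => x /=; rewrite /half_plane /cross -/e /= => h; first by rewrite -[RHS]addr0 -h; ring.
  have -> : e.1 * (x.2 - (vtx L i).2) - e.2 * (x.1 - (vtx L i).1) =
    - e.2 * x.1 + e.1 * x.2 - (e.1 * (vtx L i).2 - e.2 * (vtx L i).1) by ring.
  by rewrite h subrr.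
split; first exact: line_measurable.
apply: line_null; rewrite oppr_eq0 orbC -negb_and; apply: contraNN (vtx_neq L i).
by move=> /andP[/eqP e1 /eqP e2]; rewrite -/e (surjective_pairing e) e1 e2.
Qed.

Lemma cells_null : exists N : set T2, [/\ measurable N, leb2 N = 0%E,
  forall x, Omega x -> ~ N x -> exists k, interior (cell_set (K k)) x & forall x, x \in vertices -> N x].
Proof.
have [N [mN N0 hN]] := @null_cover _ (enum [set: 'I_(ncells J) * 'I_4]%SET)
  (fun p => [set x | half_plane (K p.1) p.2 x = 0]) (fun p => half_plane_line (K p.1) p.2).
exists N; split => // [x Ox Nx|x /allpairsP[[k i] [_ _ ->]]].
  have [k kx] := cover_cell Ox; exists k; apply: half_plane_interior => i.
  rewrite lt_neqAle cell_half_plane // andbT eq_sym; apply/eqP => h.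
  by apply: Nx; apply: (hN (k, i)); rewrite ?mem_enum ?inE.
by apply: (hN (k, i)); rewrite ?mem_enum ?inE //= half_plane_start.
Qed.

End GridTopology.

(** * Bubbles on the reference cell *)

Section ReferenceCell.
Context {R : realType}.

Definition pos (t : R) : R := if 0 < t then t else 0.

Definition heaviside (t : R) : R := if 0 < t then 1 else 0.

Lemma pos_le0 t : t <= 0 -> pos t = 0.
Proof. by rewrite /pos; case: ltP => // h1 h2; have := lt_le_trans h1 h2; rewrite ltxx. Qed.

Lemma pos_gt0 t : 0 < t -> pos t = t.
Proof. by rewrite /pos => ->. Qed.

Lemma pos_lipschitz s t : `|pos s - pos t| <= `|s - t|.
Proof.
have [hs|hs] := ltP 0 s; have [ht|ht] := ltP 0 t; rewrite ?(pos_gt0 hs) ?(pos_gt0 ht) ?(pos_le0 hs) ?(pos_le0 ht) //.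
- by rewrite !ger0_norm ?subr_ge0; lra.
- by rewrite sub0r normrN (gtr0_norm ht) distrC ger0_norm; lra.
- by rewrite subrr normr0.
Qed.

Variables a b : R.

(** The vertices in the coordinates xi, eta: the corners of the square with coordinates 1 and -1,
    displaced alternately by (a, b) and (-a, -b). A parallelogram has a = b = 0. *)
Definition vx (i : 'I_4) : R := nth 0 [:: 1 + a; -1 - a; -1 + a; 1 - a] i.
Definition vy (i : 'I_4) : R := nth 0 [:: 1 + b; 1 - b; -1 + b; -1 - b] i.
(** Twice the area, in these coordinates, of the triangle that joins the center to edge [i]
    ([rhoE]). *)
Definition rho (i : 'I_4) : R := nth 0 [:: 2 * (1 + a); 2 * (1 - b); 2 * (1 - a); 2 * (1 + b)] i.
(** The product of the increments of xi and eta along edge [i] is a multiple of [rho i]; the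
    quotient is linear in [a] and [b], which is what makes the bubbles small on nearly parallelogram
    cells. *)
Definition kap (i : 'I_4) : R := nth 0 [:: 2 * b; - (2 * a); - (2 * b); 2 * a] i.

Definition lam (i : 'I_4) (X Y : R) : R := X * vy (i + 1) - Y * vx (i + 1).
Definition mu (i : 'I_4) (X Y : R) : R := vx i * Y - vy i * X.

(* [lam i] and [mu i] are the barycentric coordinates of the vertices [i] and
   [i + 1] in the triangle with apex the center, up to the factor [rho i]; the [i]th
   summand lives on that triangle and equals the deviation of XY from its affine
   interpolant on the edge [i], up to sign (see [bubbles_edge]). *)
Definition bubbles (X Y : R) : R := \sum_i kap i / rho i * (pos (lam i X Y) * pos (mu i X Y)).

Definition bubbles_dx (X Y : R) : R := \sum_i kap i / rho i *
  (pos (lam i X Y) * (heaviside (mu i X Y) * - vy i) + pos (mu i X Y) * (heaviside (lam i X Y) * vy (i + 1))).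

Definition bubbles_dy (X Y : R) : R := \sum_i kap i / rho i *
  (pos (lam i X Y) * (heaviside (mu i X Y) * vx i) + pos (mu i X Y) * (heaviside (lam i X Y) * - vx (i + 1))).

Hypothesis ab1 : `|a| + `|b| < 1.

Lemma ab_bounds : [/\ -1 < a - b, a - b < 1, -1 < a + b & a + b < 1].
Proof.
have h0 := ab1; have h1 := ler_norm a; have h2 := ler_norm (- a); have h3 := ler_norm b; have h4 := ler_norm (- b).
rewrite !normrN in h2 h4; split; lra.
Qed.

Lemma rho_gt0 i : 0 < rho i.
Proof. by have [h1 h2 h3 h4] := ab_bounds; elim/ord4P: i; rewrite /rho /=; lra. Qed.

Lemma rho_le4 i : rho i <= 4.
Proof. by have [h1 h2 h3 h4] := ab_bounds; elim/ord4P: i; rewrite /rho /=; lra. Qed.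

Lemma rhoE i : rho i = vx i * vy (i + 1) - vy i * vx (i + 1).
Proof. by elim/ord4P: i; rewrite /rho /vx /vy /=; ring. Qed.

Lemma kapE i : kap i * rho i = (vx (i + 1) - vx i) * (vy (i + 1) - vy i).
Proof. by elim/ord4P: i; rewrite /rho /vx /vy /kap /=; ring. Qed.

Lemma kap_le i : `|kap i| <= 2 * (`|a| + `|b|).
Proof.
have ha := normr_ge0 a; have hb := normr_ge0 b.
by elim/ord4P: i; rewrite /kap /= ?normrN normrM (ger0_norm (ler0n _ 2)) ler_wpM2l //; lra.
Qed.

Lemma vx_le i : `|vx i| <= 2.
Proof.
have h0 := ab1; have h1 := ler_norm a; have h2 := ler_norm (- a); have h3 := normr_ge0 b; rewrite normrN in h2.
by elim/ord4P: i; rewrite /vx /= ler_norml; apply/andP; split; lra.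
Qed.

Lemma vy_le i : `|vy i| <= 2.
Proof.
have h0 := ab1; have h1 := ler_norm b; have h2 := ler_norm (- b); have h3 := normr_ge0 a; rewrite normrN in h2.
by elim/ord4P: i; rewrite /vy /= ler_norml; apply/andP; split; lra.
Qed.

Lemma mu_edge_next (i : 'I_4) (t : R) : t <= 1 ->
  mu (i + 1) ((1 - t) * vx i + t * vx (i + 1)) ((1 - t) * vy i + t * vy (i + 1)) <= 0.
Proof.
move=> t1; have -> : mu (i + 1) ((1 - t) * vx i + t * vx (i + 1)) ((1 - t) * vy i + t * vy (i + 1)) =
   - ((1 - t) * rho i) by rewrite rhoE /mu; ring.
by rewrite oppr_le0 mulr_ge0 ?subr_ge0 // ltW // rho_gt0.
Qed.

Lemma lam_edge_prev (j : 'I_4) (t : R) : 0 <= t ->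
  lam j ((1 - t) * vx (j + 1) + t * vx (j + 1 + 1)) ((1 - t) * vy (j + 1) + t * vy (j + 1 + 1)) <= 0.
Proof.
move=> t0; have -> : lam j ((1 - t) * vx (j + 1) + t * vx (j + 1 + 1)) ((1 - t) * vy (j + 1) + t * vy (j + 1 + 1)) =
   - (t * rho (j + 1)) by rewrite rhoE /lam; ring.
by rewrite oppr_le0 mulr_ge0 // ltW // rho_gt0.
Qed.

Lemma opposite_edge (i : 'I_4) (t : R) : 0 <= t -> t <= 1 ->
  let X := (1 - t) * vx i + t * vx (i + 1) in let Y := (1 - t) * vy i + t * vy (i + 1) in
  pos (lam (i + 2) X Y) * pos (mu (i + 2) X Y) = 0.
Proof.
move=> t0 t1 X Y; have [h1 h2 h3 h4] := ab_bounds.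
have [l0|l0] := leP (lam (i + 2) X Y) 0; first by rewrite (pos_le0 l0) mul0r.
have [m0|m0] := leP (mu (i + 2) X Y) 0; first by rewrite (pos_le0 m0) mulr0.
exfalso; move: l0 m0; rewrite /lam /mu /X /Y {X Y}.
have b1 : 0 < 1 + b by lra.
have b2 : 0 < 1 - b by lra.
have a1 : 0 < 1 + a by lra.
have a2 : 0 < 1 - a by lra.
elim/ord4P: i; rewrite /vx /vy /= => l0 m0.
(* In each case a combination of [lam] and [mu] with positive coefficients eliminates one coordinate
   and is a negative multiple of the other, up to the sign that the latter has along edge [i]. *)
- have Y0 : 0 < (1 - t) * (1 + b) + t * (1 - b) by nra.
  by have := mulr_gt0 Y0 a2; have := mulr_gt0 l0 b2; have := mulr_gt0 m0 b1; lra.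
- have X0 : 0 < (1 - t) * (1 + a) + t * (1 - a) by nra.
  by have := mulr_gt0 X0 b1; have := mulr_gt0 l0 a2; have := mulr_gt0 m0 a1; lra.
- have Y0 : 0 < (1 - t) * (1 - b) + t * (1 + b) by nra.
  by have := mulr_gt0 Y0 a1; have := mulr_gt0 l0 b1; have := mulr_gt0 m0 b2; lra.
- have X0 : 0 < (1 - t) * (1 - a) + t * (1 + a) by nra.
  by have := mulr_gt0 X0 b2; have := mulr_gt0 l0 a1; have := mulr_gt0 m0 a2; lra.
Qed.

(** Only the bubble of edge [i] survives there; its barycentric factors are [(1 - t) * rho i] and
    [t * rho i], and [kapE] absorbs the remaining [rho i]. *)
Lemma bubbles_edge (i : 'I_4) (t : R) : 0 <= t -> t <= 1 ->
  bubbles ((1 - t) * vx i + t * vx (i + 1)) ((1 - t) * vy i + t * vy (i + 1)) =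
  (vx (i + 1) - vx i) * (vy (i + 1) - vy i) * (t * (1 - t)).
Proof.
move=> t0 t1; set X := _ + _; set Y := _ + _.
have r0 := rho_gt0 i.
have zero j : j != i -> pos (lam j X Y) * pos (mu j X Y) = 0.
  move=> ji; have [->|j1] := eqVneq j (i + 1).
    by rewrite (pos_le0 (mu_edge_next i t1)) mulr0.
  have [->|j2] := eqVneq j (i + 2); first exact: opposite_edge.
  have ij : i = j + 1 by move: i j ji j1 j2 {X Y r0}; do 2 (elim/ord4P); rewrite // => *; exact: val_inj.
  by rewrite /X /Y ij (pos_le0 (lam_edge_prev j t0)) mul0r.
rewrite /bubbles (bigD1 i) //= big1 ?addr0; last by move=> j ji; rewrite zero // mulr0.
have -> : lam i X Y = (1 - t) * rho i by rewrite rhoE /lam /X /Y; ring.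
have -> : mu i X Y = t * rho i by rewrite rhoE /mu /X /Y; ring.
have pr (s : R) : 0 <= s -> pos (s * rho i) = s * rho i.
  rewrite le_eqVlt => /predU1P[<-|s0]; first by rewrite mul0r pos_le0.
  by rewrite pos_gt0 // mulr_gt0.
rewrite !pr ?subr_ge0 // -kapE; field; exact: lt0r_neq0.
Qed.

Definition ref_cell (X Y : R) : Prop := forall i, lam i X Y + mu i X Y <= rho i.

Lemma bubbles_le X Y : ref_cell X Y -> `|bubbles X Y| <= 32.
Proof.
move=> h; rewrite /bubbles; apply: le_trans (ler_norm_sum _ _ _) _.
(* Each of the four terms is at most 8: [|kap i| <= 2], and [lam * mu / rho <= 4] because
   [lam + mu <= rho <= 4]. *)
have -> : (32 : R) = \sum_(i < 4) 8 by rewrite sumr_const card_ord -mulr_natl; ring.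
apply: ler_sum => i _; have r0 := rho_gt0 i; have r4 := rho_le4 i.
have k2 : `|kap i| <= 2 by apply: le_trans (kap_le i) _; have := ab1; lra.
have [l0|l0] := leP (lam i X Y) 0; first by rewrite (pos_le0 l0) mul0r mulr0 normr0.
have [m0|m0] := leP (mu i X Y) 0; first by rewrite (pos_le0 m0) !mulr0 normr0.
rewrite (pos_gt0 l0) (pos_gt0 m0); have hi := h i.
rewrite normrM normrM normfV (gtr0_norm r0) normrM (gtr0_norm l0) (gtr0_norm m0).
have lm : lam i X Y * mu i X Y / rho i <= 4.
  by rewrite ler_pdivrMr //; nra.
rewrite -mulrA [_^-1 * _]mulrC; have := normr_ge0 (kap i).
have lm0 : 0 <= lam i X Y * mu i X Y / rho i by rewrite divr_ge0 ?mulr_ge0 ?ltW.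
by nra.
Qed.

Let half_term (i : 'I_4) (p q k : R) : `|k| <= 2 -> p + q <= rho i ->
  `|kap i / rho i * (pos p * (heaviside q * k))| <= 4 * (`|a| + `|b|).
Proof.
move=> k2 pq; have r0 := rho_gt0 i; have hk := kap_le i.
have ab0 : 0 <= `|a| + `|b| by rewrite addr_ge0.
have [p0|p0] := leP p 0; first by rewrite (pos_le0 p0) mul0r mulr0 normr0 mulr_ge0.
have [q0|q0] := leP q 0; first by rewrite /heaviside ltNge q0 /= mul0r !mulr0 normr0 mulr_ge0.
rewrite /heaviside q0 mul1r (pos_gt0 p0) !normrM normfV (gtr0_norm r0) (gtr0_norm p0).
have pr : p / rho i <= 1 by rewrite ler_pdivrMr // mul1r; lra.
have pr0 : 0 <= p / rho i by rewrite divr_ge0 // ltW.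
have -> : `|kap i| / rho i * (p * `|k|) = `|kap i| * (p / rho i) * `|k| by rewrite -!mulrA; congr (_ * _); rewrite !mulrA [_^-1 * p]mulrC.
have := normr_ge0 k; have := normr_ge0 (kap i) => kk0 k0.
have h1 : `|kap i| * (p / rho i) <= 2 * (`|a| + `|b|) by nra.
have h2 : 0 <= `|kap i| * (p / rho i) by rewrite mulr_ge0.
by nra.
Qed.

Lemma bubbles_dx_le X Y : ref_cell X Y -> `|bubbles_dx X Y| <= 32 * (`|a| + `|b|).
Proof.
move=> h; rewrite /bubbles_dx; apply: le_trans (ler_norm_sum _ _ _) _.
have -> : 32 * (`|a| + `|b|) = \sum_(i < 4) (8 * (`|a| + `|b|)) by rewrite sumr_const card_ord -mulr_natl; ring.
apply: ler_sum => i _; have hi := h i; rewrite mulrDr; apply: le_trans (ler_normD _ _) _.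
have -> : 8 * (`|a| + `|b|) = 4 * (`|a| + `|b|) + 4 * (`|a| + `|b|) by ring.
by apply: lerD; apply: half_term; rewrite ?normrN ?vy_le // addrC.
Qed.

Lemma bubbles_dy_le X Y : ref_cell X Y -> `|bubbles_dy X Y| <= 32 * (`|a| + `|b|).
Proof.
move=> h; rewrite /bubbles_dy; apply: le_trans (ler_norm_sum _ _ _) _.
have -> : 32 * (`|a| + `|b|) = \sum_(i < 4) (8 * (`|a| + `|b|)) by rewrite sumr_const card_ord -mulr_natl; ring.
apply: ler_sum => i _; have hi := h i; rewrite mulrDr; apply: le_trans (ler_normD _ _) _.
have -> : 8 * (`|a| + `|b|) = 4 * (`|a| + `|b|) + 4 * (`|a| + `|b|) by ring.
by apply: lerD; apply: half_term; rewrite ?normrN ?vx_le // addrC.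
Qed.

End ReferenceCell.

(** * The frame of a cell *)

Section CellFrame.
Context {R : realType}.
Implicit Types (K : quad R) (x y u v : R * R).

(** Half the vector between the midpoints of the diagonals. The vertices are the center plus or
    minus [qr K], plus or minus [qs K], with [qt K] added and subtracted alternately; [ca K] and
    [cb K] are the coordinates of [qt K] in the frame. *)
Definition qt K : R * R := 4^-1 *: (vtx K 0 - vtx K 1 + vtx K 2 - vtx K 3).
Definition qD K : R := cross (qr K) (qs K).
Definition ca K : R := cross (qt K) (qs K) / qD K.
Definition cb K : R := cross (qr K) (qt K) / qD K.

Lemma qD_gt0 K : 0 < qD K. Proof. exact: qr_qs_gt0. Qed.

Lemma qD_neq0 K : qD K != 0. Proof. exact: lt0r_neq0 (qD_gt0 K). Qed.

Lemma vtx_rst K : [/\ vtx K 0 - qcenter K = qr K + qs K + qt K, vtx K 1 - qcenter K = - qr K + qs K - qt K,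
  vtx K 2 - qcenter K = - qr K - qs K + qt K & vtx K 3 - qcenter K = qr K - qs K - qt K].
Proof.
rewrite /qr /qs /qt /qcenter /emid /midpoint !ord4E.
case: (vtx K 0) (vtx K 1) (vtx K 2) (vtx K 3) => [a1 a2] [b1 b2] [c1 c2] [d1 d2].
by split; congr pair; rewrite /= /GRing.scale /=; field.
Qed.

Lemma qxi_vtx K i : qxi K (vtx K i) = vx (ca K) i.
Proof.
have [h0 h1 h2 h3] := vtx_rst K; have := qD_neq0 K.
elim/ord4P: i; rewrite /qxi ?h0 ?h1 ?h2 ?h3 /ca /qD {h0 h1 h2 h3};
  move: (qr K) (qs K) (qt K) => [r1 r2] [s1 s2] [t1 t2]; rewrite /cross /vx /= => D0; field; exact: D0.
Qed.

Lemma qeta_vtx K i : qeta K (vtx K i) = vy (cb K) i.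
Proof.
have [h0 h1 h2 h3] := vtx_rst K; have := qD_neq0 K.
elim/ord4P: i; rewrite /qeta ?h0 ?h1 ?h2 ?h3 /cb /qD {h0 h1 h2 h3};
  move: (qr K) (qs K) (qt K) => [r1 r2] [s1 s2] [t1 t2]; rewrite /cross /vy /= => D0; field; exact: D0.
Qed.

Lemma frame_coord K x : x = qcenter K + qxi K x *: qr K + qeta K x *: qs K.
Proof.
have := qD_neq0 K; rewrite /qxi /qeta /qD; case: x (qr K) (qs K) (qcenter K) => [x1 x2] [r1 r2] [s1 s2] [p1 p2].
by rewrite /cross /= => D0; congr pair; rewrite /= /GRing.scale /=; field.
Qed.

Lemma vtx_coord K i : vtx K i = qcenter K + vx (ca K) i *: qr K + vy (cb K) i *: qs K.
Proof. by rewrite -qxi_vtx -qeta_vtx -frame_coord. Qed.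

Lemma half_plane_coord K i x : half_plane K i x =
  qD K * (rho (ca K) (cb K) i - lam (ca K) (cb K) i (qxi K x) (qeta K x) - mu (ca K) (cb K) i (qxi K x) (qeta K x)).
Proof.
rewrite /half_plane {1}(frame_coord K x) !vtx_coord rhoE /lam /mu /qD /cross /= /GRing.scale /=.
by ring.
Qed.

(** The left turn between consecutive edges is [4 * qD K] times 1 plus or minus [ca K] plus or minus
    [cb K]; the four turns give the four combinations of signs. *)
Lemma ca_cb_lt1 K : `|ca K| + `|cb K| < 1.
Proof.
have D0 := qD_gt0 K.
have H i (c : R) : cross (vtx K (i + 1) - vtx K i) (vtx K (i + 2) - vtx K (i + 1)) = 4 * qD K * c -> 0 < c.
  by have := vtx_ccw K i => /[swap] ->; rewrite pmulr_rgt0 // mulr_gt0.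
have E0 : 0 < 1 + ca K - cb K.
  apply: (H 0); rewrite !ord4E !vtx_coord /vx /vy /qD /cross /= /GRing.scale /=; ring.
have E1 : 0 < 1 - ca K - cb K.
  apply: (H 1); rewrite !ord4E !vtx_coord /vx /vy /qD /cross /= /GRing.scale /=; ring.
have E2 : 0 < 1 - ca K + cb K.
  apply: (H 2); rewrite !ord4E !vtx_coord /vx /vy /qD /cross /= /GRing.scale /=; ring.
have E3 : 0 < 1 + ca K + cb K.
  apply: (H 3); rewrite !ord4E !vtx_coord /vx /vy /qD /cross /= /GRing.scale /=; ring.
by have [ha|ha] := leP 0 (ca K); have [hb|hb] := leP 0 (cb K);
  rewrite ?(ger0_norm ha) ?(ltr0_norm ha) ?(ger0_norm hb) ?(ltr0_norm hb); lra.
Qed.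

Lemma cell_ref K x : cell_set K x -> ref_cell (ca K) (cb K) (qxi K x) (qeta K x).
Proof.
move=> Kx i; have := cell_half_plane Kx i.
by rewrite half_plane_coord pmulr_rge0 ?qD_gt0 // => h; rewrite -subr_ge0 opprD addrA.
Qed.

(** The diamond is the Varignon parallelogram, whose vertices are the midpoints of the edges. *)
Lemma diamond_interior K x : `|qxi K x| + `|qeta K x| < 1 -> interior (cell_set K) x.
Proof.
move=> h; apply: half_plane_interior => i; rewrite half_plane_coord pmulr_rgt0 ?qD_gt0 //.
have := ca_cb_lt1 K; move: h; move: (qxi K x) (qeta K x) (ca K) (cb K) => X Y a b h hab.
have a1 := ler_norm a; have a2 := ler_norm (- a); have b1 := ler_norm b; have b2 := ler_norm (- b).
have X1 := ler_norm X; have X2 := ler_norm (- X); have Y1 := ler_norm Y; have Y2 := ler_norm (- Y).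
rewrite !normrN in a2 b2 X2 Y2.
have XX := normr_ge0 X; have YY := normr_ge0 Y; have aa := normr_ge0 a; have bb := normr_ge0 b.
have ba : `|b * X| <= `|b| * `|X| by rewrite normrM.
have ab : `|a * Y| <= `|a| * `|Y| by rewrite normrM.
have ba1 := ler_norm (b * X); have ba2 := ler_norm (- (b * X)).
have ab1 := ler_norm (a * Y); have ab2 := ler_norm (- (a * Y)).
rewrite !normrN in ba2 ab2.
elim/ord4P: i; rewrite /rho /lam /mu /vx /vy /=; nra.
Qed.

Lemma has_grad_affine (p q c : R) x : has_grad (fun y => p * y.1 + q * y.2 + c) x (p, q).
Proof.
have h := has_gradD (has_gradD (has_gradZ p (has_grad_fst x)) (has_gradZ q (has_grad_snd x))) (has_grad_cst c x).
by apply: has_grad_eq h _; congr pair; rewrite /= /GRing.scale /=; ring.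
Qed.

Definition dxi K : R * R := ((qs K).2 / qD K, - (qs K).1 / qD K).
Definition deta K : R * R := (- (qr K).2 / qD K, (qr K).1 / qD K).

Lemma qxi_affine K y : qxi K y = (dxi K).1 * y.1 + (dxi K).2 * y.2 +
  - ((dxi K).1 * (qcenter K).1 + (dxi K).2 * (qcenter K).2).
Proof.
have := qD_neq0 K; rewrite /qxi /dxi /qD; move: (qr K) (qs K) (qcenter K) y => [r1 r2] [s1 s2] [p1 p2] [y1 y2].
by rewrite /cross /= => D0; field.
Qed.

Lemma qeta_affine K y : qeta K y = (deta K).1 * y.1 + (deta K).2 * y.2 +
  - ((deta K).1 * (qcenter K).1 + (deta K).2 * (qcenter K).2).
Proof.
have := qD_neq0 K; rewrite /qeta /deta /qD; move: (qr K) (qs K) (qcenter K) y => [r1 r2] [s1 s2] [p1 p2] [y1 y2].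
by rewrite /cross /= => D0; field.
Qed.

Lemma has_grad_qxi K x : has_grad (qxi K) x (dxi K).
Proof.
have -> : qxi K = fun y => (dxi K).1 * y.1 + (dxi K).2 * y.2 + - ((dxi K).1 * (qcenter K).1 + (dxi K).2 * (qcenter K).2).
  by apply/funext => y; exact: qxi_affine.
by apply: has_grad_eq (has_grad_affine _ _ _ x) _; rewrite -surjective_pairing.
Qed.

Lemma has_grad_qeta K x : has_grad (qeta K) x (deta K).
Proof.
have -> : qeta K = fun y => (deta K).1 * y.1 + (deta K).2 * y.2 + - ((deta K).1 * (qcenter K).1 + (deta K).2 * (qcenter K).2).
  by apply/funext => y; exact: qeta_affine.
by apply: has_grad_eq (has_grad_affine _ _ _ x) _; rewrite -surjective_pairing.
Qed.

Lemma has_grad_continuous (f : R * R -> R) : (forall x, exists u, has_grad f x u) -> continuous f.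
Proof. by move=> h x; have [u hu] := h x; apply: differentiable_continuous; exact: has_grad_differentiable hu. Qed.

Lemma qxi_continuous K : continuous (qxi K).
Proof. by apply: has_grad_continuous => x; exists (dxi K); exact: has_grad_qxi. Qed.

Lemma qeta_continuous K : continuous (qeta K).
Proof. by apply: has_grad_continuous => x; exists (deta K); exact: has_grad_qeta. Qed.

Lemma has_grad_pos (g : R * R -> R) x u : has_grad g x u -> g x != 0 ->
  has_grad (fun y => pos (g y)) x (heaviside (g x) *: u).
Proof.
move=> hg g0; have cg : {for x, continuous g}.
  by apply: differentiable_continuous; exact: has_grad_differentiable hg.
have [gx|gx] := ltP 0 (g x).
  rewrite /heaviside gx scale1r; apply: has_grad_near hg.
  near=> y; rewrite pos_gt0 //; near: y.
  by apply: (cvgr_gt (g x)) => //; exact: cg.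
have {}gx : g x < 0 by rewrite lt_neqAle g0.
rewrite /heaviside ltNge (ltW gx) /= scale0r; apply: has_grad_near (has_grad_cst 0 x).
near=> y; rewrite pos_le0 // ltW //; near: y.
by apply: (cvgr_lt (g x)) => //; exact: cg.
Unshelve. all: by end_near. Qed.

Definition bilinear_poly (c : 'I_4 -> R) (X Y : R) : R := c 0 + c 1 * X + c 2 * Y + c 3 * (X * Y).

Definition cell_poly K (c : 'I_4 -> R) x : R := bilinear_poly c (qxi K x) (qeta K x).

Definition cell_poly_grad K (c : 'I_4 -> R) x : R * R :=
  (c 1 + c 3 * qeta K x) *: dxi K + (c 2 + c 3 * qxi K x) *: deta K.

Lemma has_grad_cell_poly K c x : has_grad (cell_poly K c) x (cell_poly_grad K c x).
Proof.
have hx := has_grad_qxi K x; have hy := has_grad_qeta K x.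
have h := has_gradD (has_gradD (has_gradD (has_grad_cst (c 0) x) (has_gradZ (c 1) hx)) (has_gradZ (c 2) hy))
  (has_gradZ (c 3) (has_gradM hx hy)).
apply: has_grad_eq h _; rewrite /cell_poly_grad; move: (dxi K) (deta K) => [u1 u2] [v1 v2].
by congr pair; rewrite /= /GRing.scale /=; ring.
Qed.

Definition cell_bubbles K x : R := bubbles (ca K) (cb K) (qxi K x) (qeta K x).

Definition cell_bubbles_grad K x : R * R :=
  bubbles_dx (ca K) (cb K) (qxi K x) (qeta K x) *: dxi K +
  bubbles_dy (ca K) (cb K) (qxi K x) (qeta K x) *: deta K.

(* the four half-lines from the center to the vertices, along which the bubbles have kinks *)
Definition spoke K (i : 'I_4) : set (R * R) :=
  [set x | qxi K x * vy (cb K) i - qeta K x * vx (ca K) i = 0].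

Lemma has_grad_cell_bubbles K x : (forall i, ~ spoke K i x) ->
  has_grad (cell_bubbles K) x (cell_bubbles_grad K x).
Proof.
move=> nx; set a := ca K; set b := cb K.
have hl i : has_grad (fun y => lam a b i (qxi K y) (qeta K y)) x (vy b (i + 1) *: dxi K - vx a (i + 1) *: deta K).
  have h := has_gradD (has_gradZ (vy b (i + 1)) (has_grad_qxi K x)) (has_gradZ (- vx a (i + 1)) (has_grad_qeta K x)).
  rewrite -scaleNr; congr has_grad: h; apply/funext => y; rewrite /lam; ring.
have hm i : has_grad (fun y => mu a b i (qxi K y) (qeta K y)) x (vx a i *: deta K - vy b i *: dxi K).
  have h := has_gradD (has_gradZ (vx a i) (has_grad_qeta K x)) (has_gradZ (- vy b i) (has_grad_qxi K x)).
  rewrite -scaleNr; congr has_grad: h; apply/funext => y; rewrite /mu; ring.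
have l0 i : lam a b i (qxi K x) (qeta K x) != 0.
  by apply/eqP => h; apply: (nx (i + 1)).
have m0 i : mu a b i (qxi K x) (qeta K x) != 0.
  by apply/eqP => h; apply: (nx i); rewrite /spoke /= -oppr0 -h /mu; ring.
have h := has_grad_sum (index_enum 'I_4) (fun i => has_gradZ (kap a b i / rho a b i)
  (has_gradM (has_grad_pos (hl i) (l0 i)) (has_grad_pos (hm i) (m0 i)))).
apply: has_grad_eq h _; rewrite /cell_bubbles_grad /bubbles_dx /bubbles_dy !scaler_suml -big_split /=.
apply: eq_bigr => i _; rewrite -/a -/b.
move: (dxi K) (deta K) => [u1 u2] [v1 v2].
by congr pair; rewrite /= /GRing.scale /=; ring.
Qed.

End CellFrame.

(** * The edgewise affine function of a cell *)

Section CellFunction.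
Context {R : realType}.
Implicit Types (K : quad R) (c : 'I_4 -> R) (x y : R * R).
Local Notation T2 := (measurableTypeR R * measurableTypeR R)%type.

Definition cell_fun K c x : R := cell_poly K c x + c 3 * cell_bubbles K x.

Definition cell_fun_grad K c x : R * R := cell_poly_grad K c x + c 3 *: cell_bubbles_grad K x.

Lemma has_grad_cell_fun K c x : (forall i, ~ spoke K i x) -> has_grad (cell_fun K c) x (cell_fun_grad K c x).
Proof.
by move=> nx; exact: has_gradD (has_grad_cell_poly K c x) (has_gradZ (c 3) (has_grad_cell_bubbles nx)).
Qed.

Lemma cell_fun_edge K c i (t : R) : 0 <= t -> t <= 1 ->
  cell_fun K c ((1 - t) *: vtx K i + t *: vtx K (i + 1)) =
  (1 - t) * cell_poly K c (vtx K i) + t * cell_poly K c (vtx K (i + 1)).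
Proof.
move=> t0 t1; have ab := ca_cb_lt1 K.
have hx : qxi K ((1 - t) *: vtx K i + t *: vtx K (i + 1)) = (1 - t) * vx (ca K) i + t * vx (ca K) (i + 1).
  by rewrite -!qxi_vtx !qxi_affine /= /GRing.scale /=; ring.
have hy : qeta K ((1 - t) *: vtx K i + t *: vtx K (i + 1)) = (1 - t) * vy (cb K) i + t * vy (cb K) (i + 1).
  by rewrite -!qeta_vtx !qeta_affine /= /GRing.scale /=; ring.
rewrite /cell_fun /cell_bubbles /cell_poly /bilinear_poly hx hy bubbles_edge // !qxi_vtx !qeta_vtx.
by ring.
Qed.

Lemma spoke_line K i : measurable (spoke K i : set T2) /\ leb2 (spoke K i : set T2) = 0%E.
Proof.
pose a := (dxi K).1 * vy (cb K) i - (deta K).1 * vx (ca K) i.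
pose b := (dxi K).2 * vy (cb K) i - (deta K).2 * vx (ca K) i.
pose d := ((dxi K).1 * (qcenter K).1 + (dxi K).2 * (qcenter K).2) * vy (cb K) i -
  ((deta K).1 * (qcenter K).1 + (deta K).2 * (qcenter K).2) * vx (ca K) i.
have -> : spoke K i = [set x | a * x.1 + b * x.2 = d].
  apply/seteqP; split => x; rewrite /spoke /= qxi_affine qeta_affine => h.
    by apply/eqP; rewrite -subr_eq0; apply/eqP; rewrite -[RHS]h /a /b /d; ring.
  by move/eqP: h; rewrite -subr_eq0 => /eqP h; rewrite -[RHS]h /a /b /d; ring.
split; first exact: line_measurable.
apply: line_null; rewrite -negb_and; apply/negP => /andP[/eqP a0 /eqP b0].
have D0 := qD_neq0 K.
have h2 : vy (cb K) i = 0.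
  suff -> : vy (cb K) i = (qr K).1 * a + (qr K).2 * b by rewrite a0 b0; ring.
  move: D0; rewrite /a /b /dxi /deta /qD; move: (qr K) (qs K) => [r1 r2] [s1 s2].
  by rewrite /cross /= => D0; field; exact: D0.
have h3 : vx (ca K) i = 0.
  suff -> : vx (ca K) i = - ((qs K).1 * a + (qs K).2 * b) by rewrite a0 b0; ring.
  move: D0; rewrite /a /b /dxi /deta /qD; move: (qr K) (qs K) => [r1 r2] [s1 s2].
  by rewrite /cross /= => D0; field; exact: D0.
by have := rho_gt0 (ca_cb_lt1 K) i; rewrite rhoE h2 h3 !mul0r subrr ltxx.
Qed.

Lemma heaviside_measurable (g : R * R -> R) (D : set T2) : continuous g -> measurable D ->
  measurable_fun D (fun x : T2 => heaviside (g x)).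
Proof.
move=> cg mD; have -> : (fun x : T2 => heaviside (g x)) = \1_(g @^-1` [set t | 0 < t]).
  apply/funext => x; rewrite /heaviside indicE; case: (boolP (0 < g x)) => h; first by rewrite mem_set.
  by rewrite memNset // => h'; move/negP: h; apply.
apply: measurable_indic; apply: open_measurable2; apply: open_comp; last exact: open_gt.
by move=> x _; exact: cg.
Qed.

Lemma lam_continuous K i : continuous (fun x => lam (ca K) (cb K) i (qxi K x) (qeta K x)).
Proof.
move=> x; rewrite /lam; apply: cvgB; apply: cvgM; try exact: cvg_cst;
  [exact: qxi_continuous|exact: qeta_continuous].
Qed.

Lemma mu_continuous K i : continuous (fun x => mu (ca K) (cb K) i (qxi K x) (qeta K x)).
Proof.
move=> x; rewrite /mu; apply: cvgB; apply: cvgM; try exact: cvg_cst;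
  [exact: qeta_continuous|exact: qxi_continuous].
Qed.

Lemma pos_continuous (g : R * R -> R) : continuous g -> continuous (fun x => pos (g x)).
Proof.
move=> cg x; apply/cvgrPdist_lt => e e0; have /cvgrPdist_lt/(_ e e0) := cg x.
by apply: filterS => y; apply: le_lt_trans; exact: pos_lipschitz.
Qed.

Lemma cell_poly_continuous K c : continuous (cell_poly K c).
Proof. by apply: has_grad_continuous => x; exists (cell_poly_grad K c x); exact: has_grad_cell_poly. Qed.

Lemma cell_fun_grad_measurable K c (D : set T2) : measurable D ->
  measurable_fun D (fun x => (cell_fun_grad K c x).1 : R) /\
  measurable_fun D (fun x => (cell_fun_grad K c x).2 : R).
Proof.
move=> mD; have mc f : continuous f -> measurable_fun D (f : T2 -> R) by move=> cf; exact: continuous_measurable2.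
have mxi := mc _ (@qxi_continuous _ K); have meta := mc _ (@qeta_continuous _ K).
have ml i := mc _ (pos_continuous (@lam_continuous K i)).
have mm i := mc _ (pos_continuous (@mu_continuous K i)).
have hl i := heaviside_measurable (@lam_continuous K i) mD.
have hm i := heaviside_measurable (@mu_continuous K i) mD.
have mk (a : R) : measurable_fun D (fun=> a) by exact: measurable_cst.
have mdx : measurable_fun D (fun x => bubbles_dx (ca K) (cb K) (qxi K x) (qeta K x) : R).
  rewrite /bubbles_dx; apply: measurable_sum => i; apply: measurable_funM => //.
  by apply: measurable_funD; apply: measurable_funM => //; exact: measurable_funM.
have mdy : measurable_fun D (fun x => bubbles_dy (ca K) (cb K) (qxi K x) (qeta K x) : R).
  rewrite /bubbles_dy; apply: measurable_sum => i; apply: measurable_funM => //.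
  by apply: measurable_funD; apply: measurable_funM => //; exact: measurable_funM.
by split; rewrite /cell_fun_grad /cell_poly_grad /cell_bubbles_grad /= /GRing.scale /=;
  do ?[apply: measurable_funD => //|apply: measurable_funM => //].
Qed.

(** The two bounds go together because a product of Lipschitz functions is Lipschitz only when the
    factors are bounded. *)
Definition lip_bounded (S : set (R * R)) (f : R * R -> R) : Prop := exists L : R, 0 <= L /\
  (forall x y, S x -> S y -> `|f x - f y| <= L * `|x - y|) /\ forall x, S x -> `|f x| <= L.

Lemma lip_bounded_cst S (a : R) : lip_bounded S (fun=> a).
Proof.
exists `|a|; split=> //; split => // x y _ _; by rewrite subrr normr0 mulr_ge0.
Qed.

Lemma lip_boundedD S f g : lip_bounded S f -> lip_bounded S g -> lip_bounded S (fun x => f x + g x).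
Proof.
move=> [L [L0 [fL fM]]] [M [M0 [gL gM]]]; exists (L + M); split; first exact: addr_ge0.
split=> [x y Sx Sy|x Sx]; last by apply: le_trans (ler_normD _ _) _; exact: lerD (fM _ Sx) (gM _ Sx).
rewrite opprD addrACA mulrDl; apply: le_trans (ler_normD _ _) _; exact: lerD (fL _ _ Sx Sy) (gL _ _ Sx Sy).
Qed.

Lemma lip_boundedM S f g : lip_bounded S f -> lip_bounded S g -> lip_bounded S (fun x => f x * g x).
Proof.
move=> [L [L0 [fL fM]]] [M [M0 [gL gM]]]; exists (L * M + L * M); have LM := mulr_ge0 L0 M0.
split; first exact: addr_ge0.
split=> [x y Sx Sy|x Sx]; last first.
  rewrite normrM; apply: le_trans (_ : L * M <= _); last by rewrite lerDl.
  by apply: ler_pM => //; [exact: fM|exact: gM].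
have -> : f x * g x - f y * g y = (f x - f y) * g x + f y * (g x - g y) by ring.
apply: le_trans (ler_normD _ _) _; rewrite !normrM mulrDl; apply: lerD.
  by rewrite mulrAC; apply: ler_pM => //; [exact: fL|exact: gM].
by rewrite -mulrA; apply: ler_pM => //; [exact: fM|exact: gL].
Qed.

Lemma lip_bounded_sum S (I : Type) (s : seq I) (F : I -> R * R -> R) :
  (forall i, lip_bounded S (F i)) -> lip_bounded S (fun x => \sum_(i <- s) F i x).
Proof.
move=> h; elim: s => [|i s IH].
  have -> : (fun x => \sum_(i <- [::]) F i x) = fun=> 0 by apply/funext => x; rewrite big_nil.
  exact: lip_bounded_cst.
have -> : (fun x => \sum_(j <- i :: s) F j x) = fun x => F i x + \sum_(j <- s) F j x.
  by apply/funext => x; rewrite big_cons.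
exact: lip_boundedD.
Qed.

Lemma lip_bounded_pos S f : lip_bounded S f -> lip_bounded S (fun x => pos (f x)).
Proof.
move=> [L [L0 [fL fM]]]; exists L; split => //; split=> [x y Sx Sy|x Sx].
  by apply: le_trans (pos_lipschitz _ _) _; exact: fL.
apply: le_trans (fM _ Sx); have := pos_lipschitz (f x) 0.
by rewrite (pos_le0 (lexx 0)) !subr0.
Qed.

Lemma affine_lipschitz (p q d : R) x y :
  `|p * x.1 + q * x.2 + d - (p * y.1 + q * y.2 + d)| <= (`|p| + `|q|) * `|x - y|.
Proof.
have -> : p * x.1 + q * x.2 + d - (p * y.1 + q * y.2 + d) = p * (x - y).1 + q * (x - y).2 by rewrite /=; ring.
apply: le_trans (ler_normD _ _) _; rewrite !normrM mulrDl; apply: lerD; apply: ler_wpM2l => //;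
  by rewrite [in leRHS]prod_normE le_max lexx ?orbT.
Qed.

Lemma cell_qxi_le K x : cell_set K x -> `|qxi K x| <= 2.
Proof.
move=> [l [l0 l1 ->]]; have -> : qxi K (\sum_i l i *: vtx K i) = \sum_i l i * vx (ca K) i.
  rewrite (eq_bigr (fun i => l i * qxi K (vtx K i))); last by move=> i _; rewrite qxi_vtx.
  move: l1; rewrite !sum4E => l1; have -> : l 0 = 1 - l 1 - l 2 - l 3 by rewrite -l1; ring.
  by rewrite !qxi_affine /= /GRing.scale /=; ring.
apply: le_trans (ler_norm_sum _ _ _) _; have -> : (2 : R) = \sum_i l i * 2 by rewrite -mulr_suml l1 mul1r.
by apply: ler_sum => i _; rewrite normrM (ger0_norm (l0 i)) ler_wpM2l //; exact: vx_le (ca_cb_lt1 K) i.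
Qed.

Lemma cell_qeta_le K x : cell_set K x -> `|qeta K x| <= 2.
Proof.
move=> [l [l0 l1 ->]]; have -> : qeta K (\sum_i l i *: vtx K i) = \sum_i l i * vy (cb K) i.
  rewrite (eq_bigr (fun i => l i * qeta K (vtx K i))); last by move=> i _; rewrite qeta_vtx.
  move: l1; rewrite !sum4E => l1; have -> : l 0 = 1 - l 1 - l 2 - l 3 by rewrite -l1; ring.
  by rewrite !qeta_affine /= /GRing.scale /=; ring.
apply: le_trans (ler_norm_sum _ _ _) _; have -> : (2 : R) = \sum_i l i * 2 by rewrite -mulr_suml l1 mul1r.
by apply: ler_sum => i _; rewrite normrM (ger0_norm (l0 i)) ler_wpM2l //; exact: vy_le (ca_cb_lt1 K) i.
Qed.

Lemma lip_bounded_qxi K : lip_bounded (cell_set K) (qxi K).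
Proof.
exists (`|(dxi K).1| + `|(dxi K).2| + 2); split; first by rewrite !addr_ge0.
split=> [x y _ _|x Kx]; last by apply: le_trans (cell_qxi_le Kx) _; rewrite lerDr addr_ge0.
rewrite !qxi_affine; apply: le_trans (affine_lipschitz _ _ _ _ _) _.
by rewrite ler_wpM2r // lerDl.
Qed.

Lemma lip_bounded_qeta K : lip_bounded (cell_set K) (qeta K).
Proof.
exists (`|(deta K).1| + `|(deta K).2| + 2); split; first by rewrite !addr_ge0.
split=> [x y _ _|x Kx]; last by apply: le_trans (cell_qeta_le Kx) _; rewrite lerDr addr_ge0.
rewrite !qeta_affine; apply: le_trans (affine_lipschitz _ _ _ _ _) _.
by rewrite ler_wpM2r // lerDl.
Qed.

Lemma lip_bounded_cell_fun K c : lip_bounded (cell_set K) (cell_fun K c).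
Proof.
have hx := lip_bounded_qxi K; have hy := lip_bounded_qeta K; have hc := lip_bounded_cst (cell_set K).
have hl i : lip_bounded (cell_set K) (fun x => lam (ca K) (cb K) i (qxi K x) (qeta K x)).
  rewrite /lam; apply: lip_boundedD; first exact: lip_boundedM.
  have -> : (fun x => - (qeta K x * vx (ca K) (i + 1))) = (fun x => qeta K x * - vx (ca K) (i + 1)).
    by apply/funext => x; rewrite mulrN.
  exact: lip_boundedM.
have hm i : lip_bounded (cell_set K) (fun x => mu (ca K) (cb K) i (qxi K x) (qeta K x)).
  rewrite /mu; apply: lip_boundedD; first exact: lip_boundedM.
  have -> : (fun x => - (vy (cb K) i * qxi K x)) = (fun x => - vy (cb K) i * qxi K x).
    by apply/funext => x; rewrite mulNr.
  exact: lip_boundedM.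
apply: lip_boundedD.
  have hxy := lip_boundedM hx hy.
  exact: lip_boundedD (lip_boundedD (lip_boundedD (hc (c 0)) (lip_boundedM (hc (c 1)) hx))
    (lip_boundedM (hc (c 2)) hy)) (lip_boundedM (hc (c 3)) hxy).
apply: lip_boundedM => //; apply: lip_bounded_sum => i; apply: lip_boundedM => //.
by apply: lip_boundedM; exact: lip_bounded_pos.
Qed.

(** It makes the filter in [vtrace] proper, so that the limit there is the value of the
    polynomial. *)
Lemma vtx_closure_interior K i : closure (interior (cell_set K)) (vtx K i).
Proof.
move=> B /nbhs_dist_ball[e e0 he]; set A := vtx K i; set m := qcenter K.
have hO j : 0 < half_plane K j m.
  apply: interior_half_plane; apply: diamond_interior.
  by rewrite /qxi /qeta /m subrr /cross /= !(mul0r, mulr0) subrr !mul0r !normr0 addr0.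
pose t := Num.min 1 (e / (1 + `|m - A|)) / 2.
have n0 : 0 < 1 + `|m - A| by rewrite ltr_wpDr.
have t0 : 0 < t by rewrite divr_gt0 // lt_min ltr01 divr_gt0.
have t1 : t < 1 by rewrite ltr_pdivrMr // mul1r (@le_lt_trans _ _ 1) ?ge_min ?lexx // ltr1n.
exists ((1 - t) *: A + t *: m); split.
  apply: half_plane_interior => j; rewrite half_plane_affine; apply: ltr_wpDl; last exact: mulr_gt0 t0 (hO j).
  by rewrite mulr_ge0 ?half_plane_ge0 // subr_ge0 ltW.
apply: he; rewrite distrC segment_subl normrZ gtr0_norm //.
apply: (@le_lt_trans _ _ (t * (1 + `|m - A|))); first by rewrite ler_wpM2l ?(ltW t0) // lerDr.
rewrite -ltr_pdivlMr //; have : t * 2 <= e / (1 + `|m - A|) by rewrite divfK // ge_min lexx orbT.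
by move=> h; apply: lt_le_trans h; rewrite mulr_natr mulr2n ltrDl.
Qed.

Lemma vtrace_cell_poly K v c i : (forall x, interior (cell_set K) x -> v x = cell_poly K c x) ->
  vtrace K v (vtx K i) = cell_poly K c (vtx K i).
Proof.
move=> vE; rewrite /vtrace.
have pf : ProperFilter (within (interior (cell_set K)) (nbhs (vtx K i))).
  exact/within_nbhs_proper/vtx_closure_interior.
apply: (@cvg_lim _ (@Rhausdorff R)).
have : cell_poly K c x @[x --> within (interior (cell_set K)) (nbhs (vtx K i))] --> cell_poly K c (vtx K i).
  by apply: cvg_within_filter; exact: cell_poly_continuous.
apply: cvg_trans; apply: near_eq_cvg; rewrite near_withinE; near=> x => hx; by rewrite vE.
Unshelve. all: by end_near. Qed.

End CellFunction.

(** * Estimates on a cell *)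

Section CellEstimates.
Context {R : realType}.
Implicit Types (K : quad R) (c : 'I_4 -> R) (x y u v : R * R) (s : R).
Local Notation T2 := (measurableTypeR R * measurableTypeR R)%type.

Lemma enorm_ge0 u : 0 <= enorm u. Proof. exact: sqrtr_ge0. Qed.

Lemma enorm_sqr u : enorm u ^+ 2 = u.1 ^+ 2 + u.2 ^+ 2.
Proof. by rewrite sqr_sqrtr // addr_ge0 ?sqr_ge0. Qed.

Lemma normr_le_enorm (a : R) u : a ^+ 2 <= u.1 ^+ 2 + u.2 ^+ 2 -> `|a| <= enorm u.
Proof. by rewrite -enorm_sqr -real_normK ?num_real // ler_sqr ?nnegrE ?enorm_ge0. Qed.

Lemma fst_le_enorm u : `|u.1| <= enorm u.
Proof. by apply: normr_le_enorm; rewrite lerDl sqr_ge0. Qed.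

Lemma snd_le_enorm u : `|u.2| <= enorm u.
Proof. by apply: normr_le_enorm; rewrite lerDr sqr_ge0. Qed.

Lemma prod_norm_le_enorm u : `|u| <= enorm u.
Proof. by rewrite prod_normE ge_max fst_le_enorm snd_le_enorm. Qed.

Lemma cross_le_enorm u v : `|cross u v| <= enorm u * enorm v.
Proof.
have h0 : 0 <= enorm u * enorm v by rewrite mulr_ge0 ?enorm_ge0.
rewrite -ler_sqr ?nnegrE // real_normK ?num_real // exprMn !enorm_sqr /cross -subr_ge0.
have -> : (u.1 ^+ 2 + u.2 ^+ 2) * (v.1 ^+ 2 + v.2 ^+ 2) - (u.1 * v.2 - u.2 * v.1) ^+ 2 =
  (u.1 * v.1 + u.2 * v.2) ^+ 2 by ring.
exact: sqr_ge0.
Qed.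

Lemma dot_le_enorm u v : `|u.1 * v.1 + u.2 * v.2| <= enorm u * enorm v.
Proof.
have h0 : 0 <= enorm u * enorm v by rewrite mulr_ge0 ?enorm_ge0.
rewrite -ler_sqr ?nnegrE // real_normK ?num_real // exprMn !enorm_sqr -subr_ge0.
have -> : (u.1 ^+ 2 + u.2 ^+ 2) * (v.1 ^+ 2 + v.2 ^+ 2) - (u.1 * v.1 + u.2 * v.2) ^+ 2 =
  (u.1 * v.2 - u.2 * v.1) ^+ 2 by ring.
exact: sqr_ge0.
Qed.

Lemma enormD u v : enorm (u + v) <= enorm u + enorm v.
Proof.
have h0 : 0 <= enorm u + enorm v by rewrite addr_ge0 ?enorm_ge0.
rewrite -ler_sqr ?nnegrE ?enorm_ge0 // sqrrD !enorm_sqr /=.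
have := le_trans (ler_norm _) (dot_le_enorm u v); lra.
Qed.

Lemma enormZ (a : R) u : enorm (a *: u) = `|a| * enorm u.
Proof.
by apply/eqP; rewrite -(@eqrXn2 _ 2) ?mulr_ge0 ?enorm_ge0 // exprMn !enorm_sqr real_normK ?num_real //=
  /GRing.scale /=; apply/eqP; ring.
Qed.

Section Cell.
Variables (K : quad R) (sigma : R).
Hypothesis K_shape : shape_number K <= sigma.
Let r := enorm (qr K).
Let s := enorm (qs K).
Let D := qD K.

Let D0 : 0 < D := qD_gt0 K.

Lemma qr_gt0 : 0 < enorm (qr K).
Proof.
rewrite lt_neqAle enorm_ge0 andbT eq_sym; apply/eqP => h.
by have := cross_le_enorm (qr K) (qs K); rewrite h mul0r normr_le0 => /eqP h'; have := qD_neq0 K; rewrite /qD h' eqxx.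
Qed.

Lemma qs_gt0 : 0 < enorm (qs K).
Proof.
rewrite lt_neqAle enorm_ge0 andbT eq_sym; apply/eqP => h.
by have := cross_le_enorm (qr K) (qs K); rewrite h mulr0 normr_le0 => /eqP h'; have := qD_neq0 K; rewrite /qD h' eqxx.
Qed.

Let r0 : 0 < r := qr_gt0.
Let s0 : 0 < s := qs_gt0.

Lemma shape_bounds : [/\ r * s <= sigma * D, r <= sigma * s, s <= sigma * r & 0 < sigma].
Proof.
move: K_shape; rewrite /shape_number !ge_max -/(qD K) -/r -/s -/D => /andP[h1 /andP[h2 h3]].
rewrite -ler_pdivrMr // h1 -ler_pdivrMr // h2 -ler_pdivrMr // h3; split => //.
by apply: lt_le_trans h2; rewrite divr_gt0.
Qed.

Let S := 2 * (sigma ^+ 2 + sigma).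

(** Regularity makes the area [D] comparable to the squared size of the cell, so that the bounds
    below become scale invariant. *)
Lemma sqr_size_le : (r + s) ^+ 2 <= S * D.
Proof.
have [h1 h2 h3 sg] := shape_bounds.
have a1 : r ^+ 2 <= sigma * (r * s) by rewrite expr2 mulrCA ler_wpM2l // ltW.
have a2 : s ^+ 2 <= sigma * (r * s) by rewrite expr2 mulrA ler_wpM2r // ltW.
have a3 : sigma * (r * s) <= sigma * (sigma * D) by rewrite ler_wpM2l // ltW.
by move: a1 a2 a3 h1; rewrite /S; move: (r * s) (r ^+ 2) (s ^+ 2) (sqrrD r s) => rs rr ss ->; lra.
Qed.

Lemma frame_diff x y : x - y = (qxi K x - qxi K y) *: qr K + (qeta K x - qeta K y) *: qs K.
Proof.
rewrite {1}(frame_coord K x) {1}(frame_coord K y).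
by move: (qcenter K) (qr K) (qs K) => [p1 p2] [r1 r2] [s1 s2]; congr pair; rewrite /= /GRing.scale /=; ring.
Qed.

Lemma cell_dist_le x y : cell_set K x -> cell_set K y -> enorm (x - y) <= 4 * (r + s).
Proof.
move=> Kx Ky; rewrite frame_diff; apply: le_trans (enormD _ _) _; rewrite !enormZ mulrDr.
have h (a b : R) : `|a| <= 2 -> `|b| <= 2 -> `|a - b| <= 4.
  by move=> ha hb; apply: le_trans (ler_normB _ _) _; lra.
by apply: lerD; apply: ler_wpM2r; rewrite ?enorm_ge0 // h // ?cell_qxi_le ?cell_qeta_le.
Qed.

Lemma cell_center : cell_set K (qcenter K).
Proof.
apply: interior_subset; apply: diamond_interior.
by rewrite /qxi /qeta subrr /cross /= !(mul0r, mulr0) subrr !mul0r !normr0 addr0.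
Qed.

Lemma cell_diam_ub x y : cell_set K x -> cell_set K y -> enorm (x - y) <= diam (cell_set K).
Proof.
move=> Kx Ky; apply: sup_upper_bound; last by exists (x, y).
split; first by exists (enorm (x - y)), (x, y).
by exists (4 * (r + s)) => _ [[a b] [/= Ka Kb] <-]; exact: cell_dist_le.
Qed.

Lemma cell_diam_ge0 : 0 <= diam (cell_set K).
Proof. by apply: le_trans (enorm_ge0 _) (cell_diam_ub cell_center cell_center). Qed.

Lemma cell_diam_le : diam (cell_set K) <= 4 * (r + s).
Proof.
apply: ge_sup; first by exists (enorm (qcenter K - qcenter K)), (qcenter K, qcenter K); split => //; exact: cell_center.
by move=> _ [[a b] [/= Ka Kb] <-]; exact: cell_dist_le.
Qed.

Lemma cell_measure : leb2 (cell_set K : set T2) = (fine (leb2 (cell_set K : set T2)))%:E /\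
  fine (leb2 (cell_set K : set T2)) <= (2 * diam (cell_set K)) ^+ 2.
Proof.
have sub : cell_set K `<=` [set z | `|z - qcenter K| <= diam (cell_set K)].
  by move=> z Kz /=; apply: le_trans (prod_norm_le_enorm _) (cell_diam_ub Kz cell_center).
have mB : measurable ([set z | `|z - qcenter K| <= diam (cell_set K)] : set T2).
  apply: closed_measurable2; apply: (preimage_closed (f := fun z : R * R => `|z - qcenter K|) (D := [set t | t <= diam (cell_set K)])).
    by move=> z _; apply: cvg_norm; apply: cvgB; [exact: cvg_id|exact: cvg_cst].
  exact: closed_le.
have mK : measurable (cell_set K : set T2) by apply: closed_measurable2; exact: cell_closed.
have h : (leb2 (cell_set K : set T2) <= ((2 * diam (cell_set K)) ^+ 2)%:E)%E.
  by rewrite -(box_measure (qcenter K) cell_diam_ge0); apply: le_measure; rewrite ?inE.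
have fin : (leb2 (cell_set K : set T2) \is a fin_num).
  by rewrite ge0_fin_numE ?measure_ge0 //; apply: le_lt_trans h (ltry _).
by split; [rewrite fineK|rewrite -lee_fin fineK].
Qed.

Lemma diag_dist_qt : diag_dist K = 2 * enorm (qt K).
Proof.
rewrite -[2]gtr0_norm // -enormZ /diag_dist /qt /midpoint; congr enorm.
case: (vtx K 0) (vtx K 1) (vtx K 2) (vtx K 3) => [a1 a2] [b1 b2] [c1 c2] [d1 d2].
by congr pair; rewrite /= /GRing.scale /=; field.
Qed.

Lemma ca_cb_le : `|ca K| + `|cb K| <= enorm (qt K) * (r + s) / D.
Proof.
rewrite /ca /cb !normrM !normfV (gtr0_norm (qD_gt0 K)) -mulrDl ler_wpM2r ?invr_ge0 ?(ltW D0) //.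
rewrite mulrDr addrC; apply: lerD; last exact: cross_le_enorm.
by rewrite mulrC cross_le_enorm.
Qed.

Let div_le u (a : R) : `|a| <= enorm u -> `|a / qD K| <= enorm u / D.
Proof. by move=> h; rewrite normrM normfV (gtr0_norm D0) ler_wpM2r // invr_ge0 ltW. Qed.

Lemma dxi_le : `|(dxi K).1| <= s / D /\ `|(dxi K).2| <= s / D.
Proof. by split; apply: div_le; [exact: snd_le_enorm|rewrite normrN; exact: fst_le_enorm]. Qed.

Lemma deta_le : `|(deta K).1| <= r / D /\ `|(deta K).2| <= r / D.
Proof. by split; apply: div_le; [rewrite normrN; exact: snd_le_enorm|exact: fst_le_enorm]. Qed.

Lemma cell_bubbles_grad_bound x : cell_set K x -> let M := 32 * (`|ca K| + `|cb K|) * ((r + s) / D) in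
  `|(cell_bubbles_grad K x).1| <= M /\ `|(cell_bubbles_grad K x).2| <= M.
Proof.
move=> Kx M; have rc := cell_ref Kx; have ab := ca_cb_lt1 K.
have hx := bubbles_dx_le ab rc; have hy := bubbles_dy_le ab rc.
have [x1 x2] := dxi_le; have [y1 y2] := deta_le.
have comb (b1 b2 A p q : R) : `|b1| <= A -> `|b2| <= A -> `|p| <= s / D -> `|q| <= r / D ->
    `|b1 * p + b2 * q| <= A * ((r + s) / D).
  move=> h1 h2 hp hq; apply: le_trans (ler_normD _ _) _; rewrite !normrM addrC [(r + s) / D]mulrDl mulrDr.
  by apply: lerD; apply: ler_pM.
by split; rewrite /cell_bubbles_grad /= /GRing.scale /=; exact: comb.
Qed.

Variable kappa : R.
Hypothesis K_par : diag_dist K <= kappa * diam (cell_set K) ^+ 2.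

Let arith1 (t d k : R) : 0 < d -> 0 <= t -> 2 * t <= k * (16 * (S * d)) -> 0 <= S -> t * (S * d) / d ^+ 2 <= 8 * k * S ^+ 2.
Proof.
move=> d0 t0 h S0; have -> : t * (S * d) / d ^+ 2 = t * S / d by field; exact: lt0r_neq0.
rewrite ler_pdivrMr //; nra.
Qed.

(** All powers of the size cancel: [|ca| + |cb| <= enorm (qt K) * (r + s) / D], while [enorm (qt K)]
    is half of [diag_dist K], hence at most [8 * |kappa| * S * D]. With [(r + s) ^+ 2 <= S * D] this
    leaves [32 * 8 * |kappa| * S ^+ 2]. *)
Let bubbles_coef_le : 32 * (`|ca K| + `|cb K|) * ((r + s) / D) <= 256 * `|kappa| * S ^+ 2.
Proof.
have [_ _ _ sg] := shape_bounds; have S0 : 0 <= S by rewrite /S mulr_ge0 // addr_ge0 ?sqr_ge0 // ltW.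
have t0 := enorm_ge0 (qt K); have rs := sqr_size_le.
have h2 : 2 * enorm (qt K) <= `|kappa| * (16 * (S * D)).
  rewrite -diag_dist_qt; apply: le_trans K_par _.
  apply: (@le_trans _ _ (`|kappa| * diam (cell_set K) ^+ 2)); first by rewrite ler_wpM2r ?sqr_ge0 ?ler_norm.
  rewrite ler_wpM2l //; apply: (@le_trans _ _ ((4 * (r + s)) ^+ 2)).
    by rewrite lerXn2r ?nnegrE ?cell_diam_ge0 ?cell_diam_le // mulr_ge0 // addr_ge0 // ltW.
  by rewrite exprMn; move: rs; set z := (r + s) ^+ 2; lra.
have -> : 256 * `|kappa| * S ^+ 2 = 32 * (8 * `|kappa| * S ^+ 2) by ring.
rewrite -mulrA ler_wpM2l //.
apply: le_trans (_ : enorm (qt K) * (r + s) / D * ((r + s) / D) <= _).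
  by rewrite ler_wpM2r ?ca_cb_le // divr_ge0 // ?ltW // addr_gt0.
have -> : enorm (qt K) * (r + s) / D * ((r + s) / D) = enorm (qt K) * (r + s) ^+ 2 / D ^+ 2.
  by field; exact: lt0r_neq0.
apply: le_trans (arith1 D0 t0 h2 S0); rewrite ler_wpM2r ?invr_ge0 ?sqr_ge0 //.
by rewrite ler_wpM2l.
Qed.

Lemma cell_bubbles_grad_le x : cell_set K x ->
  `|(cell_bubbles_grad K x).1| <= 256 * `|kappa| * S ^+ 2 /\ `|(cell_bubbles_grad K x).2| <= 256 * `|kappa| * S ^+ 2.
Proof. by move=> /cell_bubbles_grad_bound[h1 h2]; split; apply: le_trans bubbles_coef_le. Qed.

Lemma box_integral_ge (U : set T2) (f : T2 -> R) (p : R * R) (d m : R) : measurable U -> rintegrable U f ->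
  (forall x, U x -> 0 <= f x) -> 0 <= d -> (forall x, `|x - p| <= d -> U x /\ m <= f x) ->
  m * (2 * d) ^+ 2 <= \int[leb2]_(x in U) f x.
Proof.
move=> mU rf f0 d0 h; pose B : set T2 := [set z | `|z - p| <= d].
have mB : measurable B.
  apply: closed_measurable2; apply: (preimage_closed (f := fun z : R * R => `|z - p|) (D := [set t | t <= d])).
    by move=> z _; apply: cvg_norm; apply: cvgB; [exact: cvg_id|exact: cvg_cst].
  exact: closed_le.
have BU : B `<=` U by move=> x /h[].
have hB : leb2 B = ((2 * d) ^+ 2)%:E by exact: box_measure.
have mUB : measurable (U `\` B) by exact: measurableD.
rewrite -(setDUK BU) Rintegral_setU //; last 2 first.
- by rewrite setDUK.
- by rewrite disj_set2E setDE setIA setIAC setICr set0I.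
apply: (@le_trans _ _ (\int[leb2]_(x in B) f x)); last first.
  by rewrite lerDl; apply: Rintegral_ge0 => x -[Ux _]; exact: f0.
have -> : m * (2 * d) ^+ 2 = \int[leb2]_(x in B) m by rewrite Rintegral_cst // hB.
apply: le_Rintegral => //.
- by apply: (@rintegrable_bounded _ _ mB _ (fun=> m) `|m|) => //; rewrite hB ltry.
- exact: integrableS rf.
- by move=> x /h[].
Qed.

(** The derivative along [qr K] is the derivative in xi, which does not involve [c 2]. *)
Lemma cell_poly_grad_dot c x :
  (qr K).1 * (cell_poly_grad K c x).1 + (qr K).2 * (cell_poly_grad K c x).2 = c 1 + c 3 * qeta K x.
Proof.
rewrite /cell_poly_grad /dxi /deta; move: (qeta K x) (qxi K x) (qD_neq0 K) => Y X; rewrite /qD.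
move: (qr K) (qs K) => [r1 r2] [s1 s2]; rewrite /cross /= /GRing.scale /= => D1; field; exact: D1.
Qed.

Lemma cell_poly_grad_continuous c : continuous (fun x => (cell_poly_grad K c x).1) /\ continuous (fun x => (cell_poly_grad K c x).2).
Proof.
have h (p q : R) : continuous (fun x => (c 1 + c 3 * qeta K x) * p + (c 2 + c 3 * qxi K x) * q).
  move=> x; apply: cvgD; (apply: cvgM; last exact: cvg_cst); (apply: cvgD; first exact: cvg_cst);
    (apply: cvgM; first exact: cvg_cst); [exact: qeta_continuous|exact: qxi_continuous].
by split; exact: h.
Qed.

Lemma cell_poly_grad_le c x : cell_set K x -> let M := (`|c 1| + `|c 3| * 2) * (s / D) + (`|c 2| + `|c 3| * 2) * (r / D) in
  `|(cell_poly_grad K c x).1| <= M /\ `|(cell_poly_grad K c x).2| <= M.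
Proof.
move=> Kx M; have [x1 x2] := dxi_le; have [y1 y2] := deta_le.
have h (a b z : R) : `|z| <= 2 -> `|a + b * z| <= `|a| + `|b| * 2.
  by move=> hz; apply: le_trans (ler_normD _ _) _; rewrite normrM lerD2l ler_wpM2l.
have g (p q : R) : `|p| <= s / D -> `|q| <= r / D ->
    `|(c 1 + c 3 * qeta K x) * p + (c 2 + c 3 * qxi K x) * q| <= M.
  move=> hp hq; apply: le_trans (ler_normD _ _) _; rewrite !normrM.
  by apply: lerD; apply: ler_pM => //; apply: h; [exact: cell_qeta_le|exact: cell_qxi_le].
by split; rewrite /cell_poly_grad /= /GRing.scale /=; exact: g.
Qed.

Lemma interior_measurable : measurable (interior (cell_set K) : set T2).
Proof. by apply: open_measurable2; exact: open_interior. Qed.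

Lemma interior_finite : (leb2 (interior (cell_set K) : set T2) < +oo)%E.
Proof.
have [h _] := cell_measure; apply: (@le_lt_trans _ _ (leb2 (cell_set K : set T2))); last by rewrite h ltry.
apply: le_measure; rewrite ?inE; [exact: interior_measurable| |exact: interior_subset].
by apply: closed_measurable2; exact: cell_closed.
Qed.

Lemma cell_poly_pderiv c (v : R * R -> R) x i : (forall y, interior (cell_set K) y -> v y = cell_poly K c y) ->
  interior (cell_set K) x -> pderiv i v x = if i == 0 then (cell_poly_grad K c x).1 else (cell_poly_grad K c x).2.
Proof.
move=> vE ix; apply: (has_gradE_near (g := cell_poly K c)); last exact: has_grad_cell_poly.
by apply: filterS vE _; apply: open_nbhs_nbhs; split; first exact: open_interior.
Qed.

Let arith2 (c1 c3 Y : R) : 3 / 8 <= Y -> 0 <= c1 * c3 -> 9 / 64 * c3 ^+ 2 <= (c1 + c3 * Y) ^+ 2.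
Proof.
move=> hY h; have -> : (c1 + c3 * Y) ^+ 2 = c1 ^+ 2 + 2 * (c1 * c3 * Y) + c3 ^+ 2 * Y ^+ 2 by ring.
have h1 : 0 <= c1 * c3 * Y by rewrite mulr_ge0 //; lra.
have h2 := sqr_ge0 c1; have h3 : 9 / 64 * c3 ^+ 2 <= c3 ^+ 2 * Y ^+ 2.
  rewrite mulrC ler_wpM2l ?sqr_ge0 // (_ : 9 / 64 = (3 / 8) ^+ 2); last by field.
  by rewrite lerXn2r ?nnegrE //; lra.
lra.
Qed.

Let sign_half (e : R) : e = 1 \/ e = -1 -> `|e / 2| <= 1 / 2.
Proof. by case=> ->; rewrite ?mulN1r ?normrN ger0_norm; lra. Qed.

Let sign_half_le (e Y : R) : e = 1 \/ e = -1 -> `|Y - e / 2| <= 1 / 8 -> 3 / 8 <= e * Y.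
Proof. by rewrite ler_norml; case=> -> /andP[h1 h2]; lra. Qed.

Let sum_lt1 : 1 / 8 + (1 / 8 + 1 / 2) < 1 :> R. Proof. by lra. Qed.

(** On a box where eta is at least 3/8 in absolute value, with a well chosen sign,
    [|c 1 + c 3 * eta| >= 3/8 * |c 3|]. Dividing by the length of [qr K] bounds the gradient from
    below, and the area of the box does the rest. *)
Lemma cell_coef_le c (v : R * R -> R) : (forall y, interior (cell_set K) y -> v y = cell_poly K c y) ->
  9 / 64 * c 3 ^+ 2 / (8 * (sigma ^+ 2 + sigma)) ^+ 2 <=
    \int[leb2]_(x in interior (cell_set K)) (\sum_(i < 2) pderiv i v x ^+ 2).
Proof.
move=> vE; set U := interior (cell_set K); have mU : measurable (U : set T2) := interior_measurable.
pose g x := (cell_poly_grad K c x).1 ^+ 2 + (cell_poly_grad K c x).2 ^+ 2.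
have gE x : U x -> \sum_(i < 2) pderiv i v x ^+ 2 = g x.
  by move=> Ux; rewrite big_ord_recl big_ord1 !(cell_poly_pderiv _ vE Ux).
have -> : \int[leb2]_(x in U) (\sum_(i < 2) pderiv i v x ^+ 2) = \int[leb2]_(x in U) g x.
  by apply: eq_Rintegral => x; rewrite inE; exact: gE.
have [g1 g2] := cell_poly_grad_continuous c.
set M := (`|c 1| + `|c 3| * 2) * (s / D) + (`|c 2| + `|c 3| * 2) * (r / D).
have rg : rintegrable U g.
  apply: (rintegrable_bounded mU interior_finite (M := M ^+ 2 + M ^+ 2)).
    by apply: measurable_funD; apply: measurable_funX; exact: continuous_measurable2.
  move=> x /interior_subset Kx; have [h1 h2] := cell_poly_grad_le c Kx.
  by apply: le_trans (ler_normD _ _) _; apply: lerD; rewrite normrX lerXn2r ?nnegrE //; apply: le_trans h1.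
have [h1 h2 h3 sg] := shape_bounds; have rs0 : 0 < r + s by rewrite addr_gt0.
(* The partial derivatives of xi and eta are at most [s / D] and [r / D], so within max-norm
   distance [d] of a point these coordinates change by at most 1/8. *)
pose d := D / (16 * (r + s)).
have d0 : 0 < d by rewrite divr_gt0 // mulr_gt0.
have e3 : 0 <= c 1 * c 3 \/ 0 <= - c 1 * c 3.
  by rewrite mulNr oppr_ge0; case: (leP 0 (c 1 * c 3)) => h; [left|right; exact: ltW].
(* This sign prevents [c 1] and [c 3 * eta] from cancelling when eta is close to [e / 2]. Around [p]
   one has [|xi| + |eta| <= 3/4], so the box stays in the cell. *)
have [e [ee he]] : exists e : R, (e = 1 \/ e = -1) /\ 0 <= e * c 1 * c 3.
  by case: e3 => h; [exists 1|exists (-1)]; (split; [tauto|]); rewrite ?mul1r ?mulN1r.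
pose p := qcenter K + 0 *: qr K + (e / 2) *: qs K.
have box x : `|x - p| <= d -> U x /\ 9 / 64 * c 3 ^+ 2 / r ^+ 2 <= g x.
  move=> xp.
  have rd : 2 * (r / D) * d <= 1 / 8 /\ 2 * (s / D) * d <= 1 / 8.
    have -> : 2 * (r / D) * d = r / (8 * (r + s)) by rewrite /d; field; rewrite !lt0r_neq0.
    have -> : 2 * (s / D) * d = s / (8 * (r + s)) by rewrite /d; field; rewrite !lt0r_neq0.
    by have rp := r0; have sp := s0; split; rewrite ler_pdivrMr ?mulr_gt0 //; lra.
  have [x1 x2] := dxi_le; have [y1 y2] := deta_le.
  have near_p (u : R * R) (w q : R) : `|u.1| <= w -> `|u.2| <= w -> 2 * w * d <= 1 / 8 ->
      `|u.1 * x.1 + u.2 * x.2 + q - (u.1 * p.1 + u.2 * p.2 + q)| <= 1 / 8.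
    move=> hu1 hu2 hw; apply: le_trans hw; apply: le_trans (affine_lipschitz _ _ _ _ _) _.
    by apply: ler_pM => //; move: hu1 hu2; lra.
  have pX : qxi K p = 0 by exact: qxiE.
  have pY : qeta K p = e / 2 by exact: qetaE.
  have hX : `|qxi K x - qxi K p| <= 1 / 8 by rewrite !qxi_affine; exact: near_p x1 x2 rd.2.
  have hY : `|qeta K x - qeta K p| <= 1 / 8 by rewrite !qeta_affine; exact: near_p y1 y2 rd.1.
  rewrite pX in hX; rewrite pY in hY.
  split.
    apply: diamond_interior; rewrite subr0 in hX.
    have : `|qeta K x| <= 1 / 8 + 1 / 2.
      rewrite -[qeta K x](subrK (e / 2)); apply: le_trans (ler_normD _ _) _; apply: lerD => //.
      exact: sign_half.
    move=> hYh; apply: le_lt_trans (lerD hX hYh) _; exact: sum_lt1.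
  rewrite ler_pdivrMr ?exprn_gt0 //.
  apply: (@le_trans _ _ ((c 1 + c 3 * qeta K x) ^+ 2)).
    have := arith2 (sign_half_le ee hY) he; have -> // : e * c 1 + c 3 * (e * qeta K x) = e * (c 1 + c 3 * qeta K x) by ring.
    by rewrite exprMn (_ : e ^+ 2 = 1) ?mul1r //; case: ee => ->; rewrite ?sqrrN expr1n.
  rewrite -cell_poly_grad_dot -[X in X <= _](real_normK (num_real _)).
  have := dot_le_enorm (qr K) (cell_poly_grad K c x) => hd.
  have -> : g x * r ^+ 2 = (r * enorm (cell_poly_grad K c x)) ^+ 2 by rewrite exprMn [enorm (cell_poly_grad _ _ _) ^+ 2]enorm_sqr mulrC.
  by rewrite lerXn2r ?nnegrE // mulr_ge0 ?enorm_ge0.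
have g0 x : U x -> 0 <= g x by move=> _; rewrite addr_ge0 ?sqr_ge0.
apply: le_trans (box_integral_ge mU rg g0 (ltW d0) box).
have -> : 9 / 64 * c 3 ^+ 2 / r ^+ 2 * (2 * d) ^+ 2 = 9 / 64 * c 3 ^+ 2 * (D / (8 * (r * (r + s)))) ^+ 2.
  by rewrite /d; field; rewrite !lt0r_neq0.
apply: ler_wpM2l; first by rewrite mulr_ge0 ?sqr_ge0.
rewrite -exprVn lerXn2r ?nnegrE //.
- by rewrite invr_ge0 mulr_ge0 // addr_ge0 ?sqr_ge0 // ltW.
- by rewrite divr_ge0 ?mulr_ge0 ?(ltW D0) ?(ltW r0) ?(ltW rs0).
have a0 : 0 < sigma ^+ 2 + sigma by rewrite addr_gt0 ?exprn_gt0.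
rewrite ler_pdivlMr ?mulr_gt0 // mulrC ler_pdivrMr ?mulr_gt0 //.
have a1 : r ^+ 2 <= sigma * (r * s) by rewrite expr2 mulrCA ler_wpM2l // ltW.
have a3 : sigma * (r * s) <= sigma * (sigma * D) by rewrite ler_wpM2l // ltW.
have -> : r * (r + s) = r ^+ 2 + r * s by ring.
by move: a1 a3 h1; move: (r ^+ 2) (r * s) => rr rs; lra.
Qed.

End Cell.
End CellEstimates.

(** * The glued function *)

Section GluedFunction.
Context {R : realType}.
Implicit Types x y : R * R.
Local Notation T2 := (measurableTypeR R * measurableTypeR R)%type.
Variables (Omega : set (R * R)) (J : grid R) (r : R).
Hypotheses (Omega_open : open Omega) (Omega_reg : interior (closure Omega) `<=` Omega).
Hypothesis Omega_le : forall x, Omega x -> `|x| <= r.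
Hypothesis J_grid : is_grid_of Omega J.
Local Notation K := (cell J).
Local Notation KI k := (interior (cell_set (K k))).
Local Notation V := (vertices J).

Let mO : measurable (Omega : set T2). Proof. exact: open_measurable2. Qed.
Let fO : (leb2 (Omega : set T2) < +oo)%E. Proof. exact: bounded_finite Omega_le mO. Qed.

Lemma interior_notin_vertices k x : KI k x -> x \notin V.
Proof.
move=> ix; apply/negP => /allpairsP[[l i] [_ _ /= xE]].
have lx : cell_set (K l) x by apply: (@edge_cell _ _ i); apply/edgeP; exists 0; rewrite subr0 scale1r scale0r addr0.
have kl := interior_cell_disjoint J_grid ix lx; rewrite kl in ix.
by have := interior_half_plane ix i; rewrite xE half_plane_start ltxx.
Qed.

(** For the Lipschitz extension to vanish at all points off [Omega], boundary vertices included,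
    these must be limits of points off [Omega] that are not vertices. *)
Lemma exterior_near x (e : R) : ~ Omega x -> 0 < e -> exists y, [/\ ~ Omega y, y \notin V & `|x - y| < e].
Proof.
move=> nx e0; have e20 : 0 < e / 2 by rewrite divr_gt0.
have [y xy ny] : exists2 y, `|x - y| < e / 2 & ~ closure Omega y.
  apply: contrapT => h; apply: nx; apply: Omega_reg.
  apply: (filterS (P := ball x (e / 2))); last exact: nbhsx_ballx.
  move=> z hz; apply: contrapT => nz; apply: h; exists z => //.
  by move: hz; rewrite -ball_normE.
have : nbhs y (~` closure Omega).
  by apply: open_nbhs_nbhs; split => //; apply: closed_openC; exact: closed_closure.
move=> /nbhs_dist_ball[d d0 hd].
have m0 : 0 < Num.min d (e / 2) by rewrite lt_min d0 e20.
have [t /andP[t0 tm] tV] := small_avoiding [seq v.1 - y.1 | v <- V] m0.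
have [td te] : t < d /\ t < e / 2 by move: tm; rewrite lt_min => /andP[].
have nt : `|(t, 0) : R * R| = t by rewrite prod_normE /= normr0 gtr0_norm // max_l // ltW.
exists (y + (t, 0)); split.
- have /hd h : `|y - (y + (t, 0))| < d by rewrite opprD addrA subrr sub0r normrN nt.
  by move=> /subset_closure.
- apply/negP => h; move/negP: tV; apply; apply/mapP; exists (y + (t, 0)) => //=.
  by rewrite addrC addKr.
- have -> : x - (y + (t, 0)) = (x - y) - (t, 0) by rewrite opprD addrA.
  apply: le_lt_trans (ler_normB _ _) _; rewrite nt; lra.
Qed.

Variable c : 'I_(ncells J) -> 'I_4 -> R.
Hypothesis c_compat : forall k l i j, k != l -> edge (K k) i = edge (K l) j ->
  cell_poly (K k) (c k) (vtx (K k) i) = cell_poly (K l) (c l) (vtx (K k) i) /\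
  cell_poly (K k) (c k) (vtx (K k) (i + 1)) = cell_poly (K l) (c l) (vtx (K k) (i + 1)).
Local Notation w k := (cell_fun (K k) (c k)).

Lemma cell_fun_agree k l x : cell_set (K k) x -> cell_set (K l) x -> x \notin V -> w k x = w l x.
Proof.
move=> kx lx xV; have [->//|kl] := eqVneq k l.
have [i [j [e ex _]]] := shared_edge J_grid kl kx lx xV.
have [h1 h2] := c_compat kl e; move: ex => /edgeP[t [t0 t1 xE]].
rewrite xE cell_fun_edge // h1 h2; have [[-> ->]|[-> ->]] := edge_endpoints e.
  by rewrite cell_fun_edge.
have t1' : 0 <= 1 - t by rewrite subr_ge0.
have t0' : 1 - t <= 1 by rewrite lerBlDr lerDl.
have -> : (1 - t) *: vtx (K l) (j + 1) + t *: vtx (K l) j =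
    (1 - (1 - t)) *: vtx (K l) j + (1 - t) *: vtx (K l) (j + 1) by rewrite opprB addrC subrKC addrC.
by rewrite cell_fun_edge // opprB addrC subrKC addrC.
Qed.

Lemma cell_fun_boundary k x :
  (forall i, boundary_edge Omega (K k) i ->
    cell_poly (K k) (c k) (vtx (K k) i) = 0 /\ cell_poly (K k) (c k) (vtx (K k) (i + 1)) = 0) ->
  cell_set (K k) x -> ~ Omega x -> x \notin V -> w k x = 0.
Proof.
move=> h kx nx xV; have [i /edgeP[t [t0 t1 ->]] b] := boundary_cell Omega_open Omega_reg J_grid kx nx xV.
by have [h1 h2] := h i b; rewrite cell_fun_edge // h1 h2 !mulr0 addr0.
Qed.

(** The indicators of the cell interiors make measurability immediate. The values on the edges are
    0, which is irrelevant under integrals; the Lipschitz representative comes from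
    [glued_lipschitz]. *)
Definition glued_fun x : R := \sum_k \1_(KI k) x * w k x.

Definition glued_grad (i : 'I_2) x : R := \sum_k \1_(KI k) x *
  (if i == 0 then (cell_fun_grad (K k) (c k) x).1 else (cell_fun_grad (K k) (c k) x).2).

Lemma interior_sumE (F : 'I_(ncells J) -> R) k x : KI k x ->
  \sum_l \1_(KI l) x * F l = F k.
Proof.
move=> ix; rewrite (bigD1 k) //= indicE mem_set // mul1r big1 ?addr0 // => l lk.
rewrite indicE memNset ?mul0r // => /interior_subset lx; move/eqP: lk; apply.
by rewrite (interior_cell_disjoint J_grid ix lx).
Qed.

Lemma interior_sum_le (F : 'I_(ncells J) -> R) (M : 'I_(ncells J) -> R) x :
  (forall k, 0 <= M k) -> (forall k, KI k x -> `|F k| <= M k) ->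
  `|\sum_l \1_(KI l) x * F l| <= \sum_l M l.
Proof.
move=> M0 h; apply: le_trans (ler_norm_sum _ _ _) _; apply: ler_sum => l _.
rewrite indicE; have [/set_mem ix|_] := boolP (x \in _); last by rewrite mul0r normr0.
by rewrite mul1r; exact: h.
Qed.

Lemma interior_sum_measurable (F : 'I_(ncells J) -> R * R -> R) :
  (forall k, measurable_fun (Omega : set T2) (F k : T2 -> R)) ->
  measurable_fun (Omega : set T2) (fun x => \sum_k \1_(KI k) x * F k x).
Proof.
move=> h; apply: measurable_sum => k; apply: measurable_funM => //.
by apply: measurable_indic; apply: open_measurable2; exact: open_interior.
Qed.

Lemma cell_fun_continuous k : continuous (w k).
Proof.
move=> x; apply: cvgD; first exact: cell_poly_continuous.
apply: cvgM; first exact: cvg_cst.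
pose F i y := kap (ca (K k)) (cb (K k)) i / rho (ca (K k)) (cb (K k)) i *
    (pos (lam (ca (K k)) (cb (K k)) i (qxi (K k) y) (qeta (K k) y)) *
     pos (mu (ca (K k)) (cb (K k)) i (qxi (K k) y) (qeta (K k) y))).
have h i : continuous (F i).
  move=> y; apply: cvgM; first exact: cvg_cst.
  by apply: cvgM; [exact: (pos_continuous (@lam_continuous _ (K k) i))|exact: (pos_continuous (@mu_continuous _ (K k) i))].
have -> : cell_bubbles (K k) = fun y => F 0 y + F 1 y + F 2 y + F 3 y.
  by apply/funext => y; rewrite /cell_bubbles /bubbles sum4E.
by apply: cvgD; [apply: cvgD; [apply: cvgD|]|]; exact: h.
Qed.

Lemma glued_fun_measurable : measurable_fun (Omega : set T2) (glued_fun : T2 -> R).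
Proof.
by apply: interior_sum_measurable => k; apply: continuous_measurable2 => //; exact: cell_fun_continuous.
Qed.

Lemma glued_grad_measurable i : measurable_fun (Omega : set T2) (glued_grad i : T2 -> R).
Proof.
apply: interior_sum_measurable => k; have [h1 h2] := cell_fun_grad_measurable (K k) (c k) mO.
by case: (i == 0).
Qed.

Lemma glued_fun_bounded : exists2 M : R, 0 <= M & forall x, `|glued_fun x| <= M.
Proof.
have /choice[M hM] (k : 'I_(ncells J)) : exists M, 0 <= M /\ forall x, cell_set (K k) x -> `|w k x| <= M.
  by have [L [L0 [_ hL]]] := lip_bounded_cell_fun (K k) (c k); exists L.
exists (\sum_k M k); first by apply: sumr_ge0 => k _; have [] := hM k.
move=> x; apply: interior_sum_le => k; have [M0 h] := hM k; first by [].
by move=> /interior_subset; exact: h.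
Qed.

Lemma glued_grad_bounded i : exists2 M : R, 0 <= M & forall x, `|glued_grad i x| <= M.
Proof.
have /choice[M hM] (k : 'I_(ncells J)) : exists M, 0 <= M /\ forall x, cell_set (K k) x ->
    `|if i == 0 then (cell_fun_grad (K k) (c k) x).1 else (cell_fun_grad (K k) (c k) x).2| <= M.
  have [M1 h1] : exists M, forall x, cell_set (K k) x ->
      `|(cell_poly_grad (K k) (c k) x).1| <= M /\ `|(cell_poly_grad (K k) (c k) x).2| <= M.
    by eexists => x Kx; exact: cell_poly_grad_le Kx.
  have [M2 h2] : exists M, forall x, cell_set (K k) x ->
      `|(cell_bubbles_grad (K k) x).1| <= M /\ `|(cell_bubbles_grad (K k) x).2| <= M.
    by eexists => x Kx; exact: cell_bubbles_grad_bound Kx.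
  have M10 : 0 <= M1 by have [h _] := h1 _ (cell_center (K k)); apply: le_trans h.
  have M20 : 0 <= M2 by have [h _] := h2 _ (cell_center (K k)); apply: le_trans h.
  exists (M1 + `|c k 3| * M2); split; first by rewrite addr_ge0 // mulr_ge0.
  move=> x Kx; have [h3 h4] := h1 x Kx; have [h5 h6] := h2 x Kx; case: (i == 0); rewrite /cell_fun_grad /= /GRing.scale /=;
    apply: le_trans (ler_normD _ _) _; apply: lerD => //; rewrite normrM; exact: ler_wpM2l.
exists (\sum_k M k); first by apply: sumr_ge0 => k _; have [] := hM k.
move=> x; apply: interior_sum_le => k; have [M0 h] := hM k; first by [].
by move=> /interior_subset; exact: h.
Qed.

Section Cutoff.
Variable phi : R * R -> R.
Hypothesis phi_lip : lip_bounded setT phi.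
Hypothesis phi_boundary : forall k x, cell_set (K k) x -> ~ Omega x -> x \notin V -> phi x * w k x = 0.

(** The factor [phi] is the constant 1 if [w] vanishes on the boundary edges, and a test function
    otherwise; either way the product vanishes where cells touch the complement of [Omega], away
    from vertices. *)
Lemma glued_lipschitz : exists (L : R) (u : R * R -> R), [/\ 0 <= L,
  forall x y, `|u x - u y| <= L * `|x - y|, forall x, ~ Omega x -> u x = 0 &
  forall k x, KI k x -> u x = phi x * w k x].
Proof.
have /choice[L hL] (k : 'I_(ncells J)) : exists L, 0 <= L /\
    forall x y, cell_set (K k) x -> cell_set (K k) y -> `|phi x * w k x - phi y * w k y| <= L * `|x - y|.
  have pk : lip_bounded (cell_set (K k)) phi.
    by have [L [L0 [h1 h2]]] := phi_lip; exists L; split=> //; split=> [x y _ _|x _]; [exact: h1|exact: h2].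
  by have [L [L0 [hL _]]] := lip_boundedM pk (lip_bounded_cell_fun (K k) (c k)); exists L.
pose u0 x := if [pick k | `[< cell_set (K k) x >]] is Some k then phi x * w k x else 0.
have u0E k x : cell_set (K k) x -> x \notin V -> u0 x = phi x * w k x.
  move=> kx xV; rewrite /u0; case: pickP => [l /asboolP lx|/(_ k)/asboolP//].
  by rewrite (cell_fun_agree lx kx xV).
have u0O x : ~ Omega x -> x \notin V -> u0 x = 0.
  by move=> nx xV; rewrite /u0; case: pickP => // k /asboolP kx; exact: phi_boundary.
(* The plane is covered by the cells and, as one more closed set, the complement of [Omega]; so a
   segment between two cells may leave [Omega] and come back. *)
pose F n := if insub n is Some k then cell_set (K k) else ~` Omega.
have FK (k : 'I_(ncells J)) : F k = cell_set (K k).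
  by rewrite /F insubT ?ltn_ord // => h; congr (cell_set (K _)); exact/val_inj.
have FO : F (ncells J) = ~` Omega by rewrite /F insubN // ltnn.
have L0 : 0 <= \sum_k L k by apply: sumr_ge0 => k _; have [] := hL k.
have cF n : closed (F n).
  by rewrite /F; case: insub => [k|]; [exact: cell_closed|exact: open_closedC].
have covF x : exists2 n, (n < (ncells J).+1)%N & F n x.
  have [Ox|nx] := pselect (Omega x); last by exists (ncells J) => //; rewrite FO.
  by have [k kx] := cover_cell J_grid Ox; exists k; rewrite ?FK // ltnS ltnW.
have lipF n x y : (n < (ncells J).+1)%N -> F n x -> F n y -> x \notin V -> y \notin V ->
    `|u0 x - u0 y| <= (\sum_k L k) * `|x - y|.
  move=> _; rewrite /F; case: insub => [k|] Fx Fy xV yV; last first.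
    by rewrite !u0O // subrr normr0 mulr_ge0.
  rewrite (u0E k) // (u0E k y) //; apply: le_trans ((hL k).2 x y Fx Fy) _; apply: ler_wpM2r => //.
  by rewrite (bigD1 k) //= lerDl; apply: sumr_ge0 => l _; have [] := hL l.
have lip0 := glue_lipschitz L0 cF covF lipF.
have [u uE uL] := lipschitz_extension L0 lip0.
exists (\sum_k L k), u; split => //; last first.
  by move=> k x ix; have xV := interior_notin_vertices ix; rewrite uE // (u0E k) //; exact: interior_subset.
(* At vertices the extension was not prescribed; there it is zero by continuity, from nearby points
   supplied by [exterior_near]. *)
move=> x nx; apply/eqP; rewrite -normr_le0; apply/ler_addgt0Pr => e e0; rewrite add0r.
have [y [ny yV xy]] := exterior_near nx (divr_gt0 e0 (ltr_wpDr L0 ltr01)).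
have uy : u y = 0 by rewrite uE // u0O.
have := uL x y; rewrite uy subr0 => h; apply: le_trans h _.
apply: (@le_trans _ _ ((1 + \sum_k L k) * `|x - y|)); first by rewrite ler_wpM2r // lerDr.
by rewrite mulrC -ler_pdivlMr ?ltW // ltr_wpDr.
Qed.

Lemma glued_weak_identity (dphi : 'I_2 -> R * R -> R) f g i :
  (forall x, has_grad phi x (dphi 0 x, dphi 1 x)) -> continuous (dphi i) ->
  L2 Omega f -> L2 Omega g -> is_weak_pderiv Omega i f g ->
  \int[leb2]_(x in Omega) (f x * (phi x * glued_grad i x + dphi i x * glued_fun x)) =
  - \int[leb2]_(x in Omega) (g x * (phi x * glued_fun x)).
Proof.
move=> hphi cdphi f2 g2 fg.
have [L [u [L0 uL u0 uE]]] := glued_lipschitz.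
have [N1 [mN1 N10 hN1 _]] := cells_null J_grid.
have [N2 [mN2 N20 hN2]] := @null_cover _ _ (enum [set: 'I_(ncells J) * 'I_4]%SET)
  (fun p => spoke (K p.1) p.2) (fun p => spoke_line (K p.1) p.2).
(* Off the edges and the spokes [w] is differentiable, with an explicit gradient. *)
pose N := N1 `|` N2; have mN : measurable N by exact: measurableU.
have N0 : leb2 N = 0%E by apply/null_set_setU.
pose G j x := phi x * glued_grad j x + dphi j x * glued_fun x.
have cphi : continuous phi by apply: has_grad_continuous => x; exists (dphi 0 x, dphi 1 x).
have uG x : Omega x -> ~ N x -> has_grad u x (G 0 x, G 1 x).
  move=> Ox nN; have [k ik] : exists k, KI k x by apply: hN1 => // h; apply: nN; left.
  have ns i' : ~ spoke (K k) i' x.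
    by move=> h; apply: nN; right; apply: (hN2 (k, i')) => //; rewrite mem_enum inE.
  apply: has_grad_near (has_grad_eq (has_gradM (hphi x) (has_grad_cell_fun (c k) ns)) _).
    have : nbhs x (KI k) by apply: open_nbhs_nbhs; split => //; exact: open_interior.
    by apply: filterS => y iy; rewrite (uE k).
  rewrite /G /glued_fun /glued_grad !(interior_sumE _ ik); move: (cell_fun_grad _ _ _) => [a b].
  by congr pair; rewrite /= /GRing.scale /=; ring.
have mG : measurable_fun (Omega : set T2) (G i).
  apply: measurable_funD; apply: measurable_funM; try exact: continuous_measurable2.
    exact: glued_grad_measurable.
  exact: glued_fun_measurable.
have -> := weak_pderiv_lipschitz Omega_open Omega_le f2 g2 fg L0 uL u0 mN N0 uG mG.
have [M M0 hM] := glued_fun_bounded; have [P [P0 [_ hP]]] := phi_lip.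
congr (- _); apply: (ae_eq_Rintegral mO mN N0).
- apply: (L2_mul mO g2); apply: (L2_bounded mO fO (M := `|u 0| + L * r)).
    apply: continuous_measurable2 => // x; apply/cvgrPdist_lt => e e0.
    have d0 : 0 < e / (1 + L) by rewrite divr_gt0 // ltr_wpDr.
    near=> y; apply: le_lt_trans (uL x y) _.
    apply: (@le_lt_trans _ _ ((1 + L) * `|x - y|)); first by rewrite ler_wpM2r // lerDr.
    by rewrite mulrC -ltr_pdivlMr ?ltr_wpDr //; near: y; exact: (nbhsx_ballx x (PosNum d0)).
  move=> x Ox; rewrite -[u x](subrK (u 0)) addrC; apply: le_trans (ler_normD _ _) _; rewrite lerD2l.
  apply: le_trans (uL _ _) _; rewrite subr0 ler_wpM2l //; exact: Omega_le.
- apply: (L2_mul mO g2); apply: (L2_bounded mO fO (M := P * M)).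
    by apply: measurable_funM; [exact: continuous_measurable2|exact: glued_fun_measurable].
  by move=> x _; rewrite normrM; apply: ler_pM => //; exact: hP.
move=> x Ox nN; have [k ik] : exists k, KI k x by apply: hN1 => // h; apply: nN; left.
by rewrite (uE k) // /glued_fun (interior_sumE _ ik).
Unshelve. all: by end_near. Qed.

End Cutoff.
End GluedFunction.

(** * The consistency error *)

Section Consistency.
Context {R : realType}.
Implicit Types x y : R * R.
Local Notation T2 := (measurableTypeR R * measurableTypeR R)%type.
Variables (Omega : set (R * R)) (J : grid R) (r : R).
Hypotheses (Omega_open : open Omega) (Omega_reg : interior (closure Omega) `<=` Omega).
Hypothesis Omega_le : forall x, Omega x -> `|x| <= r.
Hypothesis J_grid : is_grid_of Omega J.
Local Notation K := (cell J).
Local Notation KI k := (interior (cell_set (K k))).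
Local Notation V := (vertices J).
Local Notation comp i u := (if i == 0 then u.1 else u.2).

Let mO : measurable (Omega : set T2). Proof. exact: open_measurable2. Qed.
Let fO : (leb2 (Omega : set T2) < +oo)%E. Proof. exact: bounded_finite Omega_le mO. Qed.

Variable c : 'I_(ncells J) -> 'I_4 -> R.
Hypothesis c_compat : forall k l i j, k != l -> edge (K k) i = edge (K l) j ->
  cell_poly (K k) (c k) (vtx (K k) i) = cell_poly (K l) (c l) (vtx (K k) i) /\
  cell_poly (K k) (c k) (vtx (K k) (i + 1)) = cell_poly (K l) (c l) (vtx (K k) (i + 1)).
Local Notation w := (glued_fun c).
Local Notation G := (glued_grad c).

Let L2w : L2 Omega w.
Proof.
have [M _ hM] := glued_fun_bounded c.
by apply: (L2_bounded mO fO (M := M)) => //; exact: glued_fun_measurable.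
Qed.

Let L2G i : L2 Omega (G i).
Proof.
have [M _ hM] := glued_grad_bounded c i.
by apply: (L2_bounded mO fO (M := M)) => //; exact: glued_grad_measurable.
Qed.

Lemma glued_identity_H1 f i : H1 Omega f ->
  (forall k j, boundary_edge Omega (K k) j ->
    cell_poly (K k) (c k) (vtx (K k) j) = 0 /\ cell_poly (K k) (c k) (vtx (K k) (j + 1)) = 0) ->
  \int[leb2]_(x in Omega) (f x * G i x) + \int[leb2]_(x in Omega) (wderiv Omega i f x * w x) = 0.
Proof.
move=> Hf c0; have [g2 fg] := wderivP i Hf.
have h := @glued_weak_identity _ _ _ _ Omega_open Omega_reg Omega_le J_grid c c_compat (fun=> 1)
  (lip_bounded_cst setT 1) _ (fun _ _ => 0) f _ i _ _ Hf.1 g2 fg.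
have -> : \int[leb2]_(x in Omega) (f x * G i x) = \int[leb2]_(x in Omega) (f x * (1 * G i x + 0 * w x)).
  by apply: eq_Rintegral => x _; rewrite mul1r mul0r addr0.
have -> : \int[leb2]_(x in Omega) (wderiv Omega i f x * w x) =
    \int[leb2]_(x in Omega) (wderiv Omega i f x * (1 * w x)).
  by apply: eq_Rintegral => x _; rewrite mul1r.
rewrite h ?addNr //.
- move=> k x kx nx xV; rewrite mul1r.
  exact: (cell_fun_boundary Omega_open Omega_reg J_grid (c0 k) kx nx xV).
- by move=> x; exact: has_grad_cst.
- by move=> x; exact: cvg_cst.
Qed.

(** By [H10_weak_identity] a test function [phi] may replace [f]. Then [phi * w] vanishes off
    [Omega] whatever [w] does on the boundary, and the identity is the Green formula for the field
    1. *)
Lemma glued_identity_H10 f i : H10 Omega f ->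
  \int[leb2]_(x in Omega) (f x * G i x) + \int[leb2]_(x in Omega) (wderiv Omega i f x * w x) = 0.
Proof.
move=> Hf; have [M M0 hM] := glued_fun_bounded c; have [P P0 hP] := glued_grad_bounded c i.
have [N [mN N0 hN _]] := cells_null J_grid.
apply: (H10_weak_identity Omega_open Omega_le (M := P) Hf M0 (fun x _ => hM x) _ mN N0) => //.
- exact: glued_fun_measurable.
- move=> x Ox nN; have [k ik] := hN x Ox nN.
  have wx : w x = cell_fun (K k) (c k) x by rewrite /glued_fun (interior_sumE J_grid _ ik).
  have cw : cell_fun (K k) (c k) y @[y --> x] --> w x by rewrite wx; exact: cell_fun_continuous.
  apply: cvg_trans cw; apply: near_eq_cvg.
  have : nbhs x (KI k) by apply: open_nbhs_nbhs; split => //; exact: open_interior.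
  by apply: filterS => y iy; rewrite /glued_fun (interior_sumE J_grid _ iy).
- exact: glued_grad_measurable.
move=> phi t; have [s _ _] := t.
have pL : lip_bounded setT phi.
  have [L L0 hL] := test_fun_lipschitz t; have [Q Q0 hQ] := test_fun_bounded t.
  exists (L + Q); split; first exact: addr_ge0.
  split=> [x y _ _|x _]; last by apply: le_trans (hQ x) _; rewrite lerDr.
  by apply: le_trans (hL x y) _; rewrite ler_wpM2r // lerDl.
have phi0 k x : cell_set (K k) x -> ~ Omega x -> x \notin V -> phi x * cell_fun (K k) (c k) x = 0.
  by move=> _ nx _; rewrite (test_fun_out t nx) mul0r.
have hphi x : has_grad phi x (pderiv 0 phi x, pderiv 1 phi x).
  by apply: differentiable_has_grad; exact: smooth_differentiable.
have := glued_weak_identity (dphi := fun j => pderiv j phi) Omega_open Omega_reg Omega_le J_grid c_compat pL phi0 hphi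
  (smooth_pderiv_continuous s) (L2_cst mO fO 1) (L2_cst mO fO 0) (cst1_weak_pderiv Omega_open Omega_le i).
have -> : \int[leb2]_(x in Omega) (0 * (phi x * w x)) = 0.
  rewrite (_ : \int[leb2]_(x in Omega) (0 * (phi x * w x)) = \int[leb2]_(x in Omega) (0 : R)).
    by rewrite Rintegral_cst // mul0r.
  by apply: eq_Rintegral => x _; rewrite mul0r.
rewrite oppr0 => <-; rewrite -RintegralD //.
- by apply: eq_Rintegral => x _; rewrite mul1r.
- exact: L2_mul (test_fun_L2 Omega_open Omega_le t) (L2G i).
- exact: L2_mul (test_fun_pderiv_L2 Omega_open Omega_le i t) L2w.
Qed.

Lemma cells_partition f : rintegrable (Omega : set T2) f ->
  \int[leb2]_(x in Omega) f x = \sum_k \int[leb2]_(x in KI k) f x.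
Proof.
move=> rf; have [N [mN N0 hN _]] := cells_null J_grid.
have mU k : measurable (KI k : set T2) by exact: interior_measurable.
apply: Rintegral_partition => //.
- by move=> k; exact: (interior_cell Omega_reg J_grid).
- by move=> k l x kx /interior_subset lx; exact: (interior_cell_disjoint J_grid kx lx).
apply/eqP; rewrite eq_le measure_ge0 andbT -N0; apply: le_measure; rewrite ?inE //.
  apply: measurableD => //; apply: open_measurable2.
  by apply: bigcup_open => k _; exact: open_interior.
move=> x [Ox nx]; apply: contrapT => nN; by have [k ik] := hN x Ox nN; apply: nx; exists k.
Qed.

Lemma interior_sum_sqnorm (F : 'I_(ncells J) -> R * R -> R) (A : R) : 0 <= A ->
  (forall k, measurable_fun (Omega : set T2) (F k : T2 -> R)) ->
  (forall k x, KI k x -> `|F k x| <= A * `|c k 3|) ->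
  let f x := \sum_k \1_(KI k) x * F k x in
  L2 Omega f /\ sqnorm_L2 Omega f <= (A * (2 * mesh_size J)) ^+ 2 * \sum_k c k 3 ^+ 2.
Proof.
move=> A0 mF hF f.
have f2 : L2 Omega f.
  apply: (L2_bounded mO fO (M := \sum_k (A * `|c k 3|))); first exact: interior_sum_measurable.
  by move=> x _; apply: interior_sum_le => k; [rewrite mulr_ge0|exact: hF].
split => //; rewrite /sqnorm_L2 cells_partition; last exact: f2.2.
rewrite mulr_sumr; apply: ler_sum => k _; set U := KI k.
have mU : measurable (U : set T2) := interior_measurable (K k).
have UO : U `<=` Omega by exact: (interior_cell Omega_reg J_grid).
have fU := interior_finite (K k).
apply: (@le_trans _ _ (\int[leb2]_(x in U) ((A * `|c k 3|) ^+ 2))).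
  apply: le_Rintegral => //.
  - by apply: integrableS f2.2.
  - by apply: (rintegrable_bounded mU fU (M := `|(A * `|c k 3|) ^+ 2|)) => //; exact: measurable_cst.
  move=> x Ux; rewrite /f (interior_sumE J_grid (fun k => F k x) Ux) -[F k x ^+ 2](real_normK (num_real _)).
  by rewrite lerXn2r ?nnegrE ?hF // mulr_ge0.
rewrite Rintegral_cst // mulrC [in leRHS]exprMn [in leLHS]exprMn real_normK ?num_real //.
have [h1 h2] := cell_measure (K k).
have mU' : fine (leb2 (U : set T2)) <= (2 * mesh_size J) ^+ 2.
  apply: (@le_trans _ _ ((2 * diam (cell_set (K k))) ^+ 2)).
    apply: le_trans h2; rewrite -lee_fin -h1 fineK ?ge0_fin_numE ?measure_ge0 //.
    apply: le_measure; rewrite ?inE //; last exact: interior_subset.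
    by apply: closed_measurable2; exact: cell_closed.
  have d0 := cell_diam_ge0 (K k).
  have dm : diam (cell_set (K k)) <= mesh_size J by exact: (le_bigmax _ (fun k => diam (cell_set (K k)))).
  by rewrite lerXn2r ?nnegrE ?mulr_ge0 // ?ler_wpM2l // (le_trans d0).
by rewrite mulrA [_ * A ^+ 2]mulrC ler_wpM2r ?sqr_ge0 // ler_wpM2l ?sqr_ge0.
Qed.

Variable v : R * R -> R.
Hypothesis v_L2 : L2 Omega v.
Hypothesis vE : forall k x, KI k x -> v x = cell_poly (K k) (c k) x.

(** Here [g] and [b] represent the gradient of [w - v] and [w - v] itself; prescribing them on the
    cell interiors is enough, as the rest of [Omega] is a null set. *)
Lemma consistency_bubbles (zeta : 'I_2 -> R * R -> R) : (forall i, H1 Omega (zeta i)) ->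
  (forall i, \int[leb2]_(x in Omega) (zeta i x * G i x) +
    \int[leb2]_(x in Omega) (wderiv Omega i (zeta i) x * w x) = 0) ->
  forall (g : 'I_2 -> R * R -> R) b, (forall i, L2 Omega (g i)) -> L2 Omega b ->
  (forall i k x, KI k x -> g i x = comp i (cell_fun_grad (K k) (c k) x) - comp i (cell_poly_grad (K k) (c k) x)) ->
  (forall k x, KI k x -> b x = cell_fun (K k) (c k) x - cell_poly (K k) (c k) x) ->
  consistency Omega J zeta v = - \sum_i (\int[leb2]_(x in Omega) (zeta i x * g i x) +
    \int[leb2]_(x in Omega) (wderiv Omega i (zeta i) x * b x)).
Proof.
move=> Hz h0 g b g2 b2 gE bE.
have [N [mN N0 hN _]] := cells_null J_grid.
have dz i : L2 Omega (wderiv Omega i (zeta i)) := (wderivP i (Hz i)).1.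
have rG i := L2_mul mO (Hz i).1 (L2G i).
have rg i := L2_mul mO (Hz i).1 (g2 i).
have rB i := L2_mul mO (Hz i).1 (L2B mO (L2G i) (g2 i)).
have first_part : \sum_(k < ncells J) \int[leb2]_(x in KI k) (\sum_(i < 2) zeta i x * pderiv i v x) =
    \sum_i (\int[leb2]_(x in Omega) (zeta i x * G i x) - \int[leb2]_(x in Omega) (zeta i x * g i x)).
  transitivity (\int[leb2]_(x in Omega) (\sum_i zeta i x * (G i x - g i x))); last first.
    rewrite Rintegral_sum //; apply: eq_bigr => i _; rewrite -(RintegralB mO (rG i) (rg i)).
    by apply: eq_Rintegral => x _; rewrite mulrBr.
  rewrite (cells_partition (f := fun x => \sum_i zeta i x * (G i x - g i x))); last exact: rintegrable_sum.
  apply: eq_bigr => k _; apply: eq_Rintegral => x; rewrite inE => ix; apply: eq_bigr => i _; congr (_ * _).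
  by rewrite (cell_poly_pderiv i (@vE k) ix) /glued_grad (interior_sumE J_grid _ ix) (gE i k) // subKr.
have second_part : \int[leb2]_(x in Omega) (wdiv Omega zeta x * v x) =
    \sum_i (\int[leb2]_(x in Omega) (wderiv Omega i (zeta i) x * w x) -
      \int[leb2]_(x in Omega) (wderiv Omega i (zeta i) x * b x)).
  rewrite /wdiv; transitivity (\int[leb2]_(x in Omega) (\sum_i wderiv Omega i (zeta i) x * v x)).
    by apply: eq_Rintegral => x _; rewrite mulr_suml.
  rewrite Rintegral_sum //; last by move=> i; exact: L2_mul.
  apply: eq_bigr => i _; rewrite -(RintegralB mO (L2_mul mO (dz i) L2w) (L2_mul mO (dz i) b2)).
  apply: (ae_eq_Rintegral mO mN N0); first exact: L2_mul.
    by have := L2_mul mO (dz i) (L2B mO L2w b2); apply: eq_integrable => // x _; rewrite mulrBr.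
  move=> x Ox nN; have [k ik] := hN x Ox nN; rewrite -mulrBr; congr (_ * _).
  by rewrite (vE ik) /glued_fun (interior_sumE J_grid _ ik) (bE k) // subKr.
rewrite /consistency first_part second_part -big_split -sumrN /=; apply: eq_bigr => i _.
by rewrite addrACA h0 add0r -opprD.
Qed.

Let sqrt_le (s t : R) : 0 <= t -> s <= t ^+ 2 -> Num.sqrt s <= t.
Proof. by move=> t0 h; rewrite -[leRHS](ger0_norm t0) -sqrtr_sqr ler_wsqrtr. Qed.

Variables (sigma kappa : R).
Hypothesis sigma_gt0 : 0 < sigma.
Hypothesis J_shape : forall k, shape_number (K k) <= sigma.
Hypothesis J_par : forall k, diag_dist (K k) <= kappa * diam (cell_set (K k)) ^+ 2.

Definition coercivity : R := 9 / 64 / (8 * (sigma ^+ 2 + sigma)) ^+ 2.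
(** The sum of the gradient bound and of the bound 32 for the values, so that one constant serves
    for both terms of the error. *)
Definition bubble_bound : R := 256 * `|kappa| * (2 * (sigma ^+ 2 + sigma)) ^+ 2 + 32.
Local Notation q := coercivity.
Local Notation A := bubble_bound.

Let q0 : 0 < q.
Proof. by rewrite /coercivity divr_gt0 ?exprn_gt0 ?mulr_gt0 // addr_gt0 ?exprn_gt0. Qed.

Let A_ge32 : 32 <= A.
Proof.
rewrite /bubble_bound lerDr; apply: mulr_ge0; last exact: sqr_ge0.
by apply: mulr_ge0; [exact: ler0n|exact: normr_ge0].
Qed.

Let A_ge : 256 * `|kappa| * (2 * (sigma ^+ 2 + sigma)) ^+ 2 <= A.
Proof. by rewrite /bubble_bound lerDl. Qed.

Let A0 : 0 <= A. Proof. exact: le_trans (ler0n _ 32) A_ge32. Qed.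

Lemma sum_coef_le : q * \sum_k c k 3 ^+ 2 <= broken_seminorm J v ^+ 2.
Proof.
have h k : q * c k 3 ^+ 2 <= \int[leb2]_(x in KI k) (\sum_(i < 2) pderiv i v x ^+ 2).
  by apply: le_trans (cell_coef_le (J_shape k) (@vE k)); rewrite /coercivity mulrAC.
rewrite /broken_seminorm sqr_sqrtr; first by rewrite mulr_sumr; exact: ler_sum.
by apply: sumr_ge0 => k _; apply: le_trans (h k); rewrite mulr_ge0 ?sqr_ge0 // ltW.
Qed.

Lemma mesh_size_ge0 : 0 <= mesh_size J.
Proof.
rewrite /mesh_size; apply: (big_ind (fun t => 0 <= t)) => // [x y x0 y0|k _]; first by rewrite le_max x0.
exact: cell_diam_ge0.
Qed.

Lemma consistency_le (zeta : 'I_2 -> R * R -> R) : (forall i, H1 Omega (zeta i)) ->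
  (forall i, \int[leb2]_(x in Omega) (zeta i x * G i x) +
    \int[leb2]_(x in Omega) (wderiv Omega i (zeta i) x * w x) = 0) ->
  consistency Omega J zeta v <=
    8 * A / Num.sqrt q * mesh_size J * norm_H1v Omega zeta * broken_seminorm J v.
Proof.
move=> Hz h0; set S := \sum_k c k 3 ^+ 2; set B := broken_seminorm J v; set h := mesh_size J.
have m0 : 0 <= h := mesh_size_ge0.
have B0 : 0 <= B by exact: sqrtr_ge0.
have s0 : 0 < Num.sqrt q by rewrite sqrtr_gt0.
set T := A * (2 * h) * (B / Num.sqrt q).
have T0 : 0 <= T by rewrite !mulr_ge0 // invr_ge0 ltW.
have ST (f : R * R -> R) : sqnorm_L2 Omega f <= (A * (2 * h)) ^+ 2 * S -> Num.sqrt (sqnorm_L2 Omega f) <= T.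
  move=> hf; apply: sqrt_le => //; apply: le_trans hf _.
  rewrite [T ^+ 2]exprMn; apply: ler_wpM2l; first exact: sqr_ge0.
  rewrite expr_div_n (sqr_sqrtr (ltW q0)).
  rewrite ler_pdivlMr; last exact: q0.
  rewrite mulrC.
  exact: sum_coef_le.
pose Fg (i : 'I_2) k x := comp i (cell_fun_grad (K k) (c k) x) - comp i (cell_poly_grad (K k) (c k) x).
pose Fb k x := cell_fun (K k) (c k) x - cell_poly (K k) (c k) x.
have [] := @interior_sum_sqnorm Fb A A0.
- by move=> k; apply: measurable_funB; apply: continuous_measurable2 => //;
    [exact: cell_fun_continuous|exact: cell_poly_continuous].
- move=> k x /interior_subset Kx; rewrite /Fb /cell_fun addrC addKr normrM mulrC ler_wpM2r //.
  exact: le_trans (bubbles_le (ca_cb_lt1 _) (cell_ref Kx)) A_ge32.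
move=> b2 /ST bT.
have hg i := @interior_sum_sqnorm (Fg i) A A0.
have {}hg i : L2 Omega (fun x => \sum_k \1_(KI k) x * Fg i k x) /\
    Num.sqrt (sqnorm_L2 Omega (fun x => \sum_k \1_(KI k) x * Fg i k x)) <= T.
  have [] := hg i; last by move=> g2 /ST.
  - move=> k; have [h1 h2] := cell_fun_grad_measurable (K k) (c k) mO.
    have [h3 h4] := cell_poly_grad_continuous (K k) (c k).
    by rewrite /Fg; case: (i == 0); apply: measurable_funB => //; exact: continuous_measurable2.
  - move=> k x /interior_subset Kx; have [h1 h2] := cell_bubbles_grad_le (J_shape k) (J_par k) Kx.
    have E u u' : `|u| <= A -> u' = c k 3 * u -> `|u'| <= A * `|c k 3|.
      by move=> hu ->; rewrite normrM mulrC ler_wpM2r.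
    rewrite /Fg /cell_fun_grad; case: (i == 0).
      by apply: E (le_trans h1 A_ge) _; rewrite /= addrC addKr.
    by apply: E (le_trans h2 A_ge) _; rewrite /= addrC addKr.
rewrite (@consistency_bubbles zeta Hz h0 (fun i x => \sum_k \1_(KI k) x * Fg i k x)
  (fun x => \sum_k \1_(KI k) x * Fb k x)) //.
- set N := norm_H1v Omega zeta.
  have zN i : sqnorm_H1 Omega (zeta i) <= \sum_(j < 2) sqnorm_H1 Omega (zeta j).
    rewrite (bigD1 i) //= lerDl; apply: sumr_ge0 => j _.
    by apply: le_trans (sqnorm_L2_le Omega (zeta j)); exact: sqnorm_L2_ge0.
  have N1 i : Num.sqrt (sqnorm_L2 Omega (zeta i)) <= N.
    by apply: ler_wsqrtr; apply: le_trans (zN i); exact: sqnorm_L2_le.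
  have N2 i : Num.sqrt (sqnorm_L2 Omega (wderiv Omega i (zeta i))) <= N.
    by apply: ler_wsqrtr; apply: le_trans (zN i); exact: sqnorm_wderiv_le.
  have N0 : 0 <= N by exact: sqrtr_ge0.
  (* The final factor 8: two components, two integrals for each, and the 2 of [2 * h] in [T], which
     comes from the measure of a cell. *)
  rewrite -sumrN; apply: (@le_trans _ _ (\sum_(i < 2) 2 * (N * T))); last first.
    rewrite sumr_const card_ord -mulr_natl le_eqVlt; apply/orP; left; apply/eqP.
    by rewrite /T -/h -/B; field; rewrite lt0r_neq0.
  apply: ler_sum => i _; rewrite mulr_natl mulr2n.
  apply: le_trans (ler_norm _) _; rewrite normrN; apply: le_trans (ler_normD _ _) _; apply: lerD.
    apply: le_trans (cauchy_schwarz mO (Hz i).1 (hg i).1) _; apply: ler_pM; rewrite ?sqrtr_ge0 ?N1 //.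
    exact: (hg i).2.
  apply: le_trans (cauchy_schwarz mO (wderivP i (Hz i)).1 b2) _; apply: ler_pM; rewrite ?sqrtr_ge0 ?N2 //.
- by move=> i; exact: (hg i).1.
- by move=> i k x ix; rewrite (interior_sumE J_grid (fun k => Fg i k x) ix).
- by move=> k x ix; rewrite (interior_sumE J_grid (fun k => Fb k x) ix).
Qed.

End Consistency.

(** * Coefficients of a QBL function *)

Section QBL.
Context {R : realType}.
Variables (Omega : set (R * R)) (J : grid R) (v : R * R -> R).
Local Notation K := (cell J).
Local Notation KI k := (interior (cell_set (K k))).

Lemma VQBL_coef : VQBL Omega J v -> exists c : 'I_(ncells J) -> 'I_4 -> R,
  (forall k x, KI k x -> v x = cell_poly (K k) (c k) x) /\
  forall k l i j, k != l -> edge (K k) i = edge (K l) j ->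
    cell_poly (K k) (c k) (vtx (K k) i) = cell_poly (K l) (c l) (vtx (K k) i) /\
    cell_poly (K k) (c k) (vtx (K k) (i + 1)) = cell_poly (K l) (c l) (vtx (K k) (i + 1)).
Proof.
move=> [_ hv ht].
have /choice[c cE] (k : 'I_(ncells J)) : exists c : 'I_4 -> R,
    forall x, KI k x -> v x = cell_poly (K k) c x.
  have [c0 [c1 [c2 [c3 h]]]] := hv k.
  by exists (fun i : 'I_4 => nth 0 [:: c0; c1; c2; c3] i) => x /h ->.
exists c; split=> // k l i j kl e; have [h1 h2] := ht k l i j kl e.
rewrite (vtrace_cell_poly _ (cE k)) in h1; rewrite (vtrace_cell_poly _ (cE k)) in h2.
(* Traces on the second cell are known at its own vertices, so the end points of the common edge are
   first matched, in either order. *)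
by rewrite h1 h2; have [[-> ->]|[-> ->]] := edge_endpoints e; rewrite !(vtrace_cell_poly _ (cE l)).
Qed.

End QBL.

Theorem theorem19 (R : realType) (Omega : set (R * R))
    (I : Type) (J : I -> grid R) :
  lipschitz_domain Omega -> simply_connected Omega ->
  (forall t, is_grid_of Omega (J t)) ->
  regular_family J -> asymptotically_parallelogram J ->
  exists C : R, forall (t : I) (zeta : 'I_2 -> R * R -> R) (v : R * R -> R),
    ((forall i, H1 Omega (zeta i)) /\ VQBL0 Omega (J t) v) \/
    ((forall i, H10 Omega (zeta i)) /\ VQBL Omega (J t) v) ->
    consistency Omega (J t) zeta v <=
      C * mesh_size (J t) * norm_H1v Omega zeta * broken_seminorm (J t) v.
Proof.
move=> [oO _ _ [M [_ hM]] lO] _ gJ [sigma hs] [kappa hk].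
(* Boundedness provides a bound by every number larger than [M], hence [M + 1]. *)
have Omega_le x : Omega x -> `|x| <= M + 1 by move=> Ox; apply: hM => //; rewrite ltrDl.
have reg := lipschitz_boundary_regular oO lO.
(* The estimates need a positive [sigma], which the bound on shape numbers does not give when there
   are no cells. *)
have s0 : 0 < Num.max sigma 1 by rewrite lt_max ltr01 orbT.
exists (8 * bubble_bound (Num.max sigma 1) kappa / Num.sqrt (coercivity (Num.max sigma 1))) => t zeta v hv.
have Hz i : H1 Omega (zeta i) by case: hv => -[hz _]; [exact: hz|exact: (hz i).1].
have QBL : VQBL Omega (J t) v by case: hv => -[_ //] [].
have [c [cE compat]] := VQBL_coef QBL; have [v2 _ _] := QBL.
have sh k : shape_number (cell (J t) k) <= Num.max sigma 1 by rewrite le_max hs.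
apply: (consistency_le oO reg Omega_le (gJ t) v2 cE s0 sh (hk t) Hz) => i.
case: hv => -[hz hv]; last exact: (glued_identity_H10 oO reg Omega_le (gJ t) compat i (hz i)).
apply: (glued_identity_H1 oO reg Omega_le (gJ t) compat i (hz i)) => k j b.
have [h1 h2] := hv.2 k j b; rewrite !(vtrace_cell_poly _ (cE k)) in h1 h2.
by split.
Qed.
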